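(* Let $\Omega\subset\mathbb{R}^d$ be bounded open with Lebesgue measure $m$, and let $W$ satisfy Assumption B. For every $\boldsymbol{\mu}\in\mathcal{M}_{\pi_1\to m}(\Omega\times\mathbb{R}^q)$, $$\mathcal{T}_{E,\mathrm{Eul}}(\boldsymbol{\mu})=\sup_\varphi\Big\{-\int_{\Omega\times\mathbb{R}^q}\big(\nabla_x\cdot\varphi+W^*(\nabla_y\varphi)\big)\,d\boldsymbol{\mu}\ :\ \varphi\in C^1_c(\Omega\times\mathbb{R}^q,\mathbb{R}^d),\ W^*(\nabla_y\varphi)<+\infty\text{ on }\Omega\times\mathbb{R}^q\Big\}.$$
   Context: Assumption B: $W:\mathbb{R}^{qd}\to[0,+\infty)$ (on $q\times d$ matrices) is convex, finite everywhere, and $W(v)\ge C_1|v|^p-C_2$ for some $p\in[1,\infty)$, $C_1>0$, $C_2\ge0$ and some norm $|\cdot|$. $W'_\infty(v)=\lim_{t\to\infty}W(tv)/t$ is its recession function and $W^*(r)=\sup_v(r\cdot v-W(v))$ its Legendre transform ($\cdot$ is the Frobenius scalar product). $\mathcal{M}_{\pi_1\to m}(\Omega\times\mathbb{R}^q)$ is the set of non-negative finite Borel measures on $\Omega\times\mathbb{R}^q$ with first marginal $m$. For $\boldsymbol{\mu}\ge0$ and $J\in\mathcal{M}(\Omega\times\mathbb{R}^q)^{qd}$ with Radon–Nikodym decomposition $J=v\boldsymbol{\mu}+J^\perp$: $\mathcal{B}_W(\boldsymbol{\mu},J)=\int W(v)\,d\boldsymbol{\mu}+\int W'_\infty(dJ^\perp/d|J^\perp|)\,d|J^\perp|$.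 $\mathcal{T}_{E,\mathrm{Eul}}(\boldsymbol{\mu})=\inf\{\mathcal{B}_W(\boldsymbol{\mu},J):J\in\mathcal{M}(\Omega\times\mathbb{R}^q)^{qd},\ \nabla_x\boldsymbol{\mu}+\nabla_y\cdot J=0\}$, where the equation means $\int\nabla_x\cdot\varphi\,d\boldsymbol{\mu}+\int\nabla_y\varphi\cdot dJ=0$ for all smooth compactly supported $\varphi:\Omega\times\mathbb{R}^q\to\mathbb{R}^d$. Here $\nabla_x\cdot\varphi=\sum_{j=1}^d\partial_{x_j}\varphi_j$ and $\nabla_y\varphi$ denotes the $q\times d$ matrix $(\partial_{y_i}\varphi_j)_{1\le i\le q,1\le j\le d}$. *)

(* Defs.v *)
From HB Require Import structures.
From mathcomp Require Import all_boot all_order all_algebra.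
From mathcomp Require Import all_classical all_reals all_analysis.

Set Implicit Arguments.
Unset Strict Implicit.
Unset Printing Implicit Defensive.

Import Order.TTheory GRing.Theory Num.Theory.
Import numFieldNormedType.Exports.

Local Open Scope classical_set_scope.
Local Open Scope ring_scope.

Section Defs.
Context {R : realType}.

Definition Xsp (d q : nat) := ('rV[R]_d * 'rV[R]_q)%type.

Definition BorelRV (d : nat) := g_sigma_algebraType (@open 'rV[R]_d).
Definition BorelX (d q : nat) := g_sigma_algebraType (@open (Xsp d q)).

Definition frob {q d : nat} (r v : 'M[R]_(q, d)) : R :=
  \sum_(i < q) \sum_(j < d) r i j * v i j.

Definition frobnorm {q d : nat} (v : 'M[R]_(q, d)) : R := Num.sqrt (frob v v).

Definition is_norm {q d : nat} (N : 'M[R]_(q, d) -> R) : Prop :=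
  [/\ forall v, 0 <= N v,
      forall v, N v = 0 -> v = 0,
      forall (a : R) v, N (a *: v) = `|a| * N v
    & forall u v, N (u + v) <= N u + N v].

Definition AssumptionB {q d : nat} (W : 'M[R]_(q, d) -> R) : Prop :=
  [/\ (forall v, 0 <= W v),
      (forall (u v : 'M[R]_(q, d)) (t : R), 0 <= t <= 1 ->
          W (t *: u + (1 - t) *: v) <= t * W u + (1 - t) * W v)
    & exists (p C1 C2 : R) (N : 'M[R]_(q, d) -> R),
        [/\ 1 <= p, 0 < C1, 0 <= C2, is_norm N &
            forall v, C1 * (N v `^ p) - C2 <= W v]].

Definition Wrec {q d : nat} (W : 'M[R]_(q, d) -> R) (v : 'M[R]_(q, d)) : \bar R :=
  lim ((W (t *: v) / t)%:E @[t --> +oo]).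

Definition Wstar {q d : nat} (W : 'M[R]_(q, d) -> R) (r : 'M[R]_(q, d)) : \bar R :=
  ereal_sup [set (frob r v - W v)%:E | v in [set: 'M[R]_(q, d)]].

Definition cyl {d q : nat} (Om : set 'rV[R]_d) : set (Xsp d q) :=
  Om `*` [set: 'rV[R]_q].

Fixpoint Ck {V W : normedModType R} (k : nat) (f : V -> W) : Prop :=
  match k with
  | 0 => continuous f
  | k'.+1 => (forall p, differentiable f p) /\
             (forall w : V, Ck k' (fun p => derive f p w))
  end.

Definition smooth {V W : normedModType R} (f : V -> W) := forall k, Ck k f.

Definition fsupport {V W : normedModType R} (f : V -> W) : set V :=
  closure [set p | f p != 0].

Definition compact_support_in {V W : normedModType R} (O : set V) (f : V -> W) :=
  compact (fsupport f) /\ fsupport f `<=` O.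

Definition divx {d q : nat} (phi : Xsp d q -> 'rV[R]_d) (p : Xsp d q) : R :=
  \sum_(j < d) (derive phi p (delta_mx 0 j, 0)) 0 j.

Definition grady {d q : nat} (phi : Xsp d q -> 'rV[R]_d) (p : Xsp d q)
  : 'M[R]_(q, d) :=
  \matrix_(i < q, j < d) (derive phi p (0, delta_mx 0 i)) 0 j.

Local Open Scope ereal_scope.

Definition charge_on {d q : nat} (J : {charge set BorelX d q -> \bar R})
  (S : set (Xsp d q)) : Prop :=
  forall A : set (BorelX d q), measurable A -> A `<=` ~` S -> J A = 0.

Definition charge_int {d q : nat} (J : {charge set BorelX d q -> \bar R})
  (f : Xsp d q -> R) : \bar R :=
  let P := projT1 (cid (Hahn_decomposition J)) in
  let N := projT1 (cid (projT2 (cid (Hahn_decomposition J)))) in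
  let H := projT2 (cid (projT2 (cid (Hahn_decomposition J)))) in
  \int[jordan_pos H]_p (f p)%:E - \int[jordan_neg H]_p (f p)%:E.

(** (v, sigma, theta) is the Radon-Nikodym decomposition of J w.r.t. mu:
    J = v mu + J^perp,  J^perp = theta |J^perp|  with sigma = |J^perp|,
    theta = dJ^perp / d|J^perp| of (Frobenius) norm one, and J^perp
    singular w.r.t. mu. *)
Definition RN_decomp {d q : nat} (mu : {measure set BorelX d q -> \bar R})
  (J : 'I_q -> 'I_d -> {charge set BorelX d q -> \bar R})
  (v : BorelX d q -> 'M[R]_(q, d))
  (sigma : {measure set BorelX d q -> \bar R})
  (theta : BorelX d q -> 'M[R]_(q, d)) : Prop :=
  [/\ (forall i j, [/\ measurable_fun setT (fun p => v p i j),
                   mu.-integrable setT (fun p => (v p i j)%:E) &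
                   measurable_fun setT (fun p => theta p i j)]),
      sigma setT < +oo,
      (exists N0 : set (BorelX d q), [/\ measurable N0, sigma N0 = 0 &
          forall p, ~ N0 p -> frobnorm (theta p) = 1%R]),
      (exists N : set (BorelX d q), [/\ measurable N, mu N = 0 &
          sigma (~` N) = 0]) &
      (forall (A : set (BorelX d q)), measurable A -> forall i j,
          J i j A = \int[mu]_(p in A) (v p i j)%:E
                    + \int[sigma]_(p in A) (theta p i j)%:E)].

Definition BW {d q : nat} (W : 'M[R]_(q, d) -> R)
  (mu : {measure set BorelX d q -> \bar R})
  (J : 'I_q -> 'I_d -> {charge set BorelX d q -> \bar R}) : \bar R :=
  ereal_inf [set c | exists v sigma theta,
      RN_decomp mu J v sigma theta /\
      c = \int[mu]_p (W (v p))%:E + \int[sigma]_p Wrec W (theta p)].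

(** weak continuity equation  nabla_x mu + nabla_y . J = 0  on Omega x R^q *)
Definition cont_eq {d q : nat} (Om : set 'rV[R]_d)
  (mu : {measure set BorelX d q -> \bar R})
  (J : 'I_q -> 'I_d -> {charge set BorelX d q -> \bar R}) : Prop :=
  forall phi : Xsp d q -> 'rV[R]_d,
    smooth phi -> compact_support_in (cyl Om) phi ->
    \int[mu]_p (divx phi p)%:E
      + \sum_(i < q) \sum_(j < d) charge_int (J i j) (fun p => grady phi p i j)
    = 0.

Definition TEul {d q : nat} (Om : set 'rV[R]_d) (W : 'M[R]_(q, d) -> R)
  (mu : {measure set BorelX d q -> \bar R}) : \bar R :=
  ereal_inf [set BW W mu J | J in
    [set J | (forall i j, charge_on (J i j) (cyl Om)) /\ cont_eq Om mu J]].

Definition dual_value {d q : nat} (Om : set 'rV[R]_d) (W : 'M[R]_(q, d) -> R)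
  (mu : {measure set BorelX d q -> \bar R}) : \bar R :=
  ereal_sup [set - \int[mu]_p ((divx phi p)%:E + Wstar W (grady phi p)) | phi in
    [set phi : Xsp d q -> 'rV[R]_d | [/\ Ck 1 phi,
        compact_support_in (cyl Om) phi &
        forall p, cyl Om p -> Wstar W (grady phi p) < +oo]]].

Definition box {d : nat} (a b : 'rV[R]_d) : set 'rV[R]_d :=
  [set x | forall j, (a 0 j <= x 0 j <= b 0 j)%R].

Definition is_lebesgue {d : nat} (lam : {measure set BorelRV d -> \bar R}) :=
  forall a b : 'rV[R]_d, (forall j, a 0 j <= b 0 j)%R ->
    lam (box a b) = (\prod_(j < d) (b 0 j - a 0 j))%:E.

Definition marginal_leb {d q : nat} (Om : set 'rV[R]_d)
  (lam : {measure set BorelRV d -> \bar R})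
  (mu : {measure set BorelX d q -> \bar R}) : Prop :=
  [/\ mu setT < +oo,
      mu (~` (cyl Om : set (BorelX d q))) = 0 &
      forall A : set (BorelRV d), measurable A ->
        mu (A `*` [set: 'rV[R]_q] : set (BorelX d q)) = lam (A `&` Om)].

End Defs.

(* Main.v *)
(* Weak duality is Fenchel-Young, once the continuity equation is extended from
   smooth to C^1 test functions.  That needs a C^1-approximation by smooth
   functions; it is done without convolutions, by gluing first-order Taylor
   polynomials with a smooth partition of unity on a grid.

   For strong duality let S be the supremum, assumed finite.  On continuous
   compactly supported matrix fields r, the convex function
     r |-> inf_phi S + int (div_x phi + W^*(r + grad_y phi)) dmu
   is nonnegative at 0, so Hahn-Banach gives a linear functional l below it.
   Then l(grad_y phi) = - int div_x phi dmu and l(r) <= S + int W^*(r) dmu.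
   Since W^* is bounded near 0, l is bounded, and by Riesz it is integration
   against a matrix of charges J, which solves the continuity equation.

   It remains to see that B_W(mu, J) <= S, i.e. to exchange supremum and
   integral.  W and its recession function are suprema of countably many affine,
   resp. linear, functions given by the same slopes r_n, with intercepts
   c_n = W^*(r_n).  Fields switching between finitely many r_n on Borel sets are
   L^1-limits of continuous ones for which the field with its W^* bound stays
   admissible by convexity, and monotone convergence concludes. *)

Require Import Defs.
From HB Require Import structures.
From mathcomp Require Import all_boot all_order all_algebra.
From mathcomp Require Import all_classical all_reals all_analysis.
From mathcomp Require Import measurable_realfun ring lra.

Set Implicit Arguments.
Unset Strict Implicit.
Unset Printing Implicit Defensive.

Import Order.TTheory GRing.Theory Num.Theory.
Import numFieldNormedType.Exports.

Local Open Scope classical_set_scope.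
Local Open Scope ring_scope.

(** * Convexity and Legendre transforms *)

(** Growth of order [p = 1] is allowed, and this shapes the proof. [Wstar] may then be [+oo] away
    from 0, and an optimal flux may have a part singular to [mu]. So the linear functional can be
    controlled only on the small ball where [Wstar] is bounded, whose radius comes from the growth
    constants, and the dual object has to be a measure. Since [Wstar] of a field may be infinite,
    the Hahn-Banach step carries bounded measurable majorants [w] of it, and convex functions enter
    through their epigraphs. The exchange of supremum and integral has to serve two integrands at
    once, [W] against [mu] and the recession function against the variation of the singular part.
    Both have the same slopes and differ only by the intercepts, so one field is optimised for the
    sum of the two measures, with the intercepts switched off on a [mu]-null set carrying the
    singular part. The reduction to countably many slopes gives measurability, and a greedy choice
    among finitely many of them takes the place of a measurable selection. *)

Section HahnBanach.
Context {R : realType} {V : lmodType R}.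

Definition linear_on (D : set V) (l : V -> R) :=
  forall a x y, D x -> D y -> l (a *: x + y) = a * l x + l y.

Definition subspace_set (D : set V) :=
  D 0 /\ forall a x y, D x -> D y -> D (a *: x + y).

(* Hahn-Banach in epigraph form: [C x c] reads [F x <= c] for a convex [F]
   with [0 <= F 0], finite near [0] along every line of [D]. *)
Lemma convex_linear_minorant (D : set V) (C : V -> R -> Prop) :
  subspace_set D ->
  (forall t x y c c', 0 <= t <= 1 -> C x c -> C y c' ->
     C (t *: x + (1 - t) *: y) (t * c + (1 - t) * c')) ->
  (forall c, C 0 c -> 0 <= c) ->
  (forall x, D x -> exists t c, 0 < t /\ C (t *: x) c) ->
  exists l : V -> R, linear_on D l /\ forall x c, D x -> C x c -> l x <= c.
Proof.
move=> [D0 Dlin] Cconv C0 Cabs.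
(* Partial functionals are represented by their graphs, so the union bounds a chain.
   Single-valuedness is not part of [P]; it follows from domination by [C] in [Gfun0]. *)
pose P (G : set (V * R)) := [/\ (forall u, G u -> D u.1),
  (forall a u v, G u -> G v -> G (a *: u.1 + v.1, a * u.2 + v.2)) &
  (forall u c, G u -> C u.1 c -> u.2 <= c)].
have [F FP Ftot|G [PG Gmax]] := @Zorn_bigcup (V * R)%type P.
  split.
  - by move=> u [G FG Gu]; have [h _ _] := FP _ FG; exact: h.
  - move=> a u v [G FG Gu] [H FH Hv]; have [GH|HG] := Ftot _ _ FG FH.
      exists H => //; have [_ h _] := FP _ FH; apply: h => //; exact: GH.
    exists G => //; have [_ h _] := FP _ FG; apply: h => //; exact: HG.
  - by move=> u c [G FG Gu]; have [_ _ h] := FP _ FG; exact: h.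
have [GD Glin GC] := PG.
(* The empty graph also satisfies [P]. A graph without this point is empty, and then adding the
   point contradicts maximality. *)
have G0 : G (0, 0).
  apply: contrapT => nG0; apply: (Gmax (G `|` [set (0, 0)])).
    by split=> [u|h]; [left|apply/nG0/h; right].
  have nGu u : ~ G u.
    move=> Gu; apply: nG0.
    have := Glin (-1) _ _ Gu Gu.
    by rewrite scaleN1r mulN1r !addNr.
  split.
  - by move=> u [/nGu//|->].
  - move=> a u v [/nGu//|->] [/nGu//|->]; right.
    by rewrite /= scaler0 mulr0 !addr0.
  - by move=> u c [/nGu//|->] /=; exact: C0.
have Gscale a u : G u -> G (a *: u.1, a * u.2).
  by move=> Gu; have := Glin a _ _ Gu G0; rewrite !addr0.
have Gfun0 a : G (0, a) -> a = 0.
  move=> Ga; have [t [c [t0 Cc]]] := Cabs 0 D0; rewrite scaler0 in Cc.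
  have ha k : k * a <= c.
    have := Gscale k _ Ga; rewrite /= scaler0 => /GC; exact.
  apply/eqP/negPn/negP => a0.
  by have := ha ((c + 1) / a); rewrite divfK//; lra.
have Gfun x a b : G (x, a) -> G (x, b) -> a = b.
  move=> Ga Gb; apply/eqP; rewrite -subr_eq0; apply/eqP/Gfun0.
  by have := Glin (-1) _ _ Gb Ga; rewrite /= scaleN1r addNr mulN1r addrC.
have Gdom x0 : D x0 -> exists a, G (x0, a).
  move=> Dx0; apply: contrapT => nG.
  pose L := [set r | exists y b s c', [/\ G (y, b), 0 < s,
     C (y - s *: x0) c' & r = (b - c') / s]].
  (* The classical inequality between lower and upper candidates for the value at [x0]: the weights
     [s / (s + t)] and [t / (s + t)] cancel [x0], leaving a point over which [G] is already
     dominated. *)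
  have LU y b s c' x a t c : G (y, b) -> 0 < s -> C (y - s *: x0) c' ->
     G (x, a) -> 0 < t -> C (x + t *: x0) c ->
     (b - c') / s <= (c - a) / t.
    move=> Gy s0 Cy Gx t0 Cx.
    have st0 : 0 < s + t by rewrite addr_gt0.
    have st1 : s + t != 0 by rewrite gt_eqF.
    have h := Cconv (s / (s + t)) _ _ _ _ _ Cx Cy.
    have e1 : 1 - s / (s + t) = t / (s + t) by field.
    have h01 : 0 <= s / (s + t) <= 1.
      by rewrite divr_ge0 ?(ltW s0) ?(ltW st0)//= ler_pdivrMr// mul1r lerDl ltW.
    have := h h01; rewrite {}e1.
    have Gm : G ((s / (s + t)) *: x + (t / (s + t)) *: y,
                 s / (s + t) * a + t / (s + t) * b).
      by apply: (Glin _ (x, a) (_, _)) => //; exact: (Gscale _ (y, b)).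
    have -> : (s / (s + t)) *: (x + t *: x0) + (t / (s + t)) *: (y - s *: x0)
      = (s / (s + t)) *: x + (t / (s + t)) *: y.
      rewrite !scalerDr !scalerN !scalerA addrACA -scalerBl.
      have -> : s / (s + t) * t - t / (s + t) * s = 0 by field.
      by rewrite scale0r addr0.
    move/(GC _ _ Gm) => /= hh.
    have {}hh : s * a + t * b <= s * c + t * c'.
      move: hh; rewrite -(ler_pM2r st0) !mulrDl.
      have -> : s / (s + t) * a * (s + t) = s * a by field.
      have -> : t / (s + t) * b * (s + t) = t * b by field.
      have -> : s / (s + t) * c * (s + t) = s * c by field.
      by have -> : t / (s + t) * c' * (s + t) = t * c' by field.
    by rewrite ler_pdivrMr// mulrAC ler_pdivlMr//; nra.
  have [t [c [t0 Ct]]] := Cabs _ Dx0.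
  have Dmx0 : D (- x0) by have := Dlin (-1) _ _ Dx0 D0; rewrite scaleN1r addr0.
  have [s [c' [s0 Cs]]] := Cabs _ Dmx0.
  have L0 : L !=set0.
    exists ((0 - c') / s), 0, 0, s, c'; split => //.
    by rewrite sub0r -scalerN.
  have Lub : has_ubound L.
    exists ((c - 0) / t) => _ [y [b [s1 [c1 [Gy s10 Cy ->]]]]].
    by apply: (LU _ _ _ _ 0 0 t c Gy s10 Cy G0 t0); rewrite add0r.
  pose al := sup L.
  pose H := [set u | exists x a r, G (x, a) /\ u = (x + r *: x0, a + r * al)].
  apply: (Gmax H).
    split=> [[x a] Gx|h].
      by exists x, a, 0; split => //; rewrite scale0r mul0r !addr0.
    apply: nG; exists al; apply: h.
    by exists 0, 0, 1; split => //; rewrite scale1r mul1r !add0r.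
  split.
  - move=> _ [x [a [r [Gx ->]]]] /=; rewrite addrC; apply: Dlin => //.
    exact: (GD _ Gx).
  - move=> k _ _ [x [a [r [Gx ->]]]] [y [b [r' [Gy ->]]]] /=.
    exists (k *: x + y), (k * a + b), (k * r + r'); split.
      exact: (Glin _ _ _ Gx Gy).
    congr pair; last by ring.
    by rewrite scalerDr scalerDl scalerA addrACA.
  - move=> _ cc [x [a [r [Gx ->]]]] /= Cx.
    have [r0|r0|r0] := ltgtP r 0; last first.
    + by move: Cx; rewrite r0 scale0r mul0r !addr0; exact: (GC _ _ Gx).
    + suff : al <= (cc - a) / r by rewrite ler_pdivlMr//; nra.
      apply: ge_sup => // _ [y [b [s1 [c1 [Gy s10 Cy ->]]]]].
      exact: (LU _ _ _ _ _ _ _ _ Gy s10 Cy Gx r0 Cx).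
    + suff : (a - cc) / (- r) <= al.
        rewrite ler_pdivrMr ?oppr_gt0//; nra.
      apply: ub_le_sup => //; exists x, a, (- r), cc; split => //.
        by rewrite oppr_gt0.
      by rewrite scaleNr opprK.
pose l x := if pselect (D x) is left Dx then projT1 (cid (Gdom x Dx)) else 0.
have Gl x : D x -> G (x, l x).
  by move=> Dx; rewrite /l; case: pselect => // Dx'; case: cid.
exists l; split.
  move=> a x y Dx Dy; apply: (Gfun (a *: x + y)); first exact/Gl/Dlin.
  exact: (Glin _ _ _ (Gl _ Dx) (Gl _ Dy)).
by move=> x c Dx; exact: (GC _ _ (Gl _ Dx)).
Qed.

End HahnBanach.

Lemma lipschitz_cts {R : realType} (V : normedModType R) (f : V -> R) (K : R) :
  (forall u w, `|f u - f w| <= K * `|u - w|) -> continuous f.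
Proof.
move=> fK u; apply/cvgrPdist_lt => e e0.
have K1 : 0 < `|K| + 1 by rewrite ltr_wpDl.
near=> w; apply: le_lt_trans (fK _ _) _.
have : `|u - w| < e / (`|K| + 1).
  by near: w; apply: cvgr_dist_lt; [exact: cvg_id|exact: divr_gt0].
rewrite ltr_pdivlMr// mulrC; apply: le_lt_trans.
by rewrite ler_wpM2r// (le_trans (ler_norm _))// lerDl.
Unshelve. all: by end_near. Qed.

(** * Matrices with the Frobenius product, and equivalence of norms *)

Section Frob.
Context {R : realType} {q d : nat}.
Local Notation M := 'M[R]_(q, d).
Implicit Types r v : M.

Lemma frobC r v : frob r v = frob v r.
Proof. by apply: eq_bigr => i _; apply: eq_bigr => j _; rewrite mulrC. Qed.

Lemma frobDr r u v : frob r (u + v) = frob r u + frob r v.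
Proof.
rewrite -big_split; apply: eq_bigr => i _; rewrite -big_split.
by apply: eq_bigr => j _; rewrite mxE mulrDr.
Qed.

Lemma frobZr r a v : frob r (a *: v) = a * frob r v.
Proof.
rewrite mulr_sumr; apply: eq_bigr => i _; rewrite mulr_sumr.
by apply: eq_bigr => j _; rewrite mxE mulrCA.
Qed.

Lemma frobDl r s v : frob (r + s) v = frob r v + frob s v.
Proof. by rewrite frobC frobDr !(frobC v). Qed.

Lemma frobZl r a v : frob (a *: r) v = a * frob r v.
Proof. by rewrite frobC frobZr (frobC v). Qed.

Lemma frob0r r : frob r 0 = 0.
Proof. by rewrite -(scale0r 0) frobZr mul0r. Qed.

Lemma frob0l v : frob 0 v = 0.
Proof. by rewrite frobC frob0r. Qed.

Lemma frobNr r v : frob r (- v) = - frob r v.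
Proof. by rewrite -scaleN1r frobZr mulN1r. Qed.

Lemma frobBr r u v : frob r (u - v) = frob r u - frob r v.
Proof. by rewrite frobDr frobNr. Qed.

Lemma frob_ge0 v : 0 <= frob v v.
Proof. by apply: sumr_ge0 => i _; apply: sumr_ge0 => j _; rewrite -expr2 sqr_ge0. Qed.

Lemma abs_coord_frobnorm v i j : `|v i j| <= frobnorm v.
Proof.
rewrite /frobnorm -sqrtr_sqr ler_wsqrtr// /frob (bigD1 i)//= (bigD1 j)//=.
rewrite expr2 -addrA lerDl addr_ge0// sumr_ge0// => [k _|k _].
  by rewrite -expr2 sqr_ge0.
by apply: sumr_ge0 => l _; rewrite -expr2 sqr_ge0.
Qed.

Lemma frobnorm_eq0 v : frobnorm v = 0 -> v = 0.
Proof.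
move=> v0; apply/matrixP => i j; rewrite mxE; apply/eqP.
by rewrite -normr_eq0 eq_le normr_ge0 andbT -v0 abs_coord_frobnorm.
Qed.

Lemma frobnormZ a v : frobnorm (a *: v) = `|a| * frobnorm v.
Proof.
by rewrite /frobnorm frobZl frobZr mulrA -expr2 sqrtrM ?sqr_ge0// sqrtr_sqr.
Qed.

Lemma frobnorm_le_sum v : frobnorm v <= \sum_i \sum_j `|v i j|.
Proof.
have S0 : 0 <= \sum_i \sum_j `|v i j|.
  by apply: sumr_ge0 => i _; apply: sumr_ge0.
rewrite -(ler_pXn2r (n := 2))// ?nnegrE ?sqrtr_ge0//.
rewrite sqr_sqrtr ?frob_ge0// [leRHS]expr2 mulr_suml.
apply: ler_sum => i _; rewrite mulr_suml; apply: ler_sum => j _.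
rewrite -expr2 -real_normK ?num_real// expr2 ler_wpM2l//.
rewrite (bigD1 i)//= (bigD1 j)//= -addrA lerDl addr_ge0// ?sumr_ge0// => k _.
exact: sumr_ge0.
Qed.

Lemma linear_frob (l : M -> R) : linear_on setT l ->
  exists r, forall v, l v = frob r v.
Proof.
move=> ll.
have l0 : l 0 = 0.
  by have := ll 1 0 0 I I; rewrite scaler0 addr0 mul1r => e; lra.
have lD u v : l (u + v) = l u + l v by have := ll 1 u v I I; rewrite scale1r mul1r.
have lZ a u : l (a *: u) = a * l u.
  by have := ll a u 0 I I; rewrite addr0 l0 addr0.
have lsum I (s : seq I) (F : I -> M) : l (\sum_(i <- s) F i) = \sum_(i <- s) l (F i).
  exact: (big_morph l lD l0).
exists (\matrix_(i, j) l (delta_mx i j)) => v.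
rewrite {1}(matrix_sum_delta v) lsum; apply: eq_bigr => i _.
rewrite lsum; apply: eq_bigr => j _.
by rewrite lZ mxE mulrC.
Qed.

Lemma le_abs_frob r v c : (forall i j, `|r i j| <= c) ->
  `|frob r v| <= c * \sum_i \sum_j `|v i j|.
Proof.
move=> rc; rewrite mulr_sumr; apply: le_trans (ler_norm_sum _ _ _) _.
apply: ler_sum => i _; rewrite mulr_sumr; apply: le_trans (ler_norm_sum _ _ _) _.
by apply: ler_sum => j _; rewrite normrM ler_wpM2r.
Qed.

(** Equivalence of norms: [N] is Lipschitz, so it attains a positive minimum on the unit sphere.
    Matrices are flattened with [mxvec] to work with row vectors. *)
Lemma norm_lower_bound (N : M -> R) : is_norm N ->
  exists2 C : R, 0 < C & forall v, \sum_i \sum_j `|v i j| <= C * N v.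
Proof.
move=> [N0 Neq0 NZ ND].
have NN0 : N 0 = 0 by rewrite -(scale0r 0) NZ normr0 mul0r.
have Nsum I (s : seq I) (F : I -> M) : N (\sum_(i <- s) F i) <= \sum_(i <- s) N (F i).
  elim: s => [|i s IH]; first by rewrite !big_nil NN0.
  by rewrite !big_cons; apply: le_trans (ND _ _) _; rewrite lerD2l.
pose K := \sum_(i < q) \sum_(j < d) N (delta_mx i j).
have K0 : 0 <= K by apply: sumr_ge0 => i _; apply: sumr_ge0.
pose f (u : 'rV[R]_(q * d)) := N (vec_mx u).
have coordle n (u : 'rV[R]_n) j : `|u 0 j| <= `|u|.
  by rewrite [leRHS]/Num.norm /= mx_normrE; apply/bigmax_geP; right; exists (0, j).
have Nle u : f u <= K * `|u|.
  rewrite /f {1}(matrix_sum_delta (vec_mx u)); apply: le_trans (Nsum _ _ _) _.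
  rewrite /K mulr_suml; apply: ler_sum => i _; apply: le_trans (Nsum _ _ _) _.
  rewrite mulr_suml; apply: ler_sum => j _.
  by rewrite NZ mulrC ler_wpM2l// mxE.
have NB u w : `|f u - f w| <= f (u - w).
  have fN x : f (- x) = f x by rewrite /f raddfN /= -scaleN1r NZ normrN1 mul1r.
  have fD x y : f (x + y) <= f x + f y by rewrite /f raddfD /=.
  have h1 := fD (u - w) w; have h2 := fD (w - u) u.
  rewrite !subrK in h1 h2; rewrite -opprB fN in h2.
  by rewrite ler_norml; apply/andP; split; lra.
have fc : continuous f.
  apply: (@lipschitz_cts _ _ _ K) => u w; exact: le_trans (NB _ _) (Nle _).
pose A := [set u : 'rV[R]_(q * d) | `|u| = 1].
(* The sphere is empty when [q] or [d] is 0; then every matrix is 0. *)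
have [[u0 Au0]|A0] := pselect (A !=set0); last first.
  exists 1 => // v.
  suff -> : v = 0.
    rewrite big1 ?mul1r// => i _; rewrite big1// => j _; by rewrite mxE normr0.
  apply: contrapT => v0; apply: A0; exists (`|mxvec v|^-1 *: mxvec v).
  rewrite /A /= normrZ normfV normr_id mulVf// normr_eq0.
  by apply/eqP => h; apply: v0; rewrite -(mxvecK v) h linear0.
have [|||c Ac cmin] := @EVT_min_rV R _ f A.
- by exists u0.
- apply: bounded_closed_compact.
    by exists 1; split => // x x1 u /= ->; exact: ltW.
  have -> : A = Num.norm @^-1` [set 1] by [].
  by apply: closed_comp => [u _|]; [exact: norm_continuous|exact: closed_eq].
- exact: continuous_subspaceT.
have fc0 : 0 < f c.
  rewrite lt_def N0 andbT; apply/eqP => /Neq0 h.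
  by have := set_mem Ac; rewrite /A/= -(vec_mxK c) h linear0 normr0 => /eqP; rewrite eq_sym oner_eq0.
exists ((q * d)%:R * (f c)^-1 + 1).
  by rewrite ltr_wpDl// mulr_ge0// invr_ge0 ltW.
move=> v; have [->|v0] := eqVneq v 0.
  by rewrite NN0 mulr0 big1// => i _; rewrite big1// => j _; rewrite mxE normr0.
have mv0 : mxvec v != 0.
  by apply/eqP => h; move/eqP: v0; apply; rewrite -(mxvecK v) h linear0.
have nv0 : 0 < `|mxvec v| by rewrite normr_gt0.
have h : `|mxvec v| <= (f c)^-1 * N v.
  have := cmin (`|mxvec v|^-1 *: mxvec v).
  rewrite inE /A/= normrZ normfV normr_id mulVf ?gt_eqF// => /(_ erefl).
  rewrite /f linearZ /= NZ normfV normr_id mxvecK => h.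
  by rewrite ler_pdivlMl// -ler_pdivlMr// mulrC.
apply: (@le_trans _ _ ((q * d)%:R * `|mxvec v|)).
  rewrite pair_bigA /=.
  apply: le_trans (_ : \sum_(p : 'I_q * 'I_d) `|mxvec v| <= _).
    apply: ler_sum => p _.
    have -> : v p.1 p.2 = mxvec v 0 (mxvec_index p.1 p.2) by rewrite mxvecE.
    exact: coordle.
  by rewrite sumr_const card_prod !card_ord mulr_natl.
rewrite mulrDl mul1r -mulrA.
by apply: ler_wpDr => //; apply: ler_wpM2l.
Qed.

End Frob.

(** * Finite convex functions: subgradients, continuity, countable families of tangents *)

Section ConvexW.
Context {R : realType} {q d : nat}.
Local Notation M := 'M[R]_(q, d).
Implicit Types (W : M -> R) (r v : M).

Definition convexM W := forall (u v : M) (t : R), 0 <= t <= 1 ->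
  W (t *: u + (1 - t) *: v) <= t * W u + (1 - t) * W v.

(** Hahn-Banach for the increment [W (v + x) - W v], which vanishes at 0 and is finite in every
    direction. *)
Lemma exists_subgradient W v : convexM W ->
  exists r, forall u, W v + frob r (u - v) <= W u.
Proof.
move=> cW.
have [||||l [ll lC]] := @convex_linear_minorant R M setT
  (fun x c => W (v + x) - W v <= c).
- by split.
- move=> t x y c c' t01 xc yc'.
  have -> : v + (t *: x + (1 - t) *: y) = t *: (v + x) + (1 - t) *: (v + y).
    rewrite !scalerDr addrACA -scalerDl.
    by have -> : t + (1 - t) = 1 by [ring]; rewrite scale1r.
  have := cW (v + x) (v + y) t t01; have /andP[t0 t1] := t01.
  have h1 : t * (W (v + x) - W v) <= t * c by rewrite ler_wpM2l.
  have h2 : (1 - t) * (W (v + y) - W v) <= (1 - t) * c'.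
    by rewrite ler_wpM2l// subr_ge0.
  by nra.
- by move=> c; rewrite addr0 subrr.
- by move=> x _; exists 1, (W (v + 1 *: x) - W v); rewrite lexx ltr01.
have [r lr] := linear_frob ll; exists r => u.
have := lC (u - v) _ I (lexx _).
have -> : v + (u - v) = u by rewrite addrCA subrr addr0.
by rewrite lr; lra.
Qed.

Lemma convex_half W u v : convexM W -> W (u + v) <= (W (2 *: u) + W (2 *: v)) / 2.
Proof.
move=> cW; have := cW (2 *: u) (2 *: v) 2^-1.
have -> : 1 - 2^-1 = 2^-1 :> R by field.
rewrite !scalerA mulVf// !scale1r => h.
apply: le_trans (h _) _; last by lra.
by apply/andP; split; lra.
Qed.

Lemma convexM_shift W v : convexM W -> convexM (fun u => W (v + u) - W v).
Proof.
move=> cW u u' t t01.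
have -> : v + (t *: u + (1 - t) *: u') = t *: (v + u) + (1 - t) *: (v + u').
  rewrite !scalerDr addrACA -scalerDl.
  by have -> : t + (1 - t) = 1 by [ring]; rewrite scale1r.
have := cW (v + u) (v + u') t t01; lra.
Qed.

(** On each axis convexity between 0 and the two unit points gives a linear bound, and [convex_half]
    adds one coordinate at a time at the price of doubling the arguments. *)
Lemma convex_small_sum (F : M -> R) (s : seq ('I_q * 'I_d)) : convexM F -> F 0 = 0 ->
  forall e : R, 0 < e -> exists2 dl : R, 0 < dl & forall u : M,
   (forall p, p \in s -> `|u p.1 p.2| <= dl) ->
   F (\sum_(p <- s) u p.1 p.2 *: delta_mx p.1 p.2) <= e.
Proof.
move=> cF F0; elim: s => [e e0|p s IH e e0].
  by exists 1 => // u _; rewrite big_nil F0 ltW.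
have [dl dl0 H] := IH _ e0.
pose E : M := delta_mx p.1 p.2.
pose K := `|F E| + `|F (- E)| + 1.
have K0 : 0 < K by rewrite ltr_wpDl// addr_ge0.
have oneD t : `|t| <= 1 -> F (t *: E) <= `|t| * K.
  move=> t1; have [t0|t0] := leP 0 t.
    have := cF E 0 t; rewrite scaler0 addr0 F0 mulr0 addr0 t0/=.
    rewrite ger0_norm// in t1 *; move=> /(_ t1) /le_trans; apply.
    by rewrite ler_wpM2l// (le_trans (ler_norm _))// /K -addrA lerDl addr_ge0.
  have := cF (- E) 0 (- t); rewrite scaler0 addr0 F0 mulr0 addr0 oppr_ge0 (ltW t0)/=.
  rewrite ltr0_norm// in t1 *; rewrite scaleNr scalerN opprK => /(_ t1) /le_trans; apply.
  rewrite ler_wpM2l// ?oppr_ge0 ?(ltW t0)// (le_trans (ler_norm _))//.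
  by rewrite /K (addrC `|F E|) -addrA lerDl addr_ge0.
(* Each bound anticipates the doubling: [dl / 2] for the remaining coordinates, [1 / 2] to stay in
   the range of [oneD], and [e / (2 * K)] so that [oneD] yields at most [e]. *)
exists (Num.min (dl / 2) (Num.min (1 / 2) (e / (2 * K)))).
  by rewrite !lt_min; apply/and3P; split; rewrite divr_gt0// mulr_gt0.
move=> u hu; rewrite big_cons.
apply: le_trans (convex_half _ _ cF) _.
have : `|u p.1 p.2| <= Num.min (dl / 2) (Num.min (1 / 2) (e / (2 * K))).
  by apply: hu; rewrite mem_head.
rewrite !le_min => /and3P[_ u1 u2].
have h1 : F (2 *: (u p.1 p.2 *: E)) <= e.
  rewrite scalerA; apply: le_trans (oneD _ _) _.
    by rewrite normrM ger0_norm//; lra.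
  rewrite normrM ger0_norm//.
  by move: u2; rewrite ler_pdivlMr ?mulr_gt0//; lra.
have h2 : F (2 *: \sum_(j <- s) u j.1 j.2 *: delta_mx j.1 j.2) <= e.
  have -> : 2 *: \sum_(j <- s) u j.1 j.2 *: delta_mx j.1 j.2 =
     \sum_(j <- s) (2 *: u) j.1 j.2 *: delta_mx j.1 j.2.
    by rewrite scaler_sumr; apply: eq_bigr => j _; rewrite mxE scalerA.
  apply: H => j js; rewrite mxE normrM ger0_norm//.
  have : `|u j.1 j.2| <= Num.min (dl / 2) (Num.min (1 / 2) (e / (2 * K))).
    by apply: hu; rewrite in_cons js orbT.
  by rewrite le_min => /andP[+ _]; lra.
by rewrite -/E; lra.
Qed.

(** An upper bound near [v] suffices: convexity at the midpoint of [u] and [- u] converts it into a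
    lower bound. *)
Lemma convex_continuous W v : convexM W ->
  forall e : R, 0 < e -> exists2 dl : R, 0 < dl & forall u : M,
   (forall i j, `|u i j| <= dl) -> `|W (v + u) - W v| <= e.
Proof.
move=> cW e e0.
have cF := convexM_shift v cW.
set F := fun u => _ in cF.
have F0 : F 0 = 0 by rewrite /F addr0 subrr.
have [dl dl0 H] := convex_small_sum (index_enum ('I_q * 'I_d)%type) cF F0 e0.
have H' (u : M) : (forall i j, `|u i j| <= dl) -> F u <= e.
  move=> ul; rewrite (matrix_sum_delta u) pair_bigA /=.
  by apply: H => p _; exact: ul.
exists dl => // u ul; rewrite -/(F u).
have Fu := H' _ ul.
have FNu : F (- u) <= e by apply: H' => i j; rewrite mxE normrN.
have : F 0 <= (F u + F (- u)) / 2.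
  have := cF u (- u) (2^-1).
  have -> : 1 - 2^-1 = 2^-1 :> R by field.
  rewrite -scalerDr subrr scaler0 => h; apply: le_trans (h _) _; last by lra.
  by apply/andP; split; lra.
rewrite F0 ler_norml => h; apply/andP; split; lra.
Qed.

Lemma Fenchel_Young W r v : (forall v, 0 <= W v) ->
  ((frob r v - W v)%:E <= Wstar W r)%E.
Proof. by move=> W0; apply: ereal_sup_ubound; exists v. Qed.

Definition ratM (n : nat) : M :=
  if unpickle n is Some m then map_mx ratr (m : 'M[rat]_(q, d)) else 0.

Lemma ratM_dense v (e : R) : 0 < e -> exists n, forall i j, `|v i j - ratM n i j| <= e.
Proof.
move=> e0.
have /choice[m mP] : forall p : 'I_q * 'I_d, exists y : rat, `|v p.1 p.2 - ratr y| <= e.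
  move=> p; have := @rat_in_itvoo R (v p.1 p.2 - e) (v p.1 p.2 + e).
  case=> [|y]; first by lra.
  rewrite in_itv /= => /andP[y1 y2]; exists y.
  by rewrite ler_norml; apply/andP; split; lra.
exists (pickle (\matrix_(i, j) m (i, j))) => i j.
by rewrite /ratM pickleK !mxE; exact: (mP (i, j)).
Qed.

(** The family consists of tangents at rational points, where [Wstar] of the slope is attained. A
    tangent at [z] near [v] almost reaches [W v] whatever its slope: evaluated at the reflected
    point [v + 2 *: (z - v)] it lies below [W], which bounds [frob (r n) (z - v)] from above. *)
Lemma convex_countable_sup W : convexM W -> (forall v, 0 <= W v) ->
  exists (r : nat -> M) (c : nat -> R),
    (forall n, Wstar W (r n) = (c n)%:E) /\
    forall v (e : R), 0 < e -> exists n, W v - e <= frob (r n) v - c n.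
Proof.
move=> cW W0.
have [r rP] := choice (fun n => exists_subgradient (ratM n) cW).
exists r, (fun n => frob (r n) (ratM n) - W (ratM n)); split.
  move=> n; apply/eqP; rewrite eq_le; apply/andP; split; last exact: Fenchel_Young.
  apply: ge_ereal_sup => _ [v _ <-]; rewrite lee_fin.
  by have := rP n v; rewrite frobBr; lra.
move=> v e e0.
have [dl dl0 H] := @convex_continuous W v cW _ (divr_gt0 e0 (ltr0Sn R 3)).
have [n nP] := ratM_dense v (divr_gt0 dl0 (ltr0Sn R 1)).
exists n; set z := ratM n in nP *.
have h1 : `|W z - W v| <= e / 4.
  have -> : z = v + (z - v) by rewrite addrCA subrr addr0.
  by apply: H => i j; rewrite !mxE distrC (le_trans (nP i j))//; lra.
have h2 : `|W (v + 2 *: (z - v)) - W v| <= e / 4.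
  apply: H => i j; rewrite !mxE normrM ger0_norm// distrC.
  by have := nP i j; lra.
have := rP n (v + 2 *: (z - v)); rewrite -/z.
have -> : v + 2 *: (z - v) - z = z - v.
  by rewrite scaler_nat mulr2n addrA [v + (z - v)]addrCA subrr addr0 [LHS]addrC addKr.
rewrite frobBr.
move: h1 h2; rewrite !ler_norml => /andP[? ?] /andP[? ?]; lra.
Qed.

End ConvexW.

(** * Legendre transform near 0, and the recession function as a supremum of slopes *)

Section Recession.
Context {R : realType} {q d : nat}.
Local Notation M := 'M[R]_(q, d).
Implicit Types (W : M -> R) (r v : M).

(** Since [p >= 1], the [p]-th power of [N v] is at least [N v - 1], so [W v] is at least
    [C1 * N v - (C1 + C2)]. Entries of size [C1 / C], with [C] from [norm_lower_bound], keep
    [frob r v] below [C1 * N v]. *)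
Lemma Wstar_near0 W : AssumptionB W ->
  exists c0 K : R, 0 < c0 /\ forall r, (forall i j, `|r i j| <= c0) ->
    (Wstar W r <= K%:E)%E.
Proof.
move=> [W0 _ [p [C1 [C2 [N [p1 C10 C20 HN HW]]]]]].
have [C C0 HC] := norm_lower_bound HN; have [N0 _ _ _] := HN.
exists (C1 / C), (C1 + C2); split; first exact: divr_gt0.
move=> r hr; apply: ge_ereal_sup => _ [v _ <-]; rewrite lee_fin.
have h1 := le_trans (ler_norm _) (le_abs_frob v hr).
have h2 : C1 / C * (\sum_i \sum_j `|v i j|) <= C1 * N v.
  rewrite -mulrA ler_wpM2l ?(ltW C10)// ler_pdivrMl//; exact: HC.
have h3 : N v - 1 <= N v `^ p.
  have [Nv1|Nv1] := leP (N v) 1.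
    by apply: (@le_trans _ _ 0); [lra|exact: powR_ge0].
  apply: (@le_trans _ _ (N v `^ 1)); first by rewrite powRr1//; lra.
  by apply: ler_powR => //; exact: ltW.
have := HW v.
have : C1 * (N v - 1) <= C1 * N v `^ p by rewrite ler_wpM2l// ltW.
lra.
Qed.

Lemma Wstar0_le0 W : (forall v, 0 <= W v) -> (Wstar W 0 <= 0)%E.
Proof.
move=> W0; apply: ge_ereal_sup => _ [v _ <-].
by rewrite lee_fin frob0l sub0r oppr_le0.
Qed.

Section WithSup.
Variables (W : M -> R) (r : nat -> M) (c : nat -> R).
Hypothesis (rc : forall n, Wstar W (r n) = (c n)%:E).
Hypothesis (Wsup : forall v (e : R), 0 < e -> exists n, W v - e <= frob (r n) v - c n).

Let rcW n v : frob (r n) v - c n <= W v.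
Proof.
suff : frob (r n) v - W v <= c n by lra.
by rewrite -lee_fin -rc; apply: ereal_sup_ubound; exists v.
Qed.

(** Evaluating the affine minorants at 0 gives [- c n <= W 0], a bound on the intercepts that is
    uniform in [n]. *)
Lemma recession_sup_ub th (x t : R) : (forall n, frob (r n) th <= x) -> 0 < t ->
  W (t *: th) / t <= x + W 0 / t.
Proof.
move=> hx t0; rewrite ler_pdivrMr// mulrDl divfK ?gt_eqF//.
apply/ler_addgt0Pr => e e0.
have [n] := Wsup (t *: th) e0; rewrite frobZr => h.
have := rcW n 0; rewrite frob0r.
have : t * frob (r n) th <= t * x by rewrite ler_wpM2l// ltW.
lra.
Qed.

(** The quotient lies between [frob (r n) th - c n / t], for each [n], and [x + W 0 / t] for any
    upper bound [x] of the slopes, and the constant terms vanish as [t] grows. In particular the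
    limit in [Wrec] exists, possibly as [+oo]. *)
Lemma Wrec_supE th :
  Wrec W th = ereal_sup (range (fun n => (frob (r n) th)%:E)).
Proof.
set s := ereal_sup _.
have sge n : ((frob (r n) th)%:E <= s)%E by apply: ereal_sup_ubound; exists n.
have lb n t : 0 < t -> frob (r n) th - c n / t <= W (t *: th) / t.
  move=> t0; rewrite ler_pdivlMr// mulrBl divfK ?gt_eqF// mulrC -frobZr; exact: rcW.
apply/cvg_lim => //.
case Es : s => [x| |]; last by have := sge 0%N; rewrite Es leeNy_eq.
- have xub n : frob (r n) th <= x by rewrite -lee_fin -Es.
  apply: cvg_EFin; first by near=> t.
  apply/cvgrPdist_le => e e0.
  have [_ [n _ <-]] : exists2 y, range (fun n => (frob (r n) th)%:E) y &
      ((x - e / 2)%:E < y)%E.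
    by apply: ereal_sup_gt; rewrite -/s Es lte_fin; lra.
  rewrite lte_fin => hn.
  near=> t.
  have t0 : 0 < t by [].
  have h1 := recession_sup_ub xub t0; have h2 := lb n t t0.
  have h3 : W 0 / t <= e.
    by rewrite ler_pdivrMr// mulrC -ler_pdivrMr//; near: t; apply: nbhs_pinfty_ge; rewrite num_real.
  have h4 : c n / t <= e / 2.
    by rewrite ler_pdivrMr// mulrC -ler_pdivrMr ?divr_gt0//; near: t; apply: nbhs_pinfty_ge; rewrite num_real.
  by rewrite /= ler_norml; apply/andP; split; lra.
- apply/cvgeyPge => A.
  have [_ [n _ <-]] : exists2 y, range (fun n => (frob (r n) th)%:E) y &
      ((A + 1)%:E < y)%E.
    by apply: ereal_sup_gt; rewrite -/s Es ltry.
  rewrite lte_fin => hn; near=> t; rewrite lee_fin.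
  have t0 : 0 < t by [].
  have h2 := lb n t t0.
  have h4 : c n / t <= 1.
    by rewrite ler_pdivrMr// mul1r; near: t; apply: nbhs_pinfty_ge; rewrite num_real.
  lra.
Unshelve. all: by end_near. Qed.

(** The Fenchel-Young inequality for singular parts: along the ray [t *: th] the inequality
    [frob s v - C <= W v] loses its constant after division by a large [t]. *)
Lemma frob_le_Wrec s th : (Wstar W s < +oo)%E -> ((frob s th)%:E <= Wrec W th)%E.
Proof.
move=> sy; rewrite Wrec_supE; set S := ereal_sup _.
have sge n : ((frob (r n) th)%:E <= S)%E by apply: ereal_sup_ubound; exists n.
case ES : S => [x| |]; last 2 first.
- exact: leey.
- by have := sge 0%N; rewrite ES leeNy_eq.
have xub n : frob (r n) th <= x by rewrite -lee_fin -ES.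
have [C hC] : exists C, (Wstar W s <= C%:E)%E.
  by case: (Wstar W s) sy => [y| |]// _; [exists y; rewrite lexx|exists 0; rewrite leNye].
have hs v : frob s v - C <= W v.
  suff : frob s v - W v <= C by lra.
  rewrite -lee_fin; apply: le_trans hC.
  by apply: ereal_sup_ubound; exists v.
rewrite lee_fin; apply/ler_addgt0Pr => e e0.
pose t := (`|W 0 + C| + 1) / e.
have t0 : 0 < t by rewrite divr_gt0// ltr_wpDl.
have := recession_sup_ub xub t0; have := hs (t *: th); rewrite frobZr => h1.
rewrite ler_pdivrMr// mulrDl divfK ?gt_eqF// => h2.
have h3 : e * t = `|W 0 + C| + 1 by rewrite /t mulrC divfK// gt_eqF.
have h4 := ler_norm (W 0 + C).
rewrite -(ler_pM2l t0); lra.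
Qed.

End WithSup.
End Recession.

(** * A Riesz representation theorem *)

Lemma nneseries_sup {R : realType} (u : nat -> \bar R) : (forall n, 0 <= u n)%E ->
  (\sum_(n <oo) u n = ereal_sup (range (fun N => \sum_(0 <= n < N) u n)))%E.
Proof.
move=> u0; apply/cvg_lim => //; apply: ereal_nondecreasing_cvgn.
by apply: ereal_nondecreasing_series => n _ _.
Qed.

Section CompactSupport.
Context {R : realType} {T : topologicalType} (O : set T).
Implicit Types f g h : T -> R.

(** Asking for some compact set off which [f] vanishes, instead of a condition on the closed
    support, makes stability under sums and maxima a union of two compact sets. *)
Definition cc f := continuous f /\
  exists K, [/\ compact K, K `<=` O & forall x, ~ K x -> f x = 0].

Definition pcc f := cc f /\ forall x, 0 <= f x.

Lemma cc0 : cc (fun=> 0).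
Proof.
split; first by move=> x; exact: cvg_cst.
by exists set0; split => //; exact: compact0.
Qed.

Lemma cc_out f x : cc f -> ~ O x -> f x = 0.
Proof. by move=> [_ [K [_ KO fK]]] nO; apply: fK => /KO. Qed.

Lemma ccD f g : cc f -> cc g -> cc (fun x => f x + g x).
Proof.
move=> [fc [K [cK KO fK]]] [gc [L [cL LO gL]]]; split.
  by move=> x; apply: cvgD; [exact: fc|exact: gc].
exists (K `|` L); split; [exact: compactU|by move=> x [/KO|/LO]|].
by move=> x /not_orP[/fK -> /gL ->]; rewrite addr0.
Qed.

Lemma cc_mulr f h : continuous h -> cc f -> cc (fun x => f x * h x).
Proof.
move=> hc [fc [K [cK KO fK]]]; split.
  by move=> x; apply: cvgM; [exact: fc|exact: hc].
by exists K; split => // x /fK ->; rewrite mul0r.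
Qed.

Lemma ccZ a f : cc f -> cc (fun x => a * f x).
Proof.
move=> fc; have := cc_mulr (h := fun=> a) _ fc.
under [fun x => f x * a]eq_fun do rewrite mulrC.
by apply => x; exact: cvg_cst.
Qed.

Lemma ccB f g : cc f -> cc g -> cc (fun x => f x - g x).
Proof.
move=> hf hg; have := ccD hf (ccZ (-1) hg).
by under [fun x => f x + _]eq_fun do rewrite mulN1r.
Qed.

Lemma cc_max f g : cc f -> cc g -> cc (fun x => Num.max (f x) (g x)).
Proof.
move=> [fc [K [cK KO fK]]] [gc [L [cL LO gL]]]; split.
  by move=> x; apply: continuous_max; [exact: fc|exact: gc].
exists (K `|` L); split; [exact: compactU|by move=> x [/KO|/LO]|].
by move=> x /not_orP[/fK -> /gL ->]; rewrite maxxx.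
Qed.

Lemma cc_minr f h : continuous h -> (forall x, 0 <= h x) -> cc f ->
  cc (fun x => Num.min (f x) (h x)).
Proof.
move=> hc h0 [fc [K [cK KO fK]]]; split.
  by move=> x; apply: continuous_min; [exact: fc|exact: hc].
by exists K; split => // x /fK ->; exact: min_l.
Qed.

Lemma cc_sum (I : Type) (s : seq I) (F : I -> T -> R) :
  (forall i, cc (F i)) -> cc (fun x => \sum_(i <- s) F i x).
Proof.
move=> cF; elim: s => [|i s IH].
  by under eq_fun do rewrite big_nil; exact: cc0.
by under eq_fun do rewrite big_cons; exact: ccD.
Qed.

Lemma cc_bounded f : cc f -> exists2 B : R, 0 <= B & forall x, `|f x| <= B.
Proof.
move=> [fc [K [cK KO fK]]].
have [B [Br HB]] : bounded_set (f @` K).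
  by apply/compact_bounded/continuous_compact => //; exact: continuous_subspaceT.
exists (`|B| + 1) => [|x]; first by rewrite addr_ge0.
have [Kx|/fK ->] := pselect (K x); last by rewrite normr0 addr_ge0.
apply: HB; last by exists x.
by rewrite (le_lt_trans (ler_norm _))// ltrDl.
Qed.

Lemma pcc0 : pcc (fun=> 0).
Proof. by split; [exact: cc0|]. Qed.

Lemma pccD f g : pcc f -> pcc g -> pcc (fun x => f x + g x).
Proof. by move=> [cf f0] [cg g0]; split => [|x]; [exact: ccD|exact: addr_ge0]. Qed.

Lemma pccZ a f : 0 <= a -> pcc f -> pcc (fun x => a * f x).
Proof. by move=> a0 [cf f0]; split => [|x]; [exact: ccZ|exact: mulr_ge0]. Qed.

Lemma pcc_mulr f h : continuous h -> (forall x, 0 <= h x) -> pcc f ->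
  pcc (fun x => f x * h x).
Proof.
by move=> hc h0 [cf f0]; split => [|x]; [exact: cc_mulr|exact: mulr_ge0].
Qed.

Lemma pcc_sum (I : Type) (s : seq I) (F : I -> T -> R) :
  (forall i, pcc (F i)) -> pcc (fun x => \sum_(i <- s) F i x).
Proof.
move=> cF; split; first by apply: cc_sum => i; exact: (cF i).1.
by move=> x; apply: sumr_ge0 => i _; exact: (cF i).2.
Qed.

(** Starting from the zero function makes the partial sums of the increments [h k.+1 - h k] equal to
    [h K], so that the increments form a partition of unity on [U]. *)
Definition exhaustion (U : set T) (h : nat -> T -> R) :=
  [/\ forall n, continuous (h n) /\ exists K, [/\ compact K, K `<=` U &
                  forall x, ~ K x -> h n x = 0],
      forall n x, 0 <= h n x <= 1,
      forall n x, h n x <= h n.+1 x, forall x, h 0 x = 0 &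
      forall x, U x -> h n x @[n --> \oo] --> (1 : R)].

End CompactSupport.

Section PositiveFunctional.
Context {R : realType} {T : topologicalType} (O : set T).
Variable I : (T -> R) -> R.
Local Notation pcc := (@pcc R T O).

(** Additivity is required on the cone of nonnegative functions only, which is where the positive
    part of a signed functional is defined. The last clause is what makes the representing measure
    finite. *)
Definition pos_functional := [/\
  (forall f, pcc f -> 0 <= I f),
  (forall f g, pcc f -> pcc g -> I (fun x => f x + g x) = I f + I g),
  (forall a f, 0 <= a -> pcc f -> I (fun x => a * f x) = a * I f) &
  exists2 C : R, 0 <= C & forall f B, pcc f -> (forall x, f x <= B) -> I f <= C * B].

Hypothesis HI : pos_functional.

Lemma pfun_ge0 f : pcc f -> 0 <= I f.
Proof. by case: HI => h _ _ _; exact: h. Qed.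

Lemma pfunD f g : pcc f -> pcc g -> I (fun x => f x + g x) = I f + I g.
Proof. by case: HI => _ h _ _; exact: h. Qed.

Lemma pfunZ a f : 0 <= a -> pcc f -> I (fun x => a * f x) = a * I f.
Proof. by case: HI => _ _ h _; exact: h. Qed.

Lemma pfun0 : I (fun=> 0) = 0.
Proof.
by have := pfunZ (lexx 0) (pcc0 O); rewrite !mul0r.
Qed.

Lemma pfun_sum J (s : seq J) (F : J -> T -> R) : (forall i, pcc (F i)) ->
  I (fun x => \sum_(i <- s) F i x) = \sum_(i <- s) I (F i).
Proof.
move=> cF; elim: s => [|i s IH].
  by rewrite big_nil -[RHS]pfun0; congr I; apply/funext => x; rewrite big_nil.
rewrite big_cons -IH -pfunD//; last exact: pcc_sum.
by congr I; apply/funext => x; rewrite big_cons.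
Qed.

Lemma pfun_le f g : pcc f -> pcc g -> (forall x, f x <= g x) -> I f <= I g.
Proof.
move=> pf pg fg.
have -> : g = (fun x => f x + (g x - f x)) by apply/funext => x; rewrite addrC subrK.
have pgf : pcc (fun x => g x - f x).
  by split => [|x]; [exact: ccB pg.1 pf.1|rewrite subr_ge0].
by rewrite pfunD// lerDl pfun_ge0.
Qed.

(** Dini's argument: by compactness some partial sum exceeds [g - e'] on the whole support of [g].
    The excess [Num.max (g x - S N x) 0] is then at most [e'], and the boundedness clause makes its
    value under [I] at most [C * e']. *)
Lemma pfun_Dini g (f : nat -> T -> R) : pcc g -> (forall n, pcc (f n)) ->
  (forall x, O x -> ((g x)%:E <= \sum_(n <oo) (f n x)%:E)%E) ->
  ((I g)%:E <= \sum_(n <oo) (I (f n))%:E)%E.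
Proof.
move=> pg pf gf.
have [_ _ _ [C C0 HC]] := HI.
apply/lee_addgt0Pr => e e0.
pose e' := e / (C + 1).
have C1 : 0 < C + 1 by rewrite ltr_wpDl.
have e'0 : 0 < e' by rewrite divr_gt0.
have [[gc [K [cK KO gK]]] g0] := pg.
pose S N x := \sum_(0 <= n < N) f n x.
have Snd x m n : (m <= n)%N -> S m x <= S n x.
  move=> mn; rewrite /S (big_cat_nat _ mn)//= lerDl sumr_ge0// => i _.
  exact: (pf i).2.
have Sc N : continuous (S N).
  have [] : cc O (S N) by apply: cc_sum => i; exact: (pf i).1.
  by [].
have [N HN] : exists N, forall x, K x -> g x < S N x + e'.
  have := (compact_near_coveringP K).1 cK.
  move=> /(_ nat \oo (fun N x => g x < S N x + e') _)[].
  - move=> x Kx.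
    have [N hN] : exists N, g x - e' < S N x.
      have : ((g x - e')%:E < \sum_(n <oo) (f n x)%:E)%E.
        by apply: lt_le_trans (gf x (KO _ Kx)); rewrite lte_fin ltrBlDr ltrDl.
      rewrite nneseries_sup => [/ereal_sup_gt[_ [N _ <-]]|n].
        by rewrite sumEFin lte_fin => h; exists N.
      by rewrite lee_fin (pf n).2.
    have nx : \forall x' \near x, 0 < S N x' + e' - g x'.
      have hc : {for x, continuous (fun x' => S N x' + e' - g x')}.
        by apply: cvgB; [apply: cvgD; [exact: Sc|exact: cvg_cst]|exact: gc].
      by apply: (cvgr_gt _ hc); lra.
    exists ([set x' | 0 < S N x' + e' - g x'], [set n | (N <= n)%N]).
      by split; [exact: nx|exists N].
    move=> [x' n] /= [h1 h2]; have := Snd x' _ _ h2; lra.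
  - by move=> N _ /(_ N (leqnn N)) h; exists N.
pose w x := Num.max (g x - S N x) 0.
have pS : pcc (S N) by exact: pcc_sum.
have pw : pcc w.
  by split => [|x]; [apply: cc_max (cc0 O); exact: ccB pg.1 pS.1|rewrite le_max lexx orbT].
have we x : w x <= e'.
  rewrite ge_max (ltW e'0) andbT.
  have [/HN|/gK ->] := pselect (K x); first by lra.
  by rewrite sub0r (le_trans _ (ltW e'0))// oppr_le0 pS.2.
have Igw : I g <= I (S N) + C * e'.
  apply: (@le_trans _ _ (I (fun x => S N x + w x))).
    apply: pfun_le => //; first exact: pccD.
    by move=> x; rewrite -lerBlDl le_max lexx.
  by rewrite pfunD// lerD2l HC.
apply: (@le_trans _ _ ((I (S N) + C * e')%:E)); first by rewrite lee_fin.
rewrite EFinD; apply: leeD.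
  rewrite pfun_sum// -sumEFin; apply: nneseries_lim_ge => n _ _.
  by rewrite lee_fin pfun_ge0.
by rewrite lee_fin /e' mulrA ler_pdivrMr// mulrC ler_wpM2l ?(ltW e0)// lerDl.
Qed.

End PositiveFunctional.

(** The enumeration comes before the array: the same one rearranges the values of functions at every
    point and the values of the functional. *)
Lemma nneseries_pair {R : realType} : exists e : nat -> nat * nat,
  forall a : nat -> nat -> \bar R, (forall i j, 0 <= a i j)%E ->
   (\sum_(n <oo) a (e n).1 (e n).2 = \sum_(i <oo) \sum_(j <oo) a i j)%E.
Proof.
have /card_esym/ppcard_eqP[f] := card_nat2.
exists f => a a0.
rewrite nneseries_esumT//.
rewrite -(@reindex_esum R nat (nat * nat)%type setT setT f (fun p => a p.1 p.2)); last first.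
  exact: bij.
rewrite nneseries_esumT; last by move=> i; apply: nneseries_ge0.
rewrite (_ : setT = [set: nat] `*`` (fun=> setT)); last by apply/seteqP.
rewrite -esum_esum//; apply: eq_esum => i _.
by rewrite nneseries_esumT.
Qed.

(** * The outer measure of a positive functional *)

Section RieszOuter.
Context {R : realType} {T : ptopologicalType} (O : set T).
Variable I : (T -> R) -> R.
Local Notation pcc := (@pcc R T O).
Hypothesis HI : pos_functional O I.
Local Open Scope ereal_scope.

(** Covering by countably many functions, rather than by open sets, makes countable subadditivity a
    rearrangement of double series. Points outside [O] cost nothing. *)
Definition fcover (A : set T) (f : nat -> T -> R) :=
  (forall n, pcc (f n)) /\ forall x, A x -> O x -> 1 <= \sum_(n <oo) (f n x)%:E.

Definition riesz_outer (A : set T) : \bar R :=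
  ereal_inf [set \sum_(n <oo) (I (f n))%:E | f in fcover A].

Let I0 f : pcc f -> 0 <= (I f)%:E.
Proof. by move=> pf; rewrite lee_fin (pfun_ge0 HI). Qed.

Lemma riesz_outer_ge0 A : 0 <= riesz_outer A.
Proof.
apply: le_ereal_inf_tmp => _ [f [pf _] <-].
by apply: nneseries_ge0 => n _ _; exact: I0.
Qed.

Lemma le_riesz_outer A B : A `<=` B -> riesz_outer A <= riesz_outer B.
Proof.
move=> AB; apply: ereal_inf_le_tmp => _ [f [pf fB] <-].
by exists f => //; split => // x /AB; exact: fB.
Qed.

Lemma riesz_outer0 : riesz_outer set0 = 0.
Proof.
apply/eqP; rewrite eq_le riesz_outer_ge0 andbT.
apply: ereal_inf_lbound; exists (fun _ _ => 0%R); first by split => // n; exact: pcc0.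
by rewrite eseries0// => n _ _; rewrite (pfun0 HI).
Qed.

Lemma fcover_adherent A e : riesz_outer A < +oo -> (0 < e)%R ->
  exists2 f, fcover A f & \sum_(n <oo) (I (f n))%:E <= riesz_outer A + e%:E.
Proof.
move=> Aoo e0.
have Afin : riesz_outer A \is a fin_num by rewrite ge0_fin_numE// riesz_outer_ge0.
have [_ [f fA <-] /ltW h] := lb_ereal_inf_adherent e0 Afin.
by exists f.
Qed.

Lemma riesz_outer_sigma_subadditive : sigma_subadditive riesz_outer.
Proof.
move=> A; have [[i ioo]|] := pselect (exists i, riesz_outer (A i) = +oo).
  rewrite (eseries_pinfty _ _ ioo) ?leey// => n _.
  by rewrite -ltNye (lt_le_trans _ (riesz_outer_ge0 _)).
rewrite -forallNE => Aoo.
apply/lee_addgt0Pr => e e0.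
apply: le_trans (epsilon_trick _ _ (ltW e0)); last by move=> n; exact: riesz_outer_ge0.
have /choice[G PG] : forall n, exists f, fcover (A n) f /\
    \sum_(k <oo) (I (f k))%:E <= riesz_outer (A n) + (e / (2 ^ n.+1)%:R)%:E.
  move=> n; have [||f fA h] := @fcover_adherent (A n) (e / (2 ^ n.+1)%:R)%R.
  - by rewrite ltey; apply/eqP/Aoo.
  - by rewrite divr_gt0.
  - by exists f.
have [s Hs] := @nneseries_pair R.
apply: (@le_trans _ _ (\sum_(i <oo) \sum_(j <oo) (I (G i j))%:E)).
  rewrite -Hs; last by move=> i j; apply: I0; exact: (PG i).1.1.
  apply: ereal_inf_lbound; exists (fun n => G (s n).1 (s n).2) => //.
  split; first by move=> n; exact: (PG _).1.1.
  move=> x [i _ Aix] Ox.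
  have G0 m j : 0 <= (G m j x)%:E by rewrite lee_fin; exact: ((PG m).1.1 j).2.
  rewrite (Hs (fun i j => (G i j x)%:E))//.
  apply: (le_trans ((PG i).1.2 x Aix Ox)).
  have N0 n : 0 <= \sum_(j <oo) (G n j x)%:E by apply: nneseries_ge0.
  apply: le_trans (nneseries_lim_ge i.+1 (fun n _ _ => N0 n)).
  by rewrite big_nat_recr//= leeDr// sume_ge0.
apply: lee_nneseries => [n _ _|n _]; last exact: (PG n).2.
by apply: nneseries_ge0 => k _ _; apply: I0; exact: (PG n).1.1.
Qed.

(** A cover of [X] is cut along the exhaustion of [A]. The pieces [g n k], over all [n] and [k],
    cover the part of [X] in [A]; for every finite [K] the remainders [c n K] cover the part
    outside, because [h K] vanishes there. Finite additivity gives equality of costs at each [K],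
    and a large [K] captures [S] up to [e / 2]. *)
Lemma riesz_outer_open (A X : set T) (h : nat -> T -> R) : exhaustion A h ->
  riesz_outer (X `&` A) + riesz_outer (X `&` ~` A) <= riesz_outer X.
Proof.
move=> [hc h01 hS h0 hA].
have [Xoo|] := ltP (riesz_outer X) +oo; last by move=> h'; apply: le_trans h'; exact: leey.
apply/lee_addgt0Pr => e e0.
have [f [pf fX] fe] := fcover_adherent Xoo (divr_gt0 e0 (ltr0Sn R 1)).
pose dl k x := (h k.+1 x - h k x)%R.
have dlc k : continuous (dl k).
  by move=> x; apply: cvgB; [exact: (hc k.+1).1|exact: (hc k).1].
have dl0 k x : (0 <= dl k x)%R by rewrite subr_ge0.
pose g n k x := (f n x * dl k x)%R.
have pg n k : pcc (g n k) by exact: pcc_mulr.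
have gh n K x : (\sum_(0 <= k < K) g n k x = f n x * h K x)%R.
  by rewrite -mulr_sumr telescope_sumr// h0 subr0.
pose c n K x := (f n x * (1 - h K x))%R.
have pc n K : pcc (c n K).
  apply: pcc_mulr => // x; last by rewrite subr_ge0; have /andP[] := h01 K x.
  by apply: cvgB; [exact: cvg_cst|exact: (hc K).1].
have If n K : (I (f n) = \sum_(0 <= k < K) I (g n k) + I (c n K))%R.
  rewrite -(pfun_sum HI)// -(pfunD HI)//; last exact: pcc_sum.
  by congr I; apply/funext => x; rewrite gh /c mulrBr mulr1 addrC subrK.
have Ig0 n k : 0 <= (I (g n k))%:E by exact: I0.
have S0 k : 0 <= \sum_(n <oo) (I (g n k))%:E by apply: nneseries_ge0.
pose S := \sum_(k <oo) \sum_(n <oo) (I (g n k))%:E.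
have XA : riesz_outer (X `&` A) <= S.
  have [s Hs] := @nneseries_pair R.
  rewrite /S -(Hs (fun k n => (I (g n k))%:E))//.
  apply: ereal_inf_lbound; exists (fun m => g (s m).2 (s m).1) => //.
  split => // x [Xx Ax] Ox.
  rewrite (Hs (fun k n => (g n k x)%:E)); last by move=> i j; rewrite lee_fin (pg _ _).2.
  rewrite nneseries_interchange; last by move=> i j; rewrite lee_fin (pg _ _).2.
  apply: le_trans (fX x Xx Ox) _.
  apply: lee_nneseries => [n _ _|n _]; first by rewrite lee_fin (pf n).2.
  rewrite le_eqVlt; apply/orP; left; apply/eqP/esym/cvg_lim => //.
  under eq_fun do rewrite sumEFin gh.
  apply: cvg_EFin; first by near=> k.
  rewrite -[X in _ --> X]mulr1; apply: cvgMr; exact: hA.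
have SK K : \sum_(0 <= k < K) \sum_(n <oo) (I (g n k))%:E +
    \sum_(n <oo) (I (c n K))%:E = \sum_(n <oo) (I (f n))%:E.
  rewrite -nneseries_sum_nat//.
  rewrite -nneseriesD; [|by move=> n _ _; apply: sume_ge0|by move=> n _ _; exact: I0].
  by apply: eq_eseriesr => n _; rewrite sumEFin -EFinD -If.
have XcA K : riesz_outer (X `&` ~` A) <= \sum_(n <oo) (I (c n K))%:E.
  apply: ereal_inf_lbound; exists (fun n => c n K) => //; split => // x [Xx nAx] Ox.
  apply: le_trans (fX x Xx Ox) _.
  apply: lee_nneseries => [n _ _|n _]; first by rewrite lee_fin (pf n).2.
  have [_ [L [_ LA hL]]] := hc K.
  by rewrite /c hL ?subr0 ?mulr1// => /LA.
have Sf : S <= \sum_(n <oo) (I (f n))%:E.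
  rewrite /S [leLHS]nneseries_sup//.
  apply: ge_ereal_sup => _ [K _ <-].
  by rewrite -(SK K) leeDl//; apply: nneseries_ge0 => n _ _; exact: I0.
have Sfin : S \is a fin_num.
  rewrite ge0_fin_numE; last by apply: nneseries_ge0 => k _ _; exact: nneseries_ge0.
  by rewrite (le_lt_trans Sf)// (le_lt_trans fe)// lte_add_pinfty// ltry.
have [K HK] : exists K, S - (e / 2)%:E < \sum_(0 <= k < K) \sum_(n <oo) (I (g n k))%:E.
  have : S - (e / 2)%:E < S by rewrite lteBlDr// lteDl// lte_fin divr_gt0.
  rewrite {2}/S [ltRHS]nneseries_sup//.
  by move=> /ereal_sup_gt[_ [K _ <-] hK]; exists K.
have e2 : e%:E = (e / 2)%:E + (e / 2)%:E by rewrite -EFinD -splitr.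
rewrite e2 addeA.
apply: le_trans (leeD fe (lexx _)).
rewrite -(SK K) addeAC; apply: leeD => //.
apply: le_trans XA _.
by move: HK; rewrite lteBlDr// => /ltW.
Unshelve. all: by end_near. Qed.

End RieszOuter.

HB.instance Definition _ (T U : ptopologicalType) := Pointed.on (T * U)%type.

Section BorelTop.
Context {R : realType} {T : ptopologicalType}.
Local Notation B := (g_sigma_algebraType (@open T)).

Lemma open_borel (A : set T) : open A -> measurable (A : set B).
Proof. by move=> oA; apply: sub_sigma_algebra. Qed.

Lemma closed_borel (A : set T) : closed A -> measurable (A : set B).
Proof.
by move=> cA; rewrite -(setCK A); apply: measurableC; apply: open_borel; exact: closed_openC.
Qed.

Lemma continuous_borel (f : T -> R) : continuous f ->
  measurable_fun [set: B] (f : B -> R).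
Proof.
move=> fc; apply: (measurability _ (RGenOInfty.measurableE R)).
move=> _ [_ [x ->] <-]; rewrite setTI; apply: open_borel.
by apply: open_comp => [y _|]; [exact: fc|exact: interval_open].
Qed.

End BorelTop.

(** * From the outer measure to the representation formula *)

Section RieszTheorem.
Context {R : realType} {T : ptopologicalType} (O : set T).
Variable I : (T -> R) -> R.
Local Notation pcc := (@pcc R T O).
Local Notation B := (g_sigma_algebraType (@open T)).
Hypothesis HI : pos_functional O I.
Hypothesis Hex : forall U : set T, open U -> exists h : nat -> T -> R, exhaustion U h.
Hypothesis HO : open O.
Local Open Scope ereal_scope.

Let I0 f : pcc f -> 0 <= (I f)%:E.
Proof. by move=> pf; rewrite lee_fin (pfun_ge0 HI). Qed.

(** Open sets are measurable in the sense of Caratheodory, hence so are Borel sets; the restriction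
    to them is a pushforward under the identity. *)
Lemma riesz_measure_exists : exists tau : {measure set B -> \bar R},
  forall A, tau A = riesz_outer O I A.
Proof.
pose mo : {outer_measure set T -> \bar R} := HB.pack (riesz_outer O I)
  (isOuterMeasure.Build R T _ (riesz_outer0 HI) (riesz_outer_ge0 HI)
     (@le_riesz_outer _ _ O I) (riesz_outer_sigma_subadditive HI)).
pose m : {measure set (caratheodory_type mo) -> \bar R} := mo.
pose f : caratheodory_type mo -> B := id.
have mf : measurable_fun setT f.
  refine (@measurability _ _ (caratheodory_type mo) B setT f (@open T) _ _) => //.
  move=> _ [A oA <-]; rewrite setTI.
  apply: le_caratheodory_measurable => X.
  have [h hA] := Hex oA; exact: (riesz_outer_open HI X hA).
pose tau : {measure set B -> \bar R} := pushforward m f.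

by exists (tau mf).
Qed.

Lemma clamp_sum (y dl : R) n : (0 <= dl -> 0 <= y ->
  \sum_(0 <= j < n) Num.min (Num.max (y - j%:R * dl) 0) dl = Num.min y (n%:R * dl))%R.
Proof.
move=> dl0 y0; elim: n => [|n IH].
  by rewrite big_geq// mul0r; apply/esym/min_r.
rewrite big_nat_recr//= IH mulrSr.
have [h|h] := leP y (n%:R * dl)%R.
  rewrite (max_r (x := (y - n%:R * dl)%R)) ?subr_le0// (min_l (x := 0%R))// addr0.
  by apply/esym/min_l; rewrite mulrDl mul1r ler_wpDr.
rewrite max_l ?subr_ge0 ?(ltW h)// mulrDl mul1r.
have [h1|h1] := leP (y - n%:R * dl)%R dl; have [h2|h2] := leP y (n%:R * dl + dl)%R; lra.
Qed.

(** The slice of [f] between heights [j * dl] and [j.+1 * dl], as in the layer-cake formula. *)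
Definition layer (f : T -> R) (dl : R) (j : nat) (x : T) : R :=
  Num.min (Num.max (f x - j%:R * dl)%R 0%R) dl.

Lemma pcc_layer f dl j : pcc f -> (0 < dl)%R -> pcc (layer f dl j).
Proof.
move=> [[fc [K [cK KO fK]]] f0] dl0; split => [|x]; last first.
  by rewrite le_min (ltW dl0) le_max lexx orbT.
split.
  have h1 : continuous (fun x => f x - j%:R * dl)%R.
    by move=> x; apply: cvgB; [exact: fc|exact: cvg_cst].
  have c0 (a : R) : continuous (fun _ : T => a) by move=> x; exact: cvg_cst.
  move=> x; exact: (continuous_min (continuous_max (h1 x) (c0 0%R x)) (c0 dl x)).
exists K; split => // x /fK fx; rewrite /layer fx sub0r max_r ?min_l ?(ltW dl0)//.
by rewrite oppr_le0 mulr_ge0// ltW.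
Qed.

Lemma layer_gt f dl j x : (0 < dl)%R -> (j%:R * dl < f x)%R \/ layer f dl j x = 0%R.
Proof.
move=> dl0; have [h|h] := ltP (j%:R * dl)%R (f x); [by left|right].
by rewrite /layer max_r ?subr_le0// min_l// ltW.
Qed.

Lemma layer_full f dl j x : (0 < dl)%R -> (j.+1%:R * dl <= f x)%R -> layer f dl j x = dl.
Proof.
move=> dl0 h; rewrite /layer min_r// le_max; apply/orP; left.
by move: h; rewrite mulrSr mulrDl mul1r; lra.
Qed.

Lemma layer_sum f : pcc f -> forall dl, (0 < dl)%R -> exists n, forall x,
  f x = (\sum_(0 <= j < n.+1) layer f dl j x)%R.
Proof.
move=> pf dl dl0; have [M M0 HM] := cc_bounded pf.1.
exists (Num.truncn (M / dl)).+1 => x; rewrite (@clamp_sum (f x) dl _ (ltW dl0) (pf.2 x)).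
apply/esym/min_l; rewrite (le_trans (ler_norm _))// (le_trans (HM x))//.
rewrite -ler_pdivrMr//; apply: ltW; apply: lt_le_trans (Num.Theory.truncnS_gt _) _.
by rewrite ler_nat.
Qed.

(** Layer [j] is full wherever layer [j.+1] is nonzero, so two functionals that agree with a measure
    up to superlevel sets can be compared after a shift by one layer. Only the bottom layer stays
    unmatched, and it costs [C * dl]. *)
Lemma layer_compare (P Q : (T -> R) -> R) (f : T -> R) (C : R) :
  (forall n (F : nat -> T -> R), (forall j, pcc (F j)) ->
     P (fun x => \sum_(0 <= j < n) F j x) = \sum_(0 <= j < n) P (F j))%R ->
  (forall n (F : nat -> T -> R), (forall j, pcc (F j)) ->
     Q (fun x => \sum_(0 <= j < n) F j x) = \sum_(0 <= j < n) Q (F j))%R ->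
  (forall g, pcc g -> 0 <= Q g)%R ->
  (forall dl j, 0 < dl -> P (layer f dl j.+1) <= Q (layer f dl j))%R ->
  (forall dl, 0 < dl -> P (layer f dl 0) <= C * dl)%R ->
  (0 <= C)%R -> pcc f -> (P f <= Q f)%R.
Proof.
move=> HP HQ Q0 PQ PC C0 pf; apply/ler_addgt0Pr => e e0.
pose dl := (e / (C + 1))%R.
have C1 : (0 < C + 1)%R by rewrite ltr_wpDl.
have dl0 : (0 < dl)%R by rewrite divr_gt0.
have pl j := pcc_layer j pf dl0.
have [n fE] := layer_sum pf dl0.
have -> : f = (fun x => \sum_(0 <= j < n.+1) layer f dl j x)%R by exact/funext.
rewrite HP// HQ// big_nat_recl// big_nat_recr//= [leLHS]addrC.
apply: lerD.
  apply: (@le_trans _ _ (\sum_(0 <= i < n) Q (layer f dl i))%R).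
    by apply: ler_sum => i _; exact: PQ.
  by rewrite lerDl Q0.
apply: le_trans (PC _ dl0) _.
by rewrite /dl mulrA ler_pdivrMr// mulrC ler_wpM2l ?(ltW e0)// lerDl.
Qed.

Lemma riesz_representation : exists tau : {measure set B -> \bar R},
  [/\ tau setT < +oo, (forall A : set T, A `<=` ~` O -> tau A = 0) &
    forall f, pcc f -> \int[tau]_x (f x)%:E = (I f)%:E].
Proof.
have [tau Htau] := riesz_measure_exists.
have [_ _ _ [C C0 HC]] := HI.
(* The increments of an exhaustion of [O] cover the whole space, and their partial sums [h K] are at
   most 1, so the boundedness clause bounds the cost by [C]. *)
have tauC : tau setT <= C%:E.
  rewrite Htau; have [h [hc h01 hS h0 hO]] := Hex HO.
  pose dl k x := (h k.+1 x - h k x)%R.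
  have dlpcc k : pcc (dl k).
    by split; [apply: ccB; exact: hc|move=> x; rewrite subr_ge0].
  have sdl K x : (\sum_(0 <= k < K) dl k x = h K x)%R.
    by rewrite telescope_sumr// h0 subr0.
  apply: (@le_trans _ _ (\sum_(k <oo) (I (dl k))%:E)).
    apply: ereal_inf_lbound; exists dl => //; split=> // x _ Ox.
    rewrite le_eqVlt; apply/orP; left; apply/eqP/esym/cvg_lim => //.
    under eq_fun do rewrite sumEFin sdl.
    by apply: cvg_EFin; [near=> k|exact: hO].
  rewrite nneseries_sup; last by move=> k; exact: I0.
  apply: ge_ereal_sup => _ [K _ <-].
  rewrite sumEFin lee_fin -(pfun_sum HI)// -[leRHS]mulr1; apply: HC; first exact: pcc_sum.
  by move=> x; rewrite sdl; have /andP[] := h01 K x.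
have tauoo : tau setT < +oo by rewrite (le_lt_trans tauC)// ltry.
exists tau; split => //.
  move=> A AO; rewrite Htau; apply/eqP; rewrite eq_le (riesz_outer_ge0 HI) andbT.
  apply: ereal_inf_lbound; exists (fun _ _ => 0%R).
    by split => [n|x Ax Ox]; [exact: pcc0|have := AO _ Ax].
  by rewrite eseries0// => n _ _; rewrite (pfun0 HI).
have mpcc g : pcc g -> measurable_fun [set: B] (EFin \o (g : B -> R)).
  by move=> pg; apply/measurable_EFinP; apply: continuous_borel; exact: pg.1.1.
(* Any cover of [A] dominates [g] on [O], so [pfun_Dini] bounds [I g] by its cost. *)
have tau_ge (g : T -> R) (A : set T) : pcc g -> (forall x, 0 <= g x <= 1)%R ->
    (forall x, ~ A x -> g x = 0%R) -> (I g)%:E <= tau A.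
  move=> pg g01 gA; rewrite Htau; apply: le_ereal_inf_tmp => _ [F [pF FA] <-].
  apply: (pfun_Dini HI) => // x Ox.
  have [Ax|/gA ->] := pselect (A x); last first.
    by apply: nneseries_ge0 => n _ _; rewrite lee_fin (pF n).2.
  by apply: le_trans (FA x Ax Ox); rewrite lee_fin; have /andP[] := g01 x.
(* The sequence made of [g] followed by zeros is already a cover. *)
have tau_le (g : T -> R) (A : set T) : pcc g -> (forall x, A x -> 1 <= g x)%R ->
    tau A <= (I g)%:E.
  move=> pg gA; rewrite Htau; apply: ereal_inf_lbound.
  exists (fun n => if n == 0%N then g else fun=> 0%R).
    split=> [[|n]//=|x Ax Ox]; first exact: pcc0.
    rewrite nneseries_recl//; last first.
      by move=> [|k] _ //=; rewrite lee_fin pg.2.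
    rewrite /= eseries_cond /= eseries0 ?adde0 ?lee_fin ?gA//.
    by case.
  rewrite nneseries_recl//=; last first.
    by move=> [|k] _ /=; [exact: I0|rewrite (pfun0 HI)].
  rewrite eseries_cond /= eseries0 ?adde0// => -[|k]//= _ _.
  by rewrite (pfun0 HI).
have mge (f : T -> R) a : continuous f -> measurable ([set x | a <= f x]%R : set B).
  move=> fc; apply: closed_borel.
  by apply: (closed_comp (D := [set y | a <= y]%R)) => [x _|]; [exact: fc|exact: closed_ge].
have mgt (f : T -> R) a : continuous f -> measurable ([set x | a < f x]%R : set B).
  move=> fc; apply: open_borel.
  by apply: (open_comp (D := [set y | a < y]%R)) => [x _|]; [exact: fc|exact: open_gt].
have taufin A : measurable (A : set B) -> tau A \is a fin_num.
  move=> mA; rewrite ge0_fin_numE//; apply: le_lt_trans tauoo.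
  by apply: le_measure; rewrite ?inE.
have tauR A : measurable (A : set B) -> tau A = (fine (tau A))%:E.
  by move=> mA; rewrite fineK// taufin.
pose J f := fine (\int[tau]_x (f x)%:E).
have pint f : pcc f -> \int[tau]_x (f x)%:E = (J f)%:E.
  move=> pf; rewrite fineK//; have [M M0 HM] := cc_bounded pf.1.
  rewrite ge0_fin_numE; last by apply: integral_ge0 => x _; rewrite lee_fin pf.2.
  apply: (@le_lt_trans _ _ (\int[tau]_x (cst M%:E x))).
    apply: ge0_le_integral => //; [by move=> x _; rewrite lee_fin pf.2|exact: mpcc|].
    by move=> x _; rewrite lee_fin (le_trans (ler_norm _)).
  by rewrite integral_cst// lte_mul_pinfty.
have Jsum n (F : nat -> T -> R) : (forall j, pcc (F j)) ->
    J (fun x => \sum_(0 <= j < n) F j x)%R = (\sum_(0 <= j < n) J (F j))%R.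
  move=> pF; rewrite /J; under eq_integral do rewrite -sumEFin.
  rewrite ge0_integral_sum//; last 2 first.
  - by move=> j; exact: mpcc.
  - by move=> j x _; rewrite lee_fin (pF j).2.
  by under eq_bigr do rewrite pint//; rewrite sumEFin.
have J0 g : pcc g -> (0 <= J g)%R.
  by move=> pg; apply: fine_ge0; apply: integral_ge0 => x _; rewrite lee_fin pg.2.
have mulJ (dl : R) A : (0 <= dl)%R -> measurable (A : set B) ->
    (dl * fine (tau A))%:E = \int[tau]_x (dl * \1_A x)%:E.
  move=> d0 mA; under eq_integral do rewrite EFinM.
  rewrite ge0_integralZl_EFin//; last exact/measurable_EFinP/measurable_indic.
  by rewrite integral_indic// setIT EFinM -tauR.
have m1 (dl : R) A : measurable (A : set B) ->
    measurable_fun [set: B] (fun x => (dl * \1_A x)%:E).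
  move=> mA; apply/measurable_EFinP; apply: measurable_funM; first exact: measurable_cst.
  exact: measurable_indic.
have JA f (dl : R) A : pcc f -> (0 <= dl)%R -> measurable (A : set B) ->
    (forall x, f x <= dl)%R -> (forall x, ~ A x -> f x = 0)%R -> (J f <= dl * fine (tau A))%R.
  move=> pf d0 mA fd fA; rewrite -lee_fin -pint// mulJ//.
  apply: ge0_le_integral => //; [by move=> x _; rewrite lee_fin pf.2|exact: mpcc|exact: m1|].
  move=> x _; rewrite lee_fin indicE.
  have [Ax|/[dup] nAx /fA ->] := pselect (A x); first by rewrite mem_set// mulr1.
  by rewrite memNset// mulr0.
have AJ f (dl : R) A : pcc f -> (0 <= dl)%R -> measurable (A : set B) ->
    (forall x, A x -> dl <= f x)%R -> (dl * fine (tau A) <= J f)%R.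
  move=> pf d0 mA fd; rewrite -lee_fin -pint// mulJ//.
  apply: ge0_le_integral => //; [by move=> x _; rewrite lee_fin mulr_ge0|exact: m1|exact: mpcc|].
  move=> x _; rewrite lee_fin indicE.
  have [Ax|nAx] := pselect (A x); first by rewrite mem_set// mulr1 fd.
  by rewrite memNset// mulr0 pf.2.
have IA f (dl : R) A : pcc f -> (0 < dl)%R -> measurable (A : set B) ->
    (forall x, f x <= dl)%R -> (forall x, ~ A x -> f x = 0)%R -> (I f <= dl * fine (tau A))%R.
  move=> pf d0 mA fd fA; rewrite -ler_pdivrMl// -(pfunZ HI)//; last first.
    by rewrite invr_ge0 ltW.
  rewrite -lee_fin -tauR//; apply: tau_ge.
  - by apply: pccZ => //; rewrite invr_ge0 ltW.
  - by move=> x; rewrite mulr_ge0 ?pf.2 ?invr_ge0 ?(ltW d0)//= ler_pdivrMl// mulr1.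
  - by move=> x /fA ->; rewrite mulr0.
have AI f (dl : R) A : pcc f -> (0 < dl)%R -> measurable (A : set B) ->
    (forall x, A x -> dl <= f x)%R -> (dl * fine (tau A) <= I f)%R.
  move=> pf d0 mA fd; rewrite -ler_pdivlMl// -(pfunZ HI)//; last first.
    by rewrite invr_ge0 ltW.
  rewrite -lee_fin -tauR//; apply: tau_le.
  - by apply: pccZ => //; rewrite invr_ge0 ltW.
  - by move=> x /fd; rewrite ler_pdivlMl// mulr1.
have lle f dl j x : (layer f dl j x <= dl)%R by rewrite ge_min lexx orbT.
have lgt f dl j x : (0 < dl)%R -> ~ (j%:R * dl < f x)%R -> layer f dl j x = 0%R.
  by move=> d0 ?; have [] := layer_gt f j x d0.
have tau0 A : (0 <= fine (tau A))%R by apply: fine_ge0; exact: measure_ge0.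
move=> f pf; rewrite pint//; congr EFin.
have mono dl j : (fine (tau [set x | j.+1%:R * dl < f x]%R) <=
                  fine (tau [set x | j.+1%:R * dl <= f x]%R))%R.
  have mA := mgt _ (j.+1%:R * dl)%R pf.1.1; have mB := mge _ (j.+1%:R * dl)%R pf.1.1.
  rewrite -lee_fin -!tauR//; apply: le_measure; rewrite ?inE//.
  by move=> x /= /ltW.
(* One comparison in each direction. On both sides a layer is at most [dl] times the measure of the
   set where it is nonzero and at least [dl] times the measure of the set where it is full. *)
apply/eqP; rewrite eq_le; apply/andP; split.
  apply: (layer_compare (C := fine (tau setT))) => //.
  - by move=> n F pF; exact: (pfun_sum HI).
  - move=> dl j d0; have pl := pcc_layer _ pf d0.
    apply: le_trans (JA _ dl [set x | j.+1%:R * dl < f x]%R _ _ _ _ _) _ => //.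
    + exact: ltW.
    + exact: mgt pf.1.1.
    + by move=> x; exact: lgt.
    apply: le_trans (AI _ dl [set x | j.+1%:R * dl <= f x]%R _ _ _ _) => //.
    + by rewrite ler_wpM2l// ltW.
    + exact: mge pf.1.1.
    + by move=> x h; rewrite layer_full.
  - move=> dl d0; rewrite mulrC; by apply: (JA) => [||||x []]//; [exact: pcc_layer|exact: ltW].
apply: (layer_compare (C := fine (tau setT))) => //.
- by move=> n F pF; exact: (pfun_sum HI).
- move=> dl j d0; have pl := pcc_layer _ pf d0.
  apply: le_trans (IA _ dl [set x | j.+1%:R * dl < f x]%R _ _ _ _ _) _ => //.
  + exact: mgt pf.1.1.
  + by move=> x; exact: lgt.
  apply: le_trans (AJ _ dl [set x | j.+1%:R * dl <= f x]%R _ _ _ _) => //.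
  + by rewrite ler_wpM2l// ltW.
  + exact: ltW.
  + exact: mge pf.1.1.
  + by move=> x h; rewrite layer_full.
- move=> dl d0; rewrite mulrC; by apply: (IA) => [||||x []]//; exact: pcc_layer.
Unshelve. all: by end_near.
Qed.

End RieszTheorem.

Section Exhaustion.
Context {R : realType} {d q : nat}.
Local Notation X := (@Xsp R d q).

Lemma Xsp_bounded_closed_compact (A : set X) (M : R) :
  closed A -> (forall x, A x -> `|x| <= M) -> compact A.
Proof.
move=> cA bA.
pose C n : set 'rV[R]_n := [set v | `|v| <= M].
have cC n : compact (C n).
  apply: bounded_closed_compact.
    exists M; split; first by rewrite num_real.
    by move=> y My v /= /le_trans; apply; exact: ltW.
  by apply: (closed_comp (D := [set y : R | y <= M])) => [v _|];
    [exact: norm_continuous|exact: closed_le].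
apply: (subclosed_compact cA (compact_setX (cC d) (cC q))).
by move=> [x y] /bA; rewrite prod_normE ge_max => /andP[].
Qed.

(** The distance to [F] truncated at 1, so that the infimum is over a nonempty set even when [F] is
    empty. *)
Definition dst (F : set X) (x : X) : R :=
  inf [set r | r = 1 \/ exists2 y, F y & r = `|x - y|].

Let has_inf_dst (F : set X) (x : X) : has_inf [set r | r = 1 \/ exists2 y, F y & r = `|x - y|].
Proof.
split; first by exists 1; left.
by exists 0 => r [->//|[y _ ->]].
Qed.

Lemma dst_ge0 F x : 0 <= dst F x.
Proof. by apply: lb_le_inf; [exact: (has_inf_dst F x).1|move=> r [->//|[y _ ->]]]. Qed.

Lemma dst_lip F x y : `|dst F x - dst F y| <= 1 * `|x - y|.
Proof.
have h u v : dst F u <= dst F v + `|u - v|.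
  rewrite -lerBlDr; apply: lb_le_inf; first exact: (has_inf_dst F v).1.
  move=> r [->|[z Fz ->]].
    rewrite lerBlDr; apply: le_trans (_ : 1 <= _); last by rewrite lerDl.
    by apply: ge_inf; [exact: (has_inf_dst F u).2|left].
  rewrite lerBlDr; apply: (@le_trans _ _ `|u - z|).
    by apply: ge_inf; [exact: (has_inf_dst F u).2|right; exists z].
  by rewrite [leRHS]addrC; exact: ler_distD.
rewrite mul1r ler_norml; have := h x y; have := h y x.
by rewrite distrC => h1 h2; apply/andP; split; lra.
Qed.

Lemma dst_cts F : continuous (dst F).
Proof. exact: lipschitz_cts (@dst_lip F). Qed.

Lemma dst_in F x : F x -> dst F x = 0.
Proof.
move=> Fx; apply/eqP; rewrite eq_le dst_ge0 andbT.
apply: ge_inf; first exact: (has_inf_dst F x).2.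
by right; exists x => //; rewrite subrr normr0.
Qed.

Lemma dst_out F x : closed F -> ~ F x -> 0 < dst F x.
Proof.
move=> cF nF.
have : nbhs x (~` F) by apply: open_nbhs_nbhs; split => //; exact: closed_openC.
move=> /nbhs_ballP[e /= e0 he].
apply: (@lt_le_trans _ _ (Num.min 1 e)); first by rewrite lt_min ltr01.
apply: lb_le_inf; first exact: (has_inf_dst F x).1.
move=> r [->|[y Fy ->]]; first by rewrite ge_min lexx.
rewrite ge_min; apply/orP; right; rewrite leNgt; apply/negP => h.
by apply: (he y) => //; rewrite -ball_normE.
Qed.

Lemma open_exhaustion (U : set X) : open U -> exists h : nat -> X -> R, exhaustion U h.
Proof.
move=> oU.
pose cut (s : R) := Num.min 1 (Num.max 0 s).
have cutc (f : X -> R) : continuous f -> continuous (fun x => cut (f x)).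
  have c0 (a : R) : continuous (fun _ : X => a) by move=> x; exact: cvg_cst.
  by move=> fc x; exact: (continuous_min (c0 1 x) (continuous_max (c0 0 x) (fc x))).
have cut01 s : 0 <= cut s <= 1.
  by rewrite /cut le_min ler01 le_max lexx /= ge_min lexx.
have cutnd s t : s <= t -> cut s <= cut t.
  move=> st; rewrite /cut le_min ge_min lexx /= ge_min; apply/orP; right.
  by rewrite ge_max !le_max lexx st orbT.
have cut0 s : s <= 0 -> cut s = 0 by move=> s0; rewrite /cut max_l// min_r.
have cut1 s : 1 <= s -> cut s = 1.
  by move=> s1; rewrite /cut min_l// le_max s1 orbT.
pose D := dst (~` U).
(* The first factor vanishes where the distance to the complement is at most [1 / n], the second
   outside the ball of radius [n]. The shift by 1 keeps the compact set inside [U] and makes the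
   function with index 0 vanish. *)
exists (fun n x => cut (n%:R * D x - 1) * cut (n%:R - `|x|)); split.
- move=> n; split.
    have h1 : continuous (fun x => n%:R * D x - 1).
      move=> x; apply: cvgB; last exact: cvg_cst.
      by apply: cvgMr; exact: dst_cts.
    have h2 : continuous (fun x : X => n%:R - `|x|).
      by move=> x; apply: cvgB; [exact: cvg_cst|exact: norm_continuous].
    by move=> x; apply: cvgM; [exact: (cutc _ h1)|exact: (cutc _ h2)].
  exists ([set x | 1 <= n%:R * D x] `&` [set x | `|x| <= n%:R]); split.
  + apply: (@Xsp_bounded_closed_compact _ n%:R); last by move=> x [].
    apply: closedI.
      apply: (closed_comp (D := [set y : R | 1 <= y])) => [x _|]; last exact: closed_ge.
      by apply: cvgMr; exact: dst_cts.
    by apply: (closed_comp (D := [set y : R | y <= n%:R])) => [v _|];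
      [exact: norm_continuous|exact: closed_le].
  + move=> x [/= h _]; apply: contrapT => nU.
    by move: h; rewrite /D dst_in// mulr0 ler10.
  + move=> x /= h; have [h1|h1] := leP 1 (n%:R * D x).
      rewrite [X in _ * X]cut0 ?mulr0// subr_le0.
      by have [|/ltW//] := leP `|x| n%:R => h2; exfalso; apply: h.
    by rewrite cut0 ?mul0r// subr_le0 ltW.
- move=> n x; have /andP[a0 a1] := cut01 (n%:R * D x - 1).
  have /andP[b0 b1] := cut01 (n%:R - `|x|).
  by rewrite mulr_ge0//= mulr_ile1.
- move=> n x; have /andP[a0 a1] := cut01 (n%:R * D x - 1).
  have /andP[b0 b1] := cut01 (n%:R - `|x|).
  apply: ler_pM => //; apply: cutnd.
    by rewrite lerD2r ler_wpM2r ?dst_ge0// ler_nat.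
  by rewrite lerD2r ler_nat.
- by move=> x; rewrite cut0 ?mul0r//; lra.
- move=> x Ux.
  have D0 : 0 < D x by apply: dst_out; [exact: open_closedC|move=> /(_ Ux)].
  apply: cvg_near_cst; near=> n.
  rewrite (cut1 (n%:R * D x - 1)) ?(cut1 (n%:R - `|x|)) ?mulr1//.
    by rewrite lerBrDr; near: n; exact: nbhs_infty_ger.
  by rewrite lerBrDr -ler_pdivrMr//; near: n; exact: nbhs_infty_ger.
Unshelve. all: by end_near. Qed.

End Exhaustion.

(** * Charges and Radon-Nikodym decompositions *)

Section Densities.
Context dd (T : measurableType dd) (R : realType).
Local Open Scope ereal_scope.

(** An alias that remembers the finiteness proof, so that the finite measure structure can be
    attached to it. *)
Definition finitized (m : {measure set T -> \bar R}) of m setT < +oo : set T -> \bar R := m.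

Section Finitized.
Variables (m : {measure set T -> \bar R}) (moo : m setT < +oo).

HB.instance Definition _ := Measure.copy (finitized moo) m.

Let fin_num_finitized : fin_num_fun (finitized moo).
Proof.
move=> A mA; rewrite ge0_fin_numE ?measure_ge0//; apply: le_lt_trans moo.
by apply: le_measure; rewrite ?inE.
Qed.

HB.instance Definition _ := Measure_isFinite.Build _ _ _ (finitized moo) fin_num_finitized.

End Finitized.

Lemma finite_measure_of (m : {measure set T -> \bar R}) : m setT < +oo ->
  exists m' : {finite_measure set T -> \bar R}, forall A, m' A = m A.
Proof. by move=> moo; exists (finitized moo). Qed.

Variables (nu la : {finite_measure set T -> \bar R}) (w : T -> R).
Hypotheses (w0 : forall x, (0 <= w x)%R) (mw : measurable_fun setT w).
Hypothesis nuE : forall A, measurable A -> nu A = \int[la]_(x in A) (w x)%:E.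

Let nula : nu `<< la.
Proof.
apply/null_content_dominatesP => A mA laA; rewrite nuE//.
by apply: null_set_integral => //; apply/measurable_EFinP/measurable_funTS.
Qed.

Let ae_w E : measurable E ->
  ae_eq la E (Radon_Nikodym_SigmaFinite.f nu la) (fun x => (w x)%:E).
Proof.
move=> mE; apply: integral_ae_eq => //.
- apply: (integrableS measurableT) => //; exact: Radon_Nikodym_SigmaFinite.f_integrable.
- by apply/measurable_EFinP/measurable_funTS.
- by move=> A AE mA; rewrite -nuE// -Radon_Nikodym_SigmaFinite.f_integral.
Qed.

(** By uniqueness of densities [w] is almost everywhere the Radon-Nikodym derivative of [nu], whose
    change of variables formula then applies. *)
Lemma ge0_integral_density (f : T -> \bar R) E : (forall x, 0 <= f x) ->
  measurable E -> measurable_fun E f ->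
  \int[nu]_(x in E) f x = \int[la]_(x in E) (f x * (w x)%:E).
Proof.
move=> f0 mE mf.
rewrite -(Radon_Nikodym_SigmaFinite.change_of_variables nula)//.
have mr : measurable_fun E (Radon_Nikodym_SigmaFinite.f nu la).
  apply: measurable_funTS; apply: measurable_int.
  exact: Radon_Nikodym_SigmaFinite.f_integrable.
have mwE : measurable_fun E (fun x => (w x)%:E) by apply/measurable_EFinP/measurable_funTS.
apply: ae_eq_integral => //; [exact: emeasurable_funM|exact: emeasurable_funM|].
by apply: ae_eqe_mul2l; exact: ae_w.
Qed.

Lemma integral_density (f : T -> \bar R) E : measurable E -> nu.-integrable E f ->
  \int[nu]_(x in E) f x = \int[la]_(x in E) (f x * (w x)%:E).
Proof.
move=> mE If; rewrite -(Radon_Nikodym_change_of_variables nula)//.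
have mr : measurable_fun E (Radon_Nikodym (charge_of_finite_measure nu) la).
  by apply: measurable_funTS; apply: measurable_int; exact: Radon_Nikodym_integrable.
have mwE : measurable_fun E (fun x => (w x)%:E) by apply/measurable_EFinP/measurable_funTS.
have mf := measurable_int _ If.
apply: ae_eq_integral => //; [exact: emeasurable_funM|exact: emeasurable_funM|].
apply: ae_eqe_mul2l; apply: ae_eq_trans (ae_w mE).
exact/ae_eq_sym/ae_eq_Radon_Nikodym_SigmaFinite.
Qed.

End Densities.

Section Densities2.
Context dd (T : measurableType dd) (R : realType).
Local Open Scope ereal_scope.

Lemma measurable_inv_ge0 (w : T -> R) : (forall x, (0 <= w x)%R) ->
  measurable_fun setT w -> measurable_fun setT (fun x => (w x)^-1)%R.
Proof.
move=> w0 mw; under eq_fun do rewrite -powR_inv1//.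
exact: measurableT_comp (measurable_powR _) mw.
Qed.

Lemma density_measure (la : {finite_measure set T -> \bar R}) (w : T -> R) :
  (forall x, (0 <= w x)%R) -> la.-integrable setT (fun x => (w x)%:E) ->
  exists nu : {finite_measure set T -> \bar R},
    forall A, measurable A -> nu A = \int[la]_(x in A) (w x)%:E.
Proof.
move=> w0 Iw.
pose c := induced_charge Iw : {charge set T -> \bar R}.
have c0 A : 0 <= c A by apply: integral_ge0 => x _; rewrite lee_fin.
have [|nu Hnu] := @finite_measure_of _ T R (measure_of_charge c c0).
  by rewrite -ge0_fin_numE//; exact: (@fin_num_measure _ _ _ c).
by exists nu => A mA; rewrite Hnu.
Qed.

(** The Jordan parts of the charges are added to [mu] one charge at a time. *)
Lemma exists_dominating (I : eqType) (s : seq I) (mu : {finite_measure set T -> \bar R})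
  (J : I -> {charge set T -> \bar R}) :
  exists la : {finite_measure set T -> \bar R},
    mu `<< la /\ forall i, i \in s -> J i `<< la.
Proof.
have add (m1 m2 : {finite_measure set T -> \bar R}) :
    exists la : {finite_measure set T -> \bar R}, forall A, la A = m1 A + m2 A.
  have [|la Hla] := @finite_measure_of _ T R (measure_add m1 m2).
    apply: (@le_lt_trans _ _ (m1 setT + m2 setT)); first by rewrite -measure_addE.
    by rewrite lte_add_pinfty// -ge0_fin_numE//; exact: fin_num_measure.
  by exists la => A; rewrite Hla -measure_addE.
elim: s => [|i s [la [mula IH]]].
  by exists mu; split => //; apply/null_content_dominatesP.
have [P [N nuPN]] := Hahn_decomposition (J i).
have [la1 Hla1] := add (jordan_pos nuPN) (jordan_neg nuPN).
have [la2 Hla2] := add la la1.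
have dom (nu : set T -> \bar R) : nu `<< la -> nu `<< la2.
  move=> /null_content_dominatesP h; apply/null_content_dominatesP => A mA.
  move=> la20; have : la A + la1 A == 0 by rewrite -Hla2; apply/eqP.
  by rewrite padde_eq0// => /andP[/eqP + _]; exact: h.
exists la2; split; first exact: dom.
move=> k; rewrite in_cons => /orP[/eqP->|/IH]; last exact: dom.
apply/null_content_dominatesP => A mA.
move=> la20; have : la A + la1 A == 0 by rewrite -Hla2; apply/eqP.
rewrite padde_eq0// => /andP[_]; rewrite Hla1 => /eqP h; apply/eqP; rewrite -abse_eq0 eq_le abse_ge0 andbT.
by apply: le_trans (abse_charge_variation nuPN mA) _; rewrite /charge_variation h.
Qed.

End Densities2.

Section RNdecomp.
Context {R : realType} {d q : nat}.
Local Notation X := (@BorelX R d q).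
Local Open Scope ereal_scope.

(** Everything is expressed by densities with respect to one dominating [la]: [h] for [J] and [g]
    for [mu]. The singular part lives on the [mu]-null set [N] where [g] vanishes. Giving [sigma]
    the Frobenius norm of [h] on [N] as density makes the direction a unit field. *)
Lemma RN_decomp_exists (mu : {measure set X -> \bar R})
  (J : 'I_q -> 'I_d -> {charge set X -> \bar R}) : mu setT < +oo ->
  exists v sigma theta, RN_decomp mu J v sigma theta.
Proof.
move=> muoo.
have [muf Hmu] := finite_measure_of muoo.
have [la [mula Jla']] := @exists_dominating _ X R _
  (enum {: 'I_q * 'I_d}) muf (fun p => J p.1 p.2).
have Jla i j : J i j `<< la by apply: (Jla' (i, j)); rewrite mem_enum.
pose h p : 'M[R]_(q, d) := \matrix_(i, j) fine (Radon_Nikodym (J i j) la p).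
have hE i j p : (h p i j)%:E = Radon_Nikodym (J i j) la p.
  by rewrite mxE fineK// Radon_Nikodym_fin_num.
have Ih i j : la.-integrable setT (fun p => (h p i j)%:E).
  apply: eq_integrable (Radon_Nikodym_integrable (Jla i j)) => //.
have mh i j : measurable_fun setT (fun p => h p i j).
  by apply/measurable_EFinP; exact: measurable_int (Ih i j).
pose G := Radon_Nikodym_SigmaFinite.f muf la.
pose g p := fine (G p).
have gE p : (g p)%:E = G p by rewrite fineK// Radon_Nikodym_SigmaFinite.f_fin_num.
have g0 p : (0 <= g p)%R by rewrite -lee_fin gE Radon_Nikodym_SigmaFinite.f_ge0.
have mg : measurable_fun setT g.
  apply/measurable_EFinP; apply: (eq_measurable_fun G) => [p _|]; first by rewrite /= gE.
  exact: measurable_int (Radon_Nikodym_SigmaFinite.f_integrable mula).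
have muE A : measurable A -> muf A = \int[la]_(x in A) (g x)%:E.
  move=> mA; rewrite (Radon_Nikodym_SigmaFinite.f_integral mula)//.
  by apply: eq_integral => x _; rewrite gE.
pose N := [set p | g p = 0%R].
have mN : measurable (N : set X).
  by have := mg measurableT [set 0%R] (measurable_set1 _); rewrite setTI.
pose n p := (frobnorm (h p) * \1_N p)%R.
have n0 p : (0 <= n p)%R by rewrite mulr_ge0// sqrtr_ge0.
have mfn : measurable_fun setT (fun p => frobnorm (h p)).
  apply: measurableT_comp; first exact: continuous_measurable_fun (@sqrt_continuous R).
  apply: measurable_sum => i; apply: measurable_sum => j; exact: measurable_funM.
have mn : measurable_fun setT n.
  by apply: measurable_funM => //; exact: measurable_indic.
have In : la.-integrable setT (fun p => (n p)%:E).
  apply: (@le_integrable _ _ _ la setT _ _ (fun p => \sum_i \sum_j `|(h p i j)%:E|)) => //.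
  - exact/measurable_EFinP.
  - move=> p _; rewrite abse_EFin ger0_norm//.
    have -> : \sum_i \sum_j `|(h p i j)%:E| = (\sum_i \sum_j `|h p i j|)%:E.
      rewrite -sumEFin; apply: eq_bigr => i _; rewrite -sumEFin; exact: eq_bigr.
    rewrite gee0_abs ?lee_fin; last by apply: sumr_ge0 => i _; exact: sumr_ge0.
    apply: le_trans (frobnorm_le_sum (h p)).
    by rewrite ler_piMr ?sqrtr_ge0// indicE lern1 leq_b1.
  - apply: integrable_sum => // i _; apply: integrable_sum => // j _.
    exact: integrable_abse.
have [sg sgE] := density_measure n0 In.
(* The inverse of 0 is 0, so [v] vanishes on [N] and [th] wherever [n] does; [vg] and [thn] absorb
   these cases. *)
pose v (p : X) := ((g p)^-1 *: h p)%R.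
pose th (p : X) := ((n p)^-1 *: h p)%R.
have mv i j : measurable_fun setT (fun p => v p i j).
  rewrite /v; under eq_fun do rewrite mxE.
  by apply: measurable_funM => //; exact: measurable_inv_ge0.
have mth i j : measurable_fun setT (fun p => th p i j).
  rewrite /th; under eq_fun do rewrite mxE.
  by apply: measurable_funM => //; exact: measurable_inv_ge0.
have vg p i j : (v p i j * g p = h p i j * \1_(~` N) p)%R.
  rewrite mxE indicE; have [gp|gp] := eqVneq (g p) 0%R.
    by rewrite gp mulr0 memNset ?mulr0//=; apply.
  by rewrite mulrAC mulVf// mul1r mem_set ?mulr1//=; exact/eqP.
have thn p i j : (th p i j * n p = h p i j * \1_N p)%R.
  rewrite mxE; have [np|np] := eqVneq (n p) 0%R.
    rewrite np mulr0; move: np; rewrite /n indicE => /eqP; rewrite mulf_eq0.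
    move=> /orP[/eqP/frobnorm_eq0 ->|/eqP ->]; by rewrite ?mxE ?mul0r ?mulr0.
  rewrite mulrAC mulVf// mul1r indicE.
  by case: (boolP (p \in N)) np; rewrite /n indicE ?mulr1// => /negbTE ->; rewrite mulr0 eqxx.
have Iv i j : muf.-integrable setT (fun p => (v p i j)%:E).
  apply/integrableP; split; first exact/measurable_EFinP.
  rewrite (ge0_integral_density mg muE)//; last first.
    by apply: measurableT_comp => //; exact/measurable_EFinP.
  have /integrableP[_] := Ih i j; apply: le_lt_trans.
  apply: ge0_le_integral => //.
  - by move=> p _; rewrite mule_ge0// lee_fin.
  - apply: emeasurable_funM; last exact/measurable_EFinP.
    by apply: measurableT_comp => //; exact/measurable_EFinP.
  - by apply: measurableT_comp => //; exact/measurable_EFinP.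
  move=> p _; rewrite !abse_EFin -EFinM lee_fin -{1}(ger0_norm (g0 p)) -normrM vg normrM.
  by rewrite ler_piMr// indicE ger0_norm// lern1 leq_b1.
have sgn : forall A, measurable A -> sg A = \int[la]_(x in A) (n x)%:E by [].
have Ith i j : sg.-integrable setT (fun p => (th p i j)%:E).
  apply/integrableP; split; first exact/measurable_EFinP.
  rewrite (ge0_integral_density mn sgn)//; last first.
    by apply: measurableT_comp => //; exact/measurable_EFinP.
  have /integrableP[_] := Ih i j; apply: le_lt_trans.
  apply: ge0_le_integral => //.
  - by move=> p _; rewrite mule_ge0// lee_fin.
  - apply: emeasurable_funM; last exact/measurable_EFinP.
    by apply: measurableT_comp => //; exact/measurable_EFinP.
  - by apply: measurableT_comp => //; exact/measurable_EFinP.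
  move=> p _; rewrite !abse_EFin -EFinM lee_fin -{1}(ger0_norm (n0 p)) -normrM thn normrM.
  by rewrite ler_piMr// indicE ger0_norm// lern1 leq_b1.
have eqmu (A : set X) f : measurable A -> \int[mu]_(x in A) f x = \int[muf]_(x in A) f x.
  by move=> mA; apply: eq_measure_integral => B mB _; exact/esym/Hmu.
exists v, sg, th; split.
- move=> i j; split => //.
  have /integrableP[m1 m2] := Iv i j; apply/integrableP; split => //.
  by rewrite eqmu.
- by rewrite -ge0_fin_numE// fin_num_measure.
- have mn0 : measurable ([set p | n p = 0%R] : set X).
    by have := mn measurableT [set 0%R] (measurable_set1 _); rewrite setTI.
  exists [set p | n p = 0%R]; split => //.
  + by apply: (etrans (sgn _ mn0)); apply: integral0_eq => p /= ->.
  + move=> p /eqP np; rewrite /th frobnormZ normfV ger0_norm//.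
    have -> : n p = frobnorm (h p).
      by move: np; rewrite /n indicE; case: (p \in N); rewrite ?mulr1// mulr0 eqxx.
    by rewrite mulVf//; apply: contra np => /eqP; rewrite /n => ->; rewrite mul0r.
- exists N; split => //.
  + by rewrite -Hmu (muE _ mN); apply: integral0_eq => p /= ->.
  + apply: (etrans (sgn _ (measurableC mN))).
    by apply: integral0_eq => p /= np; rewrite /n indicE memNset// mulr0.
- move=> A mA i j.
  have IvA := integrableS measurableT mA (@subsetT _ _) (Iv i j).
  have IthA := integrableS measurableT mA (@subsetT _ _) (Ith i j).
  rewrite eqmu// (integral_density mg muE mA IvA) (integral_density mn sgn mA IthA).
  under eq_integral do rewrite -EFinM vg.
  under [X in _ = _ + X]eq_integral do rewrite -EFinM thn.
  have IhA := integrableS measurableT mA (@subsetT _ _) (Ih i j).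
  have IhB (B : set X) : measurable B -> la.-integrable A (fun p => (h p i j * \1_B p)%:E).
    move=> mB; apply: le_integrable (IhA) => //.
      apply: measurable_funTS; apply/measurable_EFinP.
      by apply: measurable_funM; [exact: mh|exact: measurable_indic].
    move=> p _; rewrite !abse_EFin lee_fin normrM ler_piMr// indicE ger0_norm//.
    by rewrite lern1 leq_b1.
  rewrite (Radon_Nikodym_integral (Jla i j) mA) -integralD//.
  + apply: eq_integral => p _; rewrite -hE -EFinD; congr EFin.
    by rewrite !indicE in_setC; case: (p \in N) => /=; lra.
  + by apply: IhB; exact: measurableC.
  + exact: IhB.
Qed.
End RNdecomp.

Section ChargeInt.
Context dd (T : measurableType dd) (R : realType).
Local Open Scope ereal_scope.

Lemma fin_subr_eq (a b c e : \bar R) : a \is a fin_num -> b \is a fin_num ->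
  c \is a fin_num -> e \is a fin_num -> (a - b = c - e) <-> (a + e = c + b).
Proof.
move=> /fineK<- /fineK<- /fineK<- /fineK<-.
by rewrite -!EFinB -!EFinD; split => -[h]; congr EFin; lra.
Qed.

Lemma fin_addrBA (a b c e : \bar R) : a \is a fin_num -> b \is a fin_num ->
  c \is a fin_num -> e \is a fin_num -> a + c - (b + e) = (a - b) + (c - e).
Proof.
move=> /fineK<- /fineK<- /fineK<- /fineK<-.
by rewrite -!EFinD -?EFinB -?EFinD; congr EFin; lra.
Qed.

Definition bmeas (f : T -> R) := measurable_fun setT f /\ exists B : R, forall x, (`|f x| <= B)%R.

Lemma bmeas_integrable_lty (m : {measure set T -> \bar R}) f : m setT < +oo -> bmeas f ->
  m.-integrable setT (fun x => (f x)%:E).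
Proof.
move=> moo [mf [B fB]]; apply: measurable_bounded_integrable => //.
exists B; split; first by rewrite num_real.
by move=> M BM x _ /=; exact: le_trans (fB x) (ltW BM).
Qed.

Lemma bmeas_integrable (m : {finite_measure set T -> \bar R}) f : bmeas f ->
  m.-integrable setT (fun x => (f x)%:E).
Proof.
by apply: bmeas_integrable_lty; rewrite -ge0_fin_numE//; exact: fin_num_measure.
Qed.

Lemma finite_measure_add (m1 m2 : {finite_measure set T -> \bar R}) :
  exists m : {finite_measure set T -> \bar R}, (forall S, m S = m1 S + m2 S) /\
  forall f, bmeas f -> \int[m]_x (f x)%:E = \int[m1]_x (f x)%:E + \int[m2]_x (f x)%:E.
Proof.
have [|m Hm] := @finite_measure_of _ T R (measure_add m1 m2).
  apply: (@le_lt_trans _ _ (m1 setT + m2 setT)); first by rewrite -measure_addE.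
  by rewrite lte_add_pinfty// -ge0_fin_numE//; exact: fin_num_measure.
exists m; split => [S|f bf]; first by rewrite Hm -measure_addE.
rewrite -integral_measure_add//; [|exact: bmeas_integrable|exact: bmeas_integrable].
by apply: eq_measure_integral => S mS _; exact: Hm.
Qed.

(** Adding crosswise turns the hypothesis into the equality of the finite measures [A + D] and
    [C + B]. *)
Lemma integral_measure_diff (A B C D : {finite_measure set T -> \bar R}) f : bmeas f ->
  (forall S, measurable S -> A S - B S = C S - D S) ->
  \int[A]_x (f x)%:E - \int[B]_x (f x)%:E = \int[C]_x (f x)%:E - \int[D]_x (f x)%:E.
Proof.
move=> bf h.
have [m1 [m1E m1f]] := finite_measure_add A D.
have [m2 [m2E m2f]] := finite_measure_add C B.
have e : \int[m1]_x (f x)%:E = \int[m2]_x (f x)%:E.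
  apply: eq_measure_integral => S mS _; apply: (etrans (m1E S)); apply: etrans (esym (m2E S)).
  by apply/fin_subr_eq; [exact: fin_num_measure..|exact: h].
have fin (m : {finite_measure set T -> \bar R}) : \int[m]_x (f x)%:E \is a fin_num.
  by apply: integrable_fin_num => //; exact: bmeas_integrable.
apply/fin_subr_eq; [exact: fin..|].
exact: (etrans (esym (m1f _ bf)) (etrans e (m2f _ bf))).
Qed.

Lemma integral_signed_density (mu : {finite_measure set T -> \bar R}) (v : T -> R) :
  mu.-integrable setT (fun x => (v x)%:E) ->
  exists A B : {finite_measure set T -> \bar R},
    (forall S, measurable S -> \int[mu]_(x in S) (v x)%:E = A S - B S) /\
    forall f, bmeas f ->
      \int[mu]_x (f x * v x)%:E = \int[A]_x (f x)%:E - \int[B]_x (f x)%:E.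
Proof.
move=> Iv.
pose p x := Num.max (v x) 0%R; pose n x := Num.max (- v x)%R 0%R.
have p0 x : (0 <= p x)%R by rewrite le_max lexx orbT.
have n0 x : (0 <= n x)%R by rewrite le_max lexx orbT.
have mv : measurable_fun setT v by apply/measurable_EFinP; exact: measurable_int Iv.
have mp : measurable_fun setT p by apply: measurable_maxr.
have mn : measurable_fun setT n by apply: measurable_maxr => //; exact: measurableT_comp.
have vE x : v x = (p x - n x)%R.
  by rewrite /p /n; have [h|h] := leP (v x) 0%R; have [h'|h'] := leP (- v x)%R 0%R; lra.
have Ip : mu.-integrable setT (fun x => (p x)%:E).
  apply: le_integrable (Iv) => //; first exact/measurable_EFinP.
  by move=> x _; rewrite !abse_EFin lee_fin ger0_norm// /p ge_max ler_norm normr_ge0.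
have In : mu.-integrable setT (fun x => (n x)%:E).
  apply: le_integrable (Iv) => //; first exact/measurable_EFinP.
  by move=> x _; rewrite !abse_EFin lee_fin ger0_norm// /n ge_max -normrN ler_norm normr_ge0.
have [A AE] := density_measure p0 Ip; have [B BE] := density_measure n0 In.
exists A, B; split.
  move=> S mS; rewrite AE// BE// -integralB//; try exact: (integrableS measurableT).
  by apply: eq_integral => x _; rewrite vE EFinB.
move=> f bf.
rewrite (integral_density mp AE measurableT (bmeas_integrable _ bf)).
rewrite (integral_density mn BE measurableT (bmeas_integrable _ bf)).
have [mf [M fM]] := bf.
have Ifw (w : T -> R) : mu.-integrable setT (fun x => (w x)%:E) ->
    mu.-integrable setT (fun x => (f x)%:E * (w x)%:E).
  move=> Iw; have mw : measurable_fun setT w.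
    by apply/measurable_EFinP; exact: measurable_int Iw.
  apply: le_integrable (integrableZl measurableT `|M|%R Iw) => //.
    by apply: emeasurable_funM; exact/measurable_EFinP.
  move=> x _; rewrite -!EFinM !abse_EFin lee_fin !normrM ler_wpM2r// normr_id.
  exact: le_trans (fM x) (ler_norm _).
rewrite -integralB//; [|exact: Ifw|exact: Ifw].
by apply: eq_integral => x _; rewrite vE mulrBr EFinB !EFinM.
Qed.

End ChargeInt.

Section ChargeInt2.
Context {R : realType} {d q : nat}.
Local Notation X := (@BorelX R d q).
Local Open Scope ereal_scope.

(** This frees [charge_int] from the particular Hahn decomposition picked in its definition. *)
Lemma charge_int_sub (J : {charge set X -> \bar R}) (A B : {finite_measure set X -> \bar R})
  (f : X -> R) : bmeas f -> (forall S, measurable S -> J S = A S - B S) ->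
  charge_int J f = \int[A]_x (f x)%:E - \int[B]_x (f x)%:E.
Proof.
move=> bf JE; rewrite /charge_int.
apply: (@integral_measure_diff _ X R (jordan_pos _) (jordan_neg _)) => // S mS.
rewrite -JE//.
by rewrite [RHS](jordan_decomp (projT2 (cid (projT2 (cid (Hahn_decomposition J))))) mS)
  /cadd/= cscaleN1.
Qed.

Lemma charge_int_RN (J : {charge set X -> \bar R}) (mu sg : {measure set X -> \bar R})
  (v th f : X -> R) :
  mu setT < +oo -> sg setT < +oo -> bmeas f ->
  mu.-integrable setT (fun x => (v x)%:E) -> sg.-integrable setT (fun x => (th x)%:E) ->
  (forall S, measurable S -> J S = \int[mu]_(x in S) (v x)%:E + \int[sg]_(x in S) (th x)%:E) ->
  charge_int J f = \int[mu]_x (f x * v x)%:E + \int[sg]_x (f x * th x)%:E.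
Proof.
move=> muoo sgoo bf Iv Ith JE.
have [A1 [B1 [E1 F1]]] := @integral_signed_density _ X R (finitized muoo) v Iv.
have [A2 [B2 [E2 F2]]] := @integral_signed_density _ X R (finitized sgoo) th Ith.
have [A [AE FA]] := finite_measure_add A1 A2.
have [B [BE FB]] := finite_measure_add B1 B2.
rewrite (@charge_int_sub J A B)//.
  have fin (m : {finite_measure set X -> \bar R}) : \int[m]_x (f x)%:E \is a fin_num.
    by apply: integrable_fin_num => //; exact: bmeas_integrable.
  transitivity ((\int[A1]_x (f x)%:E - \int[B1]_x (f x)%:E) +
                (\int[A2]_x (f x)%:E - \int[B2]_x (f x)%:E)).
    rewrite FA// FB//; apply: fin_addrBA; exact: fin.
  by rewrite -F1// -F2.
move=> S mS; rewrite JE//.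
transitivity ((A1 S - B1 S) + (A2 S - B2 S)); first by rewrite -E1// -E2.
by rewrite AE BE; apply/esym/fin_addrBA; exact: fin_num_measure.
Qed.

End ChargeInt2.

(** * Smooth approximation of test functions *)

Section CkCalculus.
Context {R : realType} {V : normedModType R}.

Lemma Ck_derivable (W : normedModType R) k (f : V -> W) p v :
  Ck k.+1 f -> derivable f p v.
Proof. by move=> [df _]; exact: diff_derivable. Qed.

Lemma Ck_pred (W : normedModType R) k (f : V -> W) : Ck k.+1 f -> Ck k f.
Proof.
elim: k f => [|k IH] f [df hf] /=.
  by move=> x; exact: differentiable_continuous.
by split => // w; exact/IH/hf.
Qed.

Lemma Ck_cst (W : normedModType R) k (c : W) : Ck k (fun _ : V => c).
Proof.
elim: k c => [|k IH] c /=; first by move=> x; exact: cvg_cst.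
split; first by move=> p; exact: differentiable_cst.
move=> w; have -> : (fun p => derive (fun _ : V => c) p w) = (fun=> 0).
  by apply/funext => p; exact: derive_cst.
exact: IH.
Qed.

Lemma CkD (W : normedModType R) k (f g : V -> W) : Ck k f -> Ck k g ->
  Ck k (fun p => f p + g p).
Proof.
elim: k f g => [|k IH] f g.
  by move=> cf cg x; apply: cvgD; [exact: cf|exact: cg].
move=> Cf Cg; have [df Df] := Cf; have [dg Dg] := Cg; split.
  by move=> p; exact: differentiableD.
move=> w; have -> : (fun p => derive (fun p => f p + g p) p w) =
    (fun p => 'D_w f p + 'D_w g p).
  by apply/funext => p; exact: (deriveD (Ck_derivable Cf) (Ck_derivable Cg)).
by apply: IH; [exact: Df|exact: Dg].
Qed.

Lemma CkM k (f g : V -> R) : Ck k f -> Ck k g -> Ck k (fun p => f p * g p).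
Proof.
elim: k f g => [|k IH] f g.
  by move=> cf cg x; apply: cvgM; [exact: cf|exact: cg].
move=> Cf Cg; have [df Df] := Cf; have [dg Dg] := Cg; split.
  by move=> p; exact: differentiableM.
move=> w; have -> : (fun p => derive (fun p => f p * g p) p w) =
    (fun p => f p * 'D_w g p + g p * 'D_w f p).
  by apply/funext => p; exact: (deriveM (Ck_derivable Cf) (Ck_derivable Cg)).
by apply: CkD; apply: IH; [exact: Ck_pred|exact: Dg|exact: Ck_pred|exact: Df].
Qed.

Lemma derive_scalel (W : normedModType R) (f : V -> R) (c : W) p w : differentiable f p ->
  'D_w (fun p => f p *: c) p = 'D_w f p *: c.
Proof.
move=> df; rewrite !deriveE//; last exact: differentiableZl.
by have /(congr1 (fun h => h w)) := @diffZl R V W f c p df.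
Qed.

Lemma Ck_scalel (W : normedModType R) k (f : V -> R) (c : W) : Ck k f ->
  Ck k (fun p => f p *: c).
Proof.
elim: k f => [|k IH] f; first by move=> cf x; apply: cvgZr_tmp; exact: cf.
move=> [df Df]; split; first by move=> p; exact: differentiableZl.
move=> w; have -> : (fun p => derive (fun p => f p *: c) p w) =
    (fun p => 'D_w f p *: c).
  by apply/funext => p; exact: derive_scalel.
exact/IH/Df.
Qed.

Lemma Ck_sum (W : normedModType R) k (I : Type) (s : seq I) (F : I -> V -> W) :
  (forall i, Ck k (F i)) -> Ck k (fun p => \sum_(i <- s) F i p).
Proof.
move=> HF; elim: s => [|i s IH].
  by under eq_fun do rewrite big_nil; exact: Ck_cst.
by under eq_fun do rewrite big_cons; exact: CkD.
Qed.

Lemma Ck_prod k (I : Type) (s : seq I) (P : pred I) (F : I -> V -> R) :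
  (forall i, Ck k (F i)) -> Ck k (fun p => \prod_(i <- s | P i) F i p).
Proof.
move=> HF; elim: s => [|i s IH].
  by under eq_fun do rewrite big_nil; exact: Ck_cst.
under eq_fun do rewrite big_cons; case: (P i) => //; exact: CkM.
Qed.

Lemma CkV k (f : V -> R) : (forall p, f p != 0) -> Ck k f -> Ck k (fun p => (f p)^-1).
Proof.
move=> f0; elim: k => [|k IH].
  by move=> cf x; apply: cvgV => //; exact: cf.
move=> Cf; have [df Df] := Cf; split; first by move=> p; exact: differentiableV.
move=> w; have -> : (fun p => derive (fun p => (f p)^-1) p w) =
    (fun p => -1 * ((f p)^-1 * (f p)^-1 * 'D_w f p)).
  apply/funext => p; apply: (etrans (deriveV (f0 p) (Ck_derivable Cf))).
  by rewrite scaleNr mulN1r -[_ *: _]/(_ * _) expr2 invfM.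
apply: CkM; first exact: Ck_cst.
have := IH (Ck_pred Cf) => Ci.
by apply: CkM; [exact: CkM|exact: Df].
Qed.

Lemma derive_comp_aff (g : R -> R) (l : V -> R) (c : V -> R) p w :
  differentiable g (l p) -> differentiable l p -> 'D_w l p = c w ->
  'D_w (fun p => g (l p)) p = 'D_(c w) g (l p).
Proof.
move=> dg dl lc; rewrite !deriveE//; last exact: differentiable_comp.
have -> : 'd (fun p => g (l p)) p = 'd g (l p) \o 'd l p :> (_ -> _).
  exact: diff_comp.
by rewrite /= -lc deriveE.
Qed.

(** The inner function has constant directional derivatives, so differentiating the composite gives
    again a composite with [l], and the induction on [k] closes. *)
Lemma Ck_comp_aff k (g : R -> R) (l : V -> R) (c : V -> R) :
  (forall p, differentiable l p) -> (forall p w, 'D_w l p = c w) ->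
  Ck k g -> Ck k (fun p => g (l p)).
Proof.
move=> dl lc; elim: k g => [|k IH] g.
  move=> cg x; apply: continuous_comp; last exact: cg.
  exact: differentiable_continuous.
move=> [dg Dg]; split; first by move=> p; exact: differentiable_comp.
move=> w; have -> : (fun p => derive (fun p => g (l p)) p w) =
    (fun p => (fun x => 'D_(c w) g x) (l p)).
  by apply/funext => p; exact: derive_comp_aff.
exact: (IH _ (Dg (c w))).
Qed.

End CkCalculus.

(** * Smooth functions on the line that vanish on a half-line *)

Section Bump.
Context {R : realType}.

Lemma deriveR (f : R -> R) x w : differentiable f x -> 'D_w f x = w * 'D_1 f x.
Proof.
by move=> df; rewrite !deriveE// -[in LHS](mulr1 w) -[w * 1]/(w *: (1 : R)) linearZ.
Qed.

(** The classical function is [flat 0]. The powers are included because the linear span of the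
    family is closed under differentiation, which turns smoothness into an induction. *)
Definition flat (n : nat) (x : R) : R := if 0 < x then x ^- n * expR (- x^-1) else 0.

(** With [t = y^-1], the constant comes from raising [t <= n.+2%:R * expR (t / n.+2%:R)] to the
    power [n.+2]. Two powers of [t] are left over and give a quadratic bound. *)
Lemma flat_le (n : nat) : exists2 C : R, 0 <= C & forall x y, x <= 0 ->
  `|flat n y| <= C * (y - x) ^+ 2.
Proof.
exists (n.+2%:R ^+ n.+2) => [|x y x0]; first exact: exprn_ge0.
have C0 : 0 <= n.+2%:R ^+ n.+2 :> R by exact: exprn_ge0.
rewrite /flat; case: ltP => y0; last by rewrite normr0 mulr_ge0// sqr_ge0.
rewrite ger0_norm; last by rewrite mulr_ge0 ?expR_ge0// invr_ge0 exprn_ge0// ltW.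
apply: (@le_trans _ _ (n.+2%:R ^+ n.+2 * y ^+ 2)); last first.
  by rewrite ler_wpM2l// ler_sqr ?nnegrE//; lra.
pose t := y^-1; have t0 : 0 < t by rewrite invr_gt0.
have h : t ^+ n.+2 <= n.+2%:R ^+ n.+2 * expR t.
  have -> : expR t = expR (t / n.+2%:R) ^+ n.+2.
    by rewrite -expRM_natl -mulr_natl mulrCA divff ?mulr1// pnatr_eq0.
  rewrite -exprMn lerXn2r// ?nnegrE ?(ltW t0)// ?mulr_ge0 ?expR_ge0//.
  have := expR_ge1Dx (t / n.+2%:R).
  have n0 : 0 < n.+2%:R :> R by rewrite ltr0n.
  move=> /(ler_wpM2l (ltW n0)); rewrite mulrDr mulr1 mulrCA divff ?gt_eqF// mulr1.
  by apply: le_trans; rewrite lerDr ltW.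
rewrite -exprVn -/t expRN.
have yt : y ^+ 2 = (t ^+ 2)^-1 by rewrite /t exprVn invrK.
rewrite yt ler_pdivlMr ?exprn_gt0// mulrAC -exprD addn2.
by rewrite ler_pdivrMr ?expR_gt0.
Qed.

(** For positive [x] this is the product rule; for [x <= 0], including the gluing point, the
    quadratic bound of [flat_le] makes the difference quotient vanish. *)
Lemma flat_derive n (x : R) : is_derive x (1 : R) (flat n) (flat n.+2 x - n%:R * flat n.+1 x).
Proof.
have [x0|x0] := ltP 0 x; last first.
  have -> : flat n.+2 x - n%:R * flat n.+1 x = 0.
    by rewrite /flat !ltNge x0 /= mulr0 subrr.
  have fx : flat n x = 0 by rewrite /flat ltNge x0.
  have [C C0 HC] := flat_le n.
  have C1 : 0 < C + 1 by rewrite ltr_wpDl.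
  have cv : h^-1 *: (flat n (h *: 1 + x) - flat n x) @[h --> 0^'] --> (0 : R).
    apply/cvgrPdist_le => e e0; near=> h.
    have h0 : h != 0 by near: h; exact: nbhs_dnbhs_neq.
    rewrite fx subr0 sub0r normrN normrZ normfV.
    rewrite ler_pdivrMl ?normr_gt0//.
    apply: le_trans (HC x _ x0) _; rewrite -[h *: 1]/(h * 1) mulr1 addrK.
    have : `|h| <= e / (C + 1) by near: h; apply: dnbhs0_le; rewrite divr_gt0.
    rewrite ler_pdivlMr// => hC.
    have -> : h ^+ 2 = `|h| * `|h| by rewrite -expr2 real_normK ?num_real.
    by have := normr_ge0 h; nra.
  by apply: DeriveDef; [apply/cvg_ex; exists 0|exact/cvg_lim].
have xn0 : x != 0 by rewrite gt_eqF.
have D1 : is_derive x (1 : R) (fun y : R => y ^- n) (- n%:R * x ^- n.+1).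
  have Dn : is_derive x (1 : R) (fun y : R => y ^+ n) ((n%:R * x ^+ n.-1) *: 1).
    apply: DeriveDef; first exact: exprn_derivable.
    by rewrite exp_derive.
  have := @is_deriveV R (fun y => y ^+ n) x _ 1 (expf_neq0 n xn0) Dn.
  congr is_derive; rewrite -![_ *: _]/(_ * _) mulr1.
  case: n {Dn} => [|m]; first by rewrite mul0r mulr0 oppr0 mul0r.
  rewrite /= !exprS; have : x ^+ m != 0 by exact: expf_neq0.
  move: (x ^+ m) (m.+1%:R) => y z y0.
  by field; rewrite ?xn0 ?y0.
have D2 : is_derive x (1 : R) (fun y : R => expR (- y^-1)) (expR (- x^-1) * x ^- 2).
  have Di : is_derive x (1 : R) (fun y : R => - y^-1) (x ^- 2).
    have := is_deriveN (@is_deriveV R id x _ 1 xn0 (is_derive_id x (1 : R))).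
    by congr is_derive; rewrite -![_ *: _]/(_ * _) mulr1 opprK.
  have := @is_derive1_comp R expR (fun y : R => - y^-1) x _ _ (is_derive_expR _) Di.
  exact.
pose g (y : R) := y ^- n * expR (- y^-1).
have Dg : is_derive x (1 : R) g (flat n.+2 x - n%:R * flat n.+1 x).
  have := is_deriveM D1 D2; congr is_derive.
  rewrite /flat x0 -![_ *: _]/(_ * _) !exprS.
  have : x ^+ n != 0 by exact: expf_neq0.
  move: (x ^+ n) (expR _) (n%:R : R) => y z t y0; rewrite expr0.
  by field; rewrite ?xn0 ?y0.
apply: near_eq_is_derive Dg; near=> y.
have y0 : 0 < y by near: y; exact: lt_nbhsr.
by rewrite /flat y0.
Unshelve. all: by end_near. Qed.

End Bump.

Section Theta.
Context {R : realType}.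
Lemma flat0_ge0 (x : R) : 0 <= flat 0 x.
Proof. by rewrite /flat; case: ifP => // _; rewrite expr0 invr1 mul1r expR_ge0. Qed.

Lemma flat0_gt0 (x : R) : 0 < x -> 0 < flat 0 x.
Proof. by move=> x0; rewrite /flat x0 expr0 invr1 mul1r expR_gt0. Qed.

Lemma flat0_eq0 (x : R) : x <= 0 -> flat 0 x = 0.
Proof. by move=> x0; rewrite /flat ltNge x0. Qed.

Local Notation flat := (@flat R).

Lemma flat_differentiable n (x : R) : differentiable (flat n) x.
Proof. by apply/derivable1_diffP; have [] := flat_derive n x. Qed.

Lemma flat_smooth n k : Ck k (flat n).
Proof.
elim: k n => [|k IH] n.
  by move=> x; apply: differentiable_continuous; exact: flat_differentiable.
split; first by move=> x; exact: flat_differentiable.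
move=> w; have -> : (fun p => derive (flat n) p w) =
    (fun x => w * (flat n.+2 x + (- n%:R) * flat n.+1 x)).
  apply/funext => x; rewrite deriveR; last exact: flat_differentiable.
  by have [_ ->] := flat_derive n x; rewrite mulNr.
apply: CkM; first exact: Ck_cst.
by apply: CkD => //; apply: CkM => //; exact: Ck_cst.
Qed.

(** A smooth step from 0 to 1 across the unit interval; the denominator is positive because [x] and
    [1 - x] are not both nonpositive. *)
Definition theta (x : R) : R := flat 0 x * (flat 0 x + flat 0 (1 - x))^-1.

Let den_gt0 (x : R) : 0 < flat 0 x + flat 0 (1 - x).
Proof.
have [x0|x0] := ltP 0 x.
  by rewrite ltr_wpDr ?flat0_ge0 ?flat0_gt0.
by rewrite ltr_wpDl ?flat0_ge0 ?flat0_gt0//; lra.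
Qed.

Lemma affR_derive (a b : R) p :
  is_derive p (1 : R) (fun x : R => a * x + b) a /\ differentiable (fun x : R => a * x + b) p.
Proof.
have D : is_derive p (1 : R) (fun x : R => a * x + b) a.
  have := is_deriveD (is_deriveZ a (is_derive_id p (1 : R))) (is_derive_cst b p (1 : R)).
  by congr is_derive; rewrite addr0 -[_ *: _]/(_ * _) mulr1.
by split => //; apply/derivable1_diffP; have [] := D.
Qed.

Lemma Ck_compR k (g : R -> R) (a b : R) : Ck k g -> Ck k (fun x => g (a * x + b)).
Proof.
apply: (@Ck_comp_aff R R k g (fun x : R => a * x + b) (fun w => w * a)).
  by move=> p; have [] := affR_derive a b p.
move=> p w; have [[_ D] df] := affR_derive a b p.
by rewrite deriveR// D.
Qed.

Lemma theta_smooth k : Ck k theta.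
Proof.
apply: CkM; first exact: flat_smooth.
apply: CkV; first by move=> p; rewrite gt_eqF.
apply: CkD; first exact: flat_smooth.
have := @Ck_compR k (flat 0) (-1) 1 (flat_smooth 0 k).
by congr Ck; apply/funext => x; rewrite mulN1r addrC.
Qed.

Lemma theta_ge0 x : 0 <= theta x.
Proof. by rewrite mulr_ge0 ?flat0_ge0// invr_ge0 ltW. Qed.

Lemma theta_le1 x : theta x <= 1.
Proof. by rewrite ler_pdivrMr// mul1r lerDl flat0_ge0. Qed.

Lemma theta_eq0 x : x <= 0 -> theta x = 0.
Proof. by move=> x0; rewrite /theta flat0_eq0// mul0r. Qed.

Lemma theta_eq1 x : 1 <= x -> theta x = 1.
Proof.
move=> x1; rewrite /theta (@flat0_eq0 (1 - x)); last by lra.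
by rewrite addr0 divff// gt_eqF// flat0_gt0//; lra.
Qed.

#[local] Opaque theta.

Definition dtheta (x : R) : R := 'D_1 theta x.

Lemma theta_differentiable x : differentiable theta x.
Proof. by have [] := theta_smooth 1. Qed.

Let dtheta_ext (f : R -> R) x : (forall y, derivable f y 1) ->
  (forall y, f y <= f x) -> 'D_1 f x = 0.
Proof.
move=> df fx; have [||||_ ->//] := @derive1_at_max R f (x - 1) (x + 1) x.
- lra.
- by move=> y _; exact: df.
- by rewrite in_itv /=; apply/andP; split; lra.
- by move=> y _; exact: fx.
Qed.

(** At these points [theta] attains its global minimum 0 or its global maximum 1, so the derivative
    vanishes, also at the two endpoints. *)
Lemma dtheta_eq0 x : x <= 0 \/ 1 <= x -> dtheta x = 0.
Proof.
have dth y : derivable theta y 1 by apply: diff_derivable; exact: theta_differentiable.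
move=> [x0|x1]; last first.
  by apply: dtheta_ext => // y; rewrite (theta_eq1 x1) theta_le1.
have : 'D_1 (fun y => - theta y) x = 0.
  apply: dtheta_ext => y; first exact: derivableN.
  by rewrite (theta_eq0 x0) oppr0 oppr_le0 theta_ge0.
rewrite (_ : (fun y => - theta y) = - theta)// deriveN// => /eqP.
by rewrite oppr_eq0 => /eqP.
Qed.

Lemma dtheta_bounded : exists2 B : R, 0 < B & forall x, `|dtheta x| <= B.
Proof.
have cd : continuous dtheta by have [_ /(_ 1)] := theta_smooth 1.
have cn : {within `[0 : R, 1], continuous (fun x => `|dtheta x|)}.
  apply: continuous_subspaceT => x.
  by apply: continuous_comp; [exact: cd|exact: norm_continuous].
have [c _ cmax] := EVT_max ler01 cn.
exists (`|dtheta c| + 1) => [|x]; first by rewrite ltr_wpDl.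
have [x0|x0] := leP x 0; first by rewrite dtheta_eq0 ?normr0 ?addr_ge0//; left.
have [x1|x1] := leP 1 x; first by rewrite dtheta_eq0 ?normr0 ?addr_ge0//; right.
rewrite (le_trans (cmax x _)) ?lerDl// in_itv /=; apply/andP; split; exact: ltW.
Qed.

(* Being a difference of translates of [theta], its integer translates sum up
   telescopically to 1. *)
Definition hat (x : R) : R := theta (x + 1) - theta x.
Definition dhat (x : R) : R := dtheta (x + 1) - dtheta x.

Lemma hat_ge0 x : 0 <= hat x.
Proof.
rewrite /hat; have [x0|x0] := leP x 0; first by rewrite (theta_eq0 x0) subr0 theta_ge0.
by rewrite (@theta_eq1 (x + 1)) ?subr_ge0 ?theta_le1//; lra.
Qed.

Lemma hat_out x : 1 < `|x| -> hat x = 0 /\ dhat x = 0.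
Proof.
rewrite ltr_normr => /orP[h|h].
  by rewrite /hat /dhat !theta_eq1 ?subrr ?dtheta_eq0 ?subr0//; try right; lra.
by rewrite /hat /dhat !theta_eq0 ?subrr ?dtheta_eq0 ?subr0//; try left; lra.
Qed.

Lemma hat_smooth k : Ck k hat.
Proof.
rewrite /hat; have -> : (fun x => theta (x + 1) - theta x) =
   (fun x => theta (1 * x + 1) + (-1) * theta x).
  by apply/funext => x; rewrite mul1r mulN1r.
apply: CkD; first by apply: Ck_compR; exact: theta_smooth.
by apply: CkM; [exact: Ck_cst|exact: theta_smooth].
Qed.

Lemma derive_hat x : 'D_1 hat x = dhat x.
Proof.
have E : (fun y : R => theta (y + 1)) = (fun y => theta (1 * y + 1)).
  by apply/funext => y; rewrite mul1r.
have d1 : derivable (fun y : R => theta (y + 1)) x 1.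
  rewrite E; apply: diff_derivable.
  by have [] := @Ck_compR 1 theta 1 1 (theta_smooth 1).
have d2 : derivable theta x 1 by apply: diff_derivable; exact: theta_differentiable.
rewrite /dhat /dtheta.
apply: (etrans (deriveB d1 d2)); congr (_ - _).
have [[_ D] df] := affR_derive 1 1 x.
rewrite E; apply: etrans (@derive_comp_aff R R theta (fun y : R => 1 * y + 1) (fun w => w) x 1
  (theta_differentiable _) df D) _.
by rewrite mul1r.
Qed.

Lemma sum_hat (s : R) n : \sum_(j < n) hat (s - j%:R) = theta (s + 1) - theta (s + 1 - n%:R).
Proof.
elim: n => [|n IH]; first by rewrite big_ord0 subr0 subrr.
rewrite big_ord_recr /= IH /hat.
have -> : s - n%:R + 1 = s + 1 - n%:R by ring.
have -> : s + 1 - n.+1%:R = s - n%:R by rewrite -natr1; lra.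
exact: subrKA.
Qed.

Lemma sum_dhat (s : R) n : \sum_(j < n) dhat (s - j%:R) = dtheta (s + 1) - dtheta (s + 1 - n%:R).
Proof.
elim: n => [|n IH]; first by rewrite big_ord0 subr0 subrr.
rewrite big_ord_recr /= IH /dhat.
have -> : s - n%:R + 1 = s + 1 - n%:R by ring.
have -> : s + 1 - n.+1%:R = s - n%:R by rewrite -natr1; lra.
exact: subrKA.
Qed.

(** The bound must not depend on the number of translates. As [dtheta] lives on one unit interval,
    it is dominated by [B * (H x - H (x - 1))] with [H] the Heaviside function, and the integer
    translates of this majorant telescope. *)
Lemma sum_abs_dhat : exists2 B : R, 0 < B &
  forall (s : R) n, \sum_(j < n) `|dhat (s - j%:R)| <= B.
Proof.
have [B B0 HB] := dtheta_bounded.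
pose H (x : R) : R := ((0 < x)%R)%:R.
have HD x : `|dtheta x| <= B * (H x - H (x - 1)).
  have [x0|x0] := leP x 0.
    rewrite dtheta_eq0; last by left.
    by rewrite normr0 /H !ltNge x0 (_ : x - 1 <= 0) ?subrr ?mulr0//; lra.
  have [x1|x1] := ltP 1 x.
    rewrite dtheta_eq0; last by right; exact: ltW.
    by rewrite normr0 /H x0 (_ : 0 < x - 1) ?subrr ?mulr0//; lra.
  by rewrite /H x0 ltNge (_ : x - 1 <= 0) ?subr0 ?mulr1//; lra.
have S (s : R) n : \sum_(j < n) `|dtheta (s - j%:R)| <= B.
  apply: (@le_trans _ _ (\sum_(j < n) B * (H (s - j%:R) - H (s - j.+1%:R)))).
    apply: ler_sum => j _; apply: le_trans (HD _) _.
    by have -> : s - j.+1%:R = s - j%:R - 1 by rewrite -natr1; ring.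
  rewrite -mulr_sumr -(big_mkord xpredT (fun j => H (s - j%:R) - H (s - j.+1%:R))).
  have -> : \sum_(0 <= j < n) (H (s - j%:R) - H (s - j.+1%:R)) = H s - H (s - n%:R).
    elim: n => [|n IH]; first by rewrite big_geq// subr0 subrr.
    by rewrite big_nat_recr//= IH; ring.
  rewrite ler_piMr ?(ltW B0)// /H.
  by case: (0 < s); case: (0 < s - n%:R) => /=; lra.
exists (B + B) => [|s n]; first by rewrite addr_gt0.
apply: (@le_trans _ _ (\sum_(j < n) (`|dtheta (s + 1 - j%:R)| + `|dtheta (s - j%:R)|))).
  apply: ler_sum => j _; rewrite /dhat; have -> : s - j%:R + 1 = s + 1 - j%:R by ring.
  exact: ler_normB.
by rewrite big_split /=; apply: lerD; exact: S.
Qed.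

End Theta.

Section Coordinates.
Context {R : realType} {d q : nat}.
Local Notation X := (@Xsp R d q).
(** The coordinates of both factors are indexed together, so that grids and gradients on the product
    run over a single finite type. *)
Definition idx : finType := ('I_d + 'I_q)%type.

Definition co (i : idx) (x : X) : R :=
  match i with inl a => x.1 0 a | inr b => x.2 0 b end.

Definition ev (i : idx) : X :=
  match i with inl a => (delta_mx 0 a, 0) | inr b => (0, delta_mx 0 b) end.

Lemma co_lin i a x y : co i (a *: x + y) = a * co i x + co i y.
Proof. by case: i => i; rewrite /co /= !mxE. Qed.

Lemma coD i x y : co i (x + y) = co i x + co i y.
Proof. by have := co_lin i 1 x y; rewrite scale1r mul1r. Qed.

Lemma coZ i a x : co i (a *: x) = a * co i x.
Proof. by case: i => i; rewrite /co /= !mxE. Qed.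

Lemma coN i x : co i (- x) = - co i x.
Proof. by rewrite -scaleN1r coZ mulN1r. Qed.

Lemma co_sum i (J : Type) (s : seq J) (F : J -> X) :
  co i (\sum_(j <- s) F j) = \sum_(j <- s) co i (F j).
Proof.
have c0 : co i 0 = 0 by case: i => i; rewrite /co /= mxE.
exact: (big_morph (co i) (coD i) c0).
Qed.

Lemma co_ev i j : co i (ev j) = (i == j)%:R.
Proof.
case: i j => i [] j; rewrite /co /= ?mxE ?eqxx//=.
Qed.

Lemma co_inj x y : (forall i, co i x = co i y) -> x = y.
Proof.
case: x y => x1 x2 [y1 y2] h; congr pair; apply/rowP => j.
  exact: (h (inl j)).
exact: (h (inr j)).
Qed.

Lemma X_sum x : x = \sum_i co i x *: ev i.
Proof.
apply: co_inj => i; rewrite co_sum (bigD1 i)//= coZ co_ev eqxx mulr1.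
rewrite big1 ?addr0// => j ji; rewrite coZ co_ev eq_sym (negbTE ji) mulr0//.
Qed.

Let coord_norm n (u : 'rV[R]_n) j : `|u 0 j| <= `|u|.
Proof.
by rewrite [leRHS]/Num.norm /= mx_normrE; apply/bigmax_geP; right; exists (0, j).
Qed.

Lemma co_norm i x : `|co i x| <= `|x|.
Proof.
rewrite prod_normE le_max; case: i => i; rewrite /co /= coord_norm ?orbT//.
Qed.

Let norm_coord n (u : 'rV[R]_n) h : 0 <= h -> (forall j, `|u 0 j| <= h) -> `|u| <= h.
Proof.
move=> h0 uh; rewrite [leLHS]/Num.norm /= mx_normrE; apply/bigmax_leP; split => // -[i j] _ /=.
by rewrite ord1.
Qed.

Lemma norm_co x h : 0 <= h -> (forall i, `|co i x| <= h) -> `|x| <= h.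
Proof.
move=> h0 xh; rewrite prod_normE ge_max; apply/andP; split; apply: norm_coord => // j.
  exact: (xh (inl j)).
exact: (xh (inr j)).
Qed.

Lemma co_cts i : continuous (co i).
Proof.
apply: (@lipschitz_cts _ _ _ 1) => u w; rewrite mul1r.
by rewrite -coN -coD; exact: co_norm.
Qed.

HB.instance Definition _ i := GRing.isLinear.Build R X R _ (co i) (co_lin i).

Lemma co_differentiable i p : differentiable (co i) p.
Proof. by apply: linear_differentiable; exact: co_cts. Qed.

Lemma derive_line (W : normedModType R) (f : X -> W) p w c :
  (forall h : R, f (h *: w + p) = f p + h *: c) -> 'D_w f p = c.
Proof.
move=> hf; apply/cvg_lim => //; apply: cvg_near_cst; near=> h.
have h0 : h != 0 by near: h; exact: nbhs_dnbhs_neq.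
by rewrite /= hf addrC addKr scalerA mulVf// scale1r.
Unshelve. all: by end_near. Qed.

Lemma co_aff (a b : R) i : (forall p, differentiable (fun x => a * co i x + b) p) /\
  forall p w, 'D_w (fun x => a * co i x + b) p = a * co i w.
Proof.
split=> p.
  apply: differentiableD; last exact: differentiable_cst.
  exact: (differentiableZ a (co_differentiable i p)).
move=> w; apply: derive_line => h.
by rewrite co_lin -[_ *: _]/(_ * _); ring.
Qed.

Lemma derive_coord (f : X -> R) p w : differentiable f p ->
  'D_w f p = \sum_i co i w * 'D_(ev i) f p.
Proof.
move=> df; rewrite deriveE// {1}(X_sum w) linear_sum; apply: eq_bigr => i _.
by rewrite linearZ deriveE.
Qed.

Lemma derive_bigsum (J : Type) (s : seq J) (F : J -> X -> R) p w :
  (forall j, Ck 1 (F j)) ->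
  'D_w (fun p => \sum_(j <- s) F j p) p = \sum_(j <- s) 'D_w (F j) p.
Proof.
move=> HF; elim: s => [|j s IH].
  rewrite big_nil; under eq_fun do rewrite big_nil; exact: derive_cst.
rewrite big_cons -IH; under eq_fun do rewrite big_cons.
exact: (deriveD (Ck_derivable (HF j)) (Ck_derivable (Ck_sum s HF))).
Qed.

Lemma derive_out (K : set X) (f : X -> R) p w : compact K ->
  (forall x, ~ K x -> f x = 0) -> ~ K p -> 'D_w f p = 0.
Proof.
move=> cK fK nKp.
have oK : open (~` K) by apply: closed_openC; apply: compact_closed => //; exact: norm_hausdorff.
rewrite (@near_eq_derive _ _ _ f (cst 0)); first exact: derive_cst.
have : nbhs p (~` K) by exact: open_nbhs_nbhs.
by apply: filterS => x /fK.
Qed.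

Lemma mean_value (f : X -> R) z p : (forall x, differentiable f x) ->
  exists t, 0 <= t <= 1 /\ f p - f z = 'D_(p - z) f (z + t *: (p - z)).
Proof.
move=> df; set w := p - z.
pose g (t : R) := f (z + t *: w).
have Dg t : is_derive t (1 : R) g ('D_w f (z + t *: w)).
  have dfw : derivable f (z + t *: w) w by exact: diff_derivable.
  have e : (fun h : R => h^-1 *: (g (h *: 1 + t) - g t)) =
           (fun h => h^-1 *: (f (h *: w + (z + t *: w)) - f (z + t *: w))).
    apply/funext => h; rewrite /g; congr (_ *: (f _ - _)).
    by rewrite -[h *: 1]/(h * 1) mulr1 scalerDl addrCA.
  by apply: DeriveDef; rewrite /derivable /derive /= e.
have cg : {within `[0 : R, 1], continuous g}.
  apply: continuous_subspaceT => t; apply: differentiable_continuous.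
  by apply/derivable1_diffP; have [] := Dg t.
have [t] := MVT ltr01 (fun x _ => Dg x) cg.
rewrite in_itv /= => /andP[t0 t1] h; exists t; rewrite !ltW//; split => //.
have e : z + w = p by rewrite /w addrCA subrr addr0.
by move: h; rewrite subr0 mulr1 /g scale1r scale0r addr0 e.
Qed.

(** Heine's theorem, phrased along the filter of small positive [dl] so that finitely many functions
    get a common [dl]. *)
Lemma uniform_near (g : X -> R) (K : set X) (e : R) : continuous g -> compact K ->
  (forall x, ~ K x -> g x = 0) -> 0 < e ->
  \forall dl \near (0 : R)^'+, forall x y, `|x - y| < dl -> `|g x - g y| <= e.
Proof.
move=> gc cK gK e0.
have H : \forall dl \near (0 : R)^'+, K `<=` [set x | forall y, `|x - y| < dl -> `|g x - g y| <= e].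
  apply: ((compact_near_coveringP K).1 cK) => x Kx.
  have e2 : 0 < e / 2 by rewrite divr_gt0.
  have /nbhs_ballP[r /= r0 hr] : nbhs x [set y | `|g x - g y| < e / 2].
    by have /cvgrPdist_lt/(_ _ e2) := gc x.
  exists (ball x (r / 2), [set dl | 0 < dl /\ dl < r / 2]).
    split; first by apply: nbhsx_ballx; rewrite divr_gt0.
    by near=> dl; split => //=; near: dl; apply: nbhs_right_lt; rewrite divr_gt0.
  move=> [x' dl] /= []; rewrite -ball_normE /ball_ /= => h1 [dl0 h2] y h3.
  have b1 : `|g x - g x'| < e / 2.
    by apply: hr; rewrite -ball_normE /ball_ /=; lra.
  have b2 : `|g x - g y| < e / 2.
    apply: hr; rewrite -ball_normE /ball_ /=.
    by have := ler_distD x' x y; lra.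
  by have := ler_distD (g x) (g x') (g y); rewrite (distrC (g x') (g x)); lra.
near=> dl => x y xy.
have Hd : K `<=` [set x | forall y, `|x - y| < dl -> `|g x - g y| <= e] by near: dl.
have [Kx|nKx] := pselect (K x); first exact: Hd.
have [Ky|nKy] := pselect (K y).
  by rewrite distrC; apply: Hd => //; rewrite distrC.
by rewrite !gK// subrr normr0 ltW.
Unshelve. all: by end_near. Qed.

Lemma compact_margin (O K : set X) : open O -> compact K -> K `<=` O ->
  exists2 dl : R, 0 < dl & forall z y, K z -> `|z - y| <= dl -> O y.
Proof.
move=> oO cK KO.
have [[z0 Kz0]|K0] := pselect (K !=set0); last first.
  by exists 1 => // z y Kz; exfalso; apply: K0; exists z.
have [||c /set_mem Kc cmin] := @compact_EVT_min X R (dst (~` O)) K _ cK.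
- by exists z0.
- by apply: continuous_subspaceT; exact: dst_cts.
have m0 : 0 < dst (~` O) c by apply: dst_out; [exact: open_closedC|move=> /(_ (KO _ Kc))].
exists (dst (~` O) c / 2) => [|z y Kz zy]; first by rewrite divr_gt0.
apply: contrapT => nO.
have := cmin z (mem_set Kz); have := dst_lip (~` O) z y.
by rewrite (dst_in nO) subr0 mul1r ger0_norm ?dst_ge0//; lra.
Qed.

End Coordinates.

(** * Quasi-interpolation of a C^1 function on a grid *)

Section SmoothApprox.
Context {R : realType} {d q : nat}.
Local Notation X := (@Xsp R d q).
Local Notation idx := (@idx d q).

Section QuasiInterpolant.
Variables (f : X -> R) (h : R) (N : nat).
Hypotheses (h0 : 0 < h) (Cf : Ck 1 f).
Local Notation M := N.*2.+1.
Local Notation grid := {ffun idx -> 'I_M}.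
Implicit Types (k : grid) (i : idx) (p : X).

(** There are [2 N + 1] indices on each axis; the shift by [N] centres the grid at the origin. *)
Definition node k : X := \sum_i (h * ((k i)%:R - N%:R)) *: ev i.

Definition arg i (m : nat) p : R := h^-1 * co i p + (N%:R - m%:R).

Definition cell k p : R := \prod_i hat (arg i (k i) p).

Definition dcell i0 k p : R := h^-1 * (\prod_i (if i == i0 then dhat else hat) (arg i (k i) p)).

Definition taylor k p : R :=
  f (node k) + \sum_i (co i p - co i (node k)) * 'D_(ev i) f (node k).

(* With Taylor polynomials instead of the values at the nodes the gradient
   converges as well: their error o(h) beats the factor 1/h in [dcell]. *)
Definition quasi p : R := \sum_k taylor k p * cell k p.

Lemma co_node i k : co i (node k) = h * ((k i)%:R - N%:R).
Proof.
rewrite /node co_sum (bigD1 i)//= coZ co_ev eqxx mulr1.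
by rewrite big1 ?addr0// => j ji; rewrite coZ co_ev eq_sym (negbTE ji) mulr0.
Qed.

Lemma arg_node i k p : arg i (k i) p = h^-1 * co i (p - node k).
Proof.
rewrite /arg coD coN co_node mulrBr mulrA mulVf ?gt_eqF// mul1r; ring.
Qed.

Lemma cell_out k p : ~ (forall i, `|co i (p - node k)| <= h) ->
  cell k p = 0 /\ forall i0, dcell i0 k p = 0.
Proof.
move=> /existsNP[i]; move/negP; rewrite -ltNge => hi.
have [|hh dh] := @hat_out R (arg i (k i) p).
  rewrite arg_node normrM normfV (gtr0_norm h0) mulrC ltr_pdivlMr// mul1r//.
split; first by rewrite /cell (bigD1 i)//= hh mul0r.
by move=> i0; rewrite /dcell (bigD1 i)//=; case: ifP; rewrite ?hh ?dh mul0r mulr0.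
Qed.

Lemma cell_smooth k : smooth (cell k).
Proof.
move=> n; apply: Ck_prod => i; have [dl cl] := @co_aff R d q h^-1 (N%:R - (k i)%:R) i.
exact: (@Ck_comp_aff _ _ n hat (arg i (k i)) _ dl cl (hat_smooth n)).
Qed.

Lemma taylor_smooth k : smooth (taylor k).
Proof.
move=> n; apply: CkD; first exact: Ck_cst.
apply: Ck_sum => i; apply: CkM; last exact: Ck_cst.
have [dl cl] := @co_aff R d q 1 (- co i (node k)) i.
have -> : (fun p => co i p - co i (node k)) = (fun p => 1 * co i p - co i (node k)).
  by apply/funext => p; rewrite mul1r.
case: n => [|n]; first by move=> x; exact: differentiable_continuous.
split => // w; have -> : (fun p => 'D_w (fun p => 1 * co i p - co i (node k)) p) =
   fun=> 1 * co i w by exact/funext.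
exact: Ck_cst.
Qed.

Lemma quasi_smooth : smooth quasi.
Proof.
by move=> n; apply: Ck_sum => k; apply: CkM; [exact: taylor_smooth|exact: cell_smooth].
Qed.

Lemma derive_taylor k p i : 'D_(ev i) (taylor k) p = 'D_(ev i) f (node k).
Proof.
apply: derive_line => t; rewrite /taylor -addrA; congr (_ + _).
rewrite [LHS](eq_bigr (fun j => (co j p - co j (node k)) * 'D_(ev j) f (node k) +
   t * (j == i)%:R * 'D_(ev j) f (node k))); last first.
  by move=> j _; rewrite co_lin co_ev; ring.
rewrite big_split /=; congr (_ + _).
rewrite (bigD1 i)//= eqxx mulr1 big1 ?addr0// => j /negbTE ->.
by rewrite mulr0 mul0r.
Qed.

Lemma derive_cell i0 k p : 'D_(ev i0) (cell k) p = dcell i0 k p.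
Proof.
pose A p := hat (arg i0 (k i0) p).
pose B p := \prod_(i | i != i0) hat (arg i (k i) p).
have cAB : cell k = (fun p => A p * B p) by apply/funext => x; rewrite /cell (bigD1 i0).
have Chat i n : Ck n (fun p => hat (arg i (k i) p)).
  have [dl cl] := @co_aff R d q h^-1 (N%:R - (k i)%:R) i.
  exact: (@Ck_comp_aff _ _ n hat (arg i (k i)) _ dl cl (hat_smooth n)).
have CA : Ck 1 A := Chat i0 1%N.
have CB : Ck 1 B by apply: Ck_prod => i; exact: Chat.
have DB : 'D_(ev i0) B p = 0.
  apply: derive_line => t; rewrite scaler0 addr0; apply: eq_bigr => i ii0.
  by rewrite /arg co_lin co_ev (negbTE ii0) mulr0 add0r.
have DA : 'D_(ev i0) A p = h^-1 * dhat (arg i0 (k i0) p).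
  have [dl cl] := @co_aff R d q h^-1 (N%:R - (k i0)%:R) i0.
  have dh : differentiable (@hat R) (arg i0 (k i0) p) by have [] := @hat_smooth R 1.
  rewrite (@derive_comp_aff R X hat (arg i0 (k i0)) (fun w => h^-1 * co i0 w))//.
  by rewrite deriveR// derive_hat co_ev eqxx mulr1.
rewrite cAB.
have := deriveM (Ck_derivable CA : derivable A p (ev i0)) (Ck_derivable CB).
move=> ->; rewrite DA DB scaler0 add0r -[_ *: _]/(_ * _) mulrC /dcell -mulrA.
congr (_ * _); rewrite (bigD1 i0)//= eqxx; congr (_ * _).
by apply: eq_bigr => i /negbTE ->.
Qed.

Lemma derive_quasi p i : 'D_(ev i) quasi p =
  \sum_k (taylor k p * dcell i k p + 'D_(ev i) f (node k) * cell k p).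
Proof.
rewrite /quasi derive_bigsum; last first.
  by move=> k; apply: CkM; [exact: taylor_smooth|exact: cell_smooth].
apply: eq_bigr => k _.
have := deriveM (Ck_derivable (taylor_smooth k 1%N) : derivable (taylor k) p (ev i))
  (Ck_derivable (cell_smooth k 1%N)).
by move=> ->; rewrite derive_taylor derive_cell -![_ *: _]/(_ * _) (mulrC (cell k p)).
Qed.

(** All coordinates of [p] are at most [N * h] in absolute value, rescaled. In this region the
    finite grid still gives a full partition of unity. *)
Definition inbox p := forall i, 0 <= h^-1 * co i p + N%:R <= N.*2%:R.

Lemma cell_ge0 k p : 0 <= cell k p.
Proof. by apply: prodr_ge0 => i _; exact: hat_ge0. Qed.

Let argE i m p : arg i m p = (h^-1 * co i p + N%:R) - m%:R.
Proof. by rewrite /arg addrA. Qed.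

Lemma sum_hat_le1 i p : 0 <= \sum_(m < M) hat (arg i m p) <= 1.
Proof.
apply/andP; split; first by apply: sumr_ge0 => m _; exact: hat_ge0.
under eq_bigr do rewrite argE; rewrite sum_hat.
set a := theta _; set b := theta _.
have : a <= 1 := theta_le1 _; have : 0 <= b := theta_ge0 _; lra.
Qed.

Lemma sum_hat_inbox i p : inbox p -> \sum_(m < M) hat (arg i m p) = 1.
Proof.
move=> /(_ i) /andP[b0 b1].
under eq_bigr do rewrite argE; rewrite sum_hat.
rewrite theta_eq1; last by lra.
by rewrite theta_eq0 ?subr0// -natr1; lra.
Qed.

Lemma sum_dhat_inbox i p : inbox p -> \sum_(m < M) dhat (arg i m p) = 0.
Proof.
move=> /(_ i) /andP[b0 b1].
under eq_bigr do rewrite argE; rewrite sum_dhat.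
rewrite !dtheta_eq0 ?subrr//; [left; rewrite -natr1; lra|right; lra].
Qed.

Lemma sum_cell p : inbox p -> \sum_k cell k p = 1.
Proof.
move=> bp; rewrite /cell -(bigA_distr_bigA (fun i (m : 'I_M) => hat (arg i m p))).
by rewrite big1// => i _; exact: sum_hat_inbox.
Qed.

Lemma sum_dcell p i : inbox p -> \sum_k dcell i k p = 0.
Proof.
move=> bp; rewrite /dcell -mulr_sumr.
rewrite -(bigA_distr_bigA (fun j (m : 'I_M) => (if j == i then dhat else hat) (arg j m p))).
by rewrite (bigD1 i)//= eqxx sum_dhat_inbox// mul0r mulr0.
Qed.

(** The sum over the grid is a product of one-dimensional sums: the differentiated axis contributes
    at most [B] and each other axis at most 1, independently of the number of nodes. *)
Lemma sum_abs_dcell (B : R) p i : 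
  (forall (s : R) n, \sum_(j < n) `|dhat (s - j%:R)| <= B) ->
  \sum_k `|dcell i k p| <= h^-1 * B.
Proof.
move=> HB; under eq_bigr do rewrite /dcell normrM ger0_norm ?invr_ge0 ?(ltW h0)// normr_prod.
rewrite -mulr_sumr ler_wpM2l ?invr_ge0 ?(ltW h0)//.
rewrite -(bigA_distr_bigA (fun j (m : 'I_M) => `|(if j == i then dhat else hat) (arg j m p)|)).
rewrite (bigD1 i)//= eqxx.
have B1 : \sum_(m < M) `|dhat (arg i m p)| <= B.
  by under eq_bigr do rewrite argE; exact: HB.
have P1 : 0 <= \prod_(j | j != i) \sum_(m < M) `|(if j == i then dhat else hat) (arg j m p)| <= 1.
  have h01 j : j != i ->
    0 <= \sum_(m < M) `|(if j == i then dhat else hat) (arg j m p)| <= 1.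
    move=> /negbTE ->; under eq_bigr do rewrite ger0_norm ?hat_ge0//.
    exact: sum_hat_le1.
  apply/andP; split; first by apply: prodr_ge0 => j /h01 /andP[].
  by apply: le_trans (ler_prod _ h01) _; rewrite big1.
have S0 : 0 <= \sum_(m < M) `|dhat (arg i m p)| by exact: sumr_ge0.
by have /andP[? ?] := P1; rewrite -[leRHS]mulr1 ler_pM.
Qed.

(** Because the cells sum to 1 and their derivatives to 0, the values of [f] and of its derivative
    at [p] can be subtracted under the sum; only nodes within [h] of [p] contribute. *)
Lemma quasi_error (om B : R) p i : 0 < B -> 0 <= om -> 
  (forall (s : R) n, \sum_(j < n) `|dhat (s - j%:R)| <= B) ->
  (forall j x y, `|x - y| <= h -> `|'D_(ev j) f x - 'D_(ev j) f y| <= om) ->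
  inbox p -> `|'D_(ev i) quasi p - 'D_(ev i) f p| <= om * (1 + #|idx|%:R * B).
Proof.
move=> B0 om0 HB Hom bp.
have df x : differentiable f x by have [] := Cf.
have -> : 'D_(ev i) quasi p - 'D_(ev i) f p =
  \sum_k ((taylor k p - f p) * dcell i k p +
          ('D_(ev i) f (node k) - 'D_(ev i) f p) * cell k p).
  rewrite derive_quasi.
  rewrite [RHS](eq_bigr (fun k => (taylor k p * dcell i k p + 'D_(ev i) f (node k) * cell k p)
    - (f p * dcell i k p + 'D_(ev i) f p * cell k p))); last by move=> k _; ring.
  rewrite sumrB; congr (_ - _).
  rewrite big_split /=.
  have <- : f p * (\sum_k dcell i k p) = \sum_k f p * dcell i k p by rewrite mulr_sumr.
  have <- : 'D_(ev i) f p * (\sum_k cell k p) = \sum_k 'D_(ev i) f p * cell k p.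
    by rewrite mulr_sumr.
  by rewrite sum_dcell// sum_cell// mulr0 add0r mulr1.
apply: le_trans (ler_norm_sum _ _ _) _.
apply: (@le_trans _ _ (\sum_k (#|idx|%:R * h * om * `|dcell i k p| + om * cell k p))).
  apply: ler_sum => k _.
  have [near|far] := pselect (forall j, `|co j (p - node k)| <= h); last first.
    have [-> ->] := cell_out far.
    by rewrite !mulr0 addr0 normr0 mulr0 addr0.
  have pn : `|p - node k| <= h by apply: norm_co => //; exact: ltW.
  apply: le_trans (ler_normD _ _) _; apply: lerD; rewrite normrM.
    rewrite ler_wpM2r//.
    have [t [/andP[t0 t1] mv]] := mean_value (node k) p df.
    (* As [f] is only C^1, the mean value theorem expresses the Taylor remainder through differences
       of first derivatives at points within [h], each at most [om]. *)
    have -> : taylor k p - f p = \sum_j co j (p - node k) *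
       ('D_(ev j) f (node k) - 'D_(ev j) f (node k + t *: (p - node k))).
      under eq_bigr do rewrite mulrBr.
      rewrite sumrB -(derive_coord _ (df (node k + t *: (p - node k)))) -mv /taylor.
      under eq_bigr do rewrite -coN -coD.
      by ring.
    apply: le_trans (ler_norm_sum _ _ _) _.
    apply: (@le_trans _ _ (\sum_(j : idx) h * om)); last first.
      by rewrite sumr_const -[leLHS]mulr_natl mulrA.
    apply: ler_sum => j _; rewrite normrM ler_pM//; apply: Hom.
    rewrite opprD addrA subrr sub0r normrN normrZ ger0_norm//.
    by apply: le_trans pn; rewrite ler_piMl.
  by rewrite (ger0_norm (cell_ge0 k p)) ler_wpM2r ?cell_ge0// Hom// distrC.
rewrite big_split /= -!mulr_sumr sum_cell// mulr1.
have := sum_abs_dcell p i HB; set S := \sum_k _ => HS.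
have : #|idx|%:R * h * om * S <= #|idx|%:R * h * om * (h^-1 * B).
  by rewrite ler_wpM2l// !mulr_ge0// ltW.
have -> : #|idx|%:R * h * om * (h^-1 * B) = om * (#|idx|%:R * B).
  by field; rewrite gt_eqF.
lra.
Qed.

End QuasiInterpolant.

(** Only first derivatives are compared, since they are all that the weak equation sees of a test
    function. *)
Theorem smooth_approx (O : set X) (f : X -> R) (e : R) : open O -> Ck 1 f ->
  (exists K, [/\ compact K, K `<=` O & forall x, ~ K x -> f x = 0]) -> 0 < e ->
  exists psi : X -> R, [/\ smooth psi,
    exists K, [/\ compact K, K `<=` O & forall x, ~ K x -> psi x = 0] &
    forall p i, `|'D_(ev i) psi p - 'D_(ev i) f p| <= e].
Proof.
move=> oO Cf [K [cK KO fK]] e0.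
have Dout i x : ~ K x -> 'D_(ev i) f x = 0 by move=> nK; exact: derive_out nK.
have [dl0 dl00 Hdl0] := compact_margin oO cK KO.
have [B0 [B0r HB0]] := compact_bounded cK.
pose b := `|B0| + 1.
have Kb x : K x -> `|x| <= b.
  by move=> Kx; apply: HB0 => //; rewrite /b (le_lt_trans (ler_norm _))// ltrDl.
have [B Bp HB] := @sum_abs_dhat R.
pose n : R := #|idx|%:R.
pose om := e / (1 + n * B).
have n1 : 0 < 1 + n * B by rewrite ltr_wpDr// mulr_ge0// ltW.
have om0 : 0 < om by rewrite divr_gt0.
have [dl dlp Hdl] : exists2 dl : R, 0 < dl & forall i x y, `|x - y| < dl ->
    `|'D_(ev i) f x - 'D_(ev i) f y| <= om.
  have H : \forall dl \near (0 : R)^'+, forall i x y, `|x - y| < dl ->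
    `|'D_(ev i) f x - 'D_(ev i) f y| <= om.
    apply: filter_forall => i; apply: (uniform_near _ cK) => //; last exact: Dout.
    by have [_ /(_ (ev i))] := Cf.
  have [dl [dl0' Hdl]] := filter_ex (filterI (nbhs_right_gt (0 : R)) H).
  by exists dl.
(* Here [dl] serves the continuity of the derivatives, and [dl0] keeps the balls of radius [h]
   around points of [K] inside [O]. *)
pose h := Num.min dl dl0 / 2.
have h0 : 0 < h by rewrite divr_gt0// lt_min dlp.
have hdl : h < dl by rewrite /h; have := ge_min dl dl dl0; rewrite lexx /= => hh; lra.
have hdl0 : h <= dl0.
  by rewrite /h; have := ge_min dl0 dl dl0; rewrite lexx orbT => hh; lra.
(* The box reaches past [K] by at least [h], so that a point outside it is further than [h] from
   every node in [K]; there the approximant and its derivatives vanish. *)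
pose N := (Num.truncn ((b + h) / h)).+1.
have HN : b + h <= h * N%:R.
  by rewrite mulrC -ler_pdivrMr// ltW// Num.Theory.truncnS_gt.
exists (quasi f h N); split.
- exact: quasi_smooth.
(* A node outside [K] has a zero Taylor polynomial, so the finitely many closed balls around the
   nodes in [K] contain the support. *)
- pose Q (k : {ffun idx -> 'I_(N.*2.+1)}) : set X :=
    if `[< K (node h k) >] then [set p | `|p - node h k| <= h] else set0.
  have cQ k : compact (Q k).
    rewrite /Q; case: asboolP => _; last exact: compact0.
    apply: (@Xsp_bounded_closed_compact _ _ _ _ (`|node h k| + h)).
      apply: (@closed_comp _ _ (fun v : X => `|v - node h k|) [set y : R | y <= h]) => [v _|];
        last exact: closed_le.
      apply: (@lipschitz_cts _ _ (fun v : X => `|v - node h k|) 1) => u w.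
      rewrite mul1r; apply: le_trans (ler_dist_dist _ _) _.
      by rewrite opprB addrA subrK.
    move=> x /= hx; rewrite -[x](subrK (node h k)) addrC.
    by apply: le_trans (ler_normD _ _) _; rewrite lerD2l.
  exists (\big[setU/set0]_k Q k); split.
  + by apply: bigsetU_compact => k _; exact: cQ.
  + apply: (big_ind (fun A : set X => A `<=` O)) => [x []|A A' hA hA' x [/hA|/hA']//|k _].
    rewrite /Q; case: asboolP => // Kn x /= hx; apply: (Hdl0 (node h k)) => //.
    by rewrite distrC (le_trans hx).
  + move=> x nx; rewrite /quasi big1// => k _.
    have nQ : ~ Q k x.
      by move=> Qk; apply: nx; rewrite (bigD1 k)//=; left.
    have [Kn|nKn] := pselect (K (node h k)).
      have far : ~ (forall i, `|co i (x - node h k)| <= h).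
        move=> hx; apply: nQ; rewrite /Q asboolT//=.
        by apply: norm_co => //; exact: ltW.
      by have [-> _] := cell_out h0 far; rewrite mulr0.
    rewrite /taylor fK// big1 ?addr0 ?mul0r// => i _.
    by rewrite Dout// mulr0.
- move=> p i.
  have Hom j x y : `|x - y| <= h -> `|'D_(ev j) f x - 'D_(ev j) f y| <= om.
    by move=> xy; apply: Hdl; exact: le_lt_trans hdl.
  have [bp|nbp] := pselect (inbox h N p).
    apply: le_trans (quasi_error h0 Cf i Bp (ltW om0) HB Hom bp) _.
    by rewrite /om divfK// gt_eqF.
  have [j hj] : exists j, b + h < `|co j p|.
    move: nbp => /existsNP[j /negP hj]; exists j; rewrite ltNge; apply: contra hj.
    rewrite ler_norml => /andP[h1 h2].
    have hN : 0 < h by [].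
    rewrite -(ler_pM2l h0) -[X in _ && X](ler_pM2l h0) mulr0 mulrDr mulrA divff ?gt_eqF// mul1r.
    by rewrite -addnn natrD; apply/andP; split; lra.
  have far (k : {ffun idx -> 'I_(N.*2.+1)}) : K (node h k) -> cell h k p = 0 /\ forall i0, dcell h i0 k p = 0.
    move=> Kn; apply: cell_out => // /(_ j); rewrite coD coN.
    have := le_trans (co_norm j _) (Kb _ Kn).
    have := ler_normB (co j p - co j (node h k)) (- co j (node h k)).
    rewrite opprK subrK normrN => h1 h2 h3; lra.
  rewrite (Dout i p); last first.
    by move=> /Kb hp; have := co_norm j p; lra.
  rewrite subr0 derive_quasi// big1 ?normr0 ?(ltW e0)// => k _.
  have [Kn|nKn] := pselect (K (node h k)).
    by have [-> ->] := far k Kn; rewrite !mulr0 addr0.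
  rewrite Dout// mul0r addr0 /taylor fK// big1 ?addr0 ?mul0r// => i' _.
  by rewrite Dout// mulr0.
Qed.

End SmoothApprox.

(** * Weak duality *)

Section Measurability.
Context dd (T : measurableType dd) {R : realType} {q d : nat}.
Local Notation M := 'M[R]_(q, d).
Implicit Types (W : M -> R) (r v : T -> M).

Lemma measurable_ereal_sup (F : nat -> T -> \bar R) :
  (forall n, measurable_fun setT (F n)) ->
  measurable_fun setT (fun x => ereal_sup (range (fun n => F n x))).
Proof.
move=> mF.
have -> : (fun x => ereal_sup (range (fun n => F n x))) = (fun x => esups (F ^~ x) 0).
  apply/funext => x; rewrite /esups /sdrop; congr ereal_sup.
  by apply/seteqP; split => [_ [n _ <-]|_ [n _ <-]]; exists n.
exact: measurable_fun_esups.
Qed.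

Lemma measurable_frob r v : (forall i j, measurable_fun setT (fun x => r x i j)) ->
  (forall i j, measurable_fun setT (fun x => v x i j)) ->
  measurable_fun setT (fun x => frob (r x) (v x)).
Proof.
move=> mr mv; apply: measurable_sum => i; apply: measurable_sum => j.
exact: measurable_funM.
Qed.

Lemma measurable_convex W v : convexM W -> (forall u : M, 0 <= W u) ->
  (forall i j, measurable_fun setT (fun x => v x i j)) ->
  measurable_fun setT (fun x => W (v x)).
Proof.
move=> cW W0 mv; have [r [c [rc Wsup]]] := convex_countable_sup cW W0.
apply/measurable_EFinP.
have -> : EFin \o (fun x => W (v x)) =
    (fun x => ereal_sup (range (fun n => (frob (r n) (v x) - c n)%:E))).
  apply/funext => x /=; apply/eqP; rewrite eq_le; apply/andP; split.
    apply/lee_addgt0Pr => e e0; have [n hn] := Wsup (v x) e e0.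
    apply: (@le_trans _ _ ((frob (r n) (v x) - c n)%:E + e%:E)%E).
      by rewrite -EFinD lee_fin; lra.
    by rewrite leeD2r//; apply: ereal_sup_ubound; exists n.
  apply: ge_ereal_sup => _ [n _ <-]; rewrite lee_fin.
  have := Fenchel_Young (r n) (v x) W0; rewrite rc lee_fin; lra.
apply: measurable_ereal_sup => n; apply/measurable_EFinP.
by apply: measurable_funB => //; apply: measurable_frob.
Qed.

(** Continuity of [W] allows the supremum to run over rational matrices only, which makes [Wstar] of
    a measurable field measurable. *)
Lemma Wstar_ratE W (r : M) : convexM W -> 
  Wstar W r = ereal_sup (range (fun n => (frob r (ratM n) - W (ratM n))%:E)).
Proof.
move=> cW; apply/eqP; rewrite eq_le; apply/andP; split; last first.
  by apply: ge_ereal_sup => _ [n _ <-]; apply: ereal_sup_ubound; exists (ratM n).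
apply: ge_ereal_sup => _ [v _ <-]; apply/lee_addgt0Pr => e e0.
have e2 : 0 < e / 2 by rewrite divr_gt0.
have [dl dl0 H] := @convex_continuous R q d W v cW _ e2.
pose S := \sum_i \sum_j `|r i j|.
have S1 : 0 < 1 + S.
  by rewrite ltr_wpDr// sumr_ge0// => i _; exact: sumr_ge0.
have dl'0 : 0 < Num.min dl (e / 2 / (1 + S)) by rewrite lt_min dl0 divr_gt0.
have [n hn] := ratM_dense v dl'0.
have h1 : `|W (ratM n) - W v| <= e / 2.
  have -> : ratM n = v + (ratM n - v) :> M by rewrite addrCA subrr addr0.
  apply: H => i j; rewrite !mxE distrC; apply: le_trans (hn i j) _.
  by rewrite ge_min lexx.
have h2 : `|frob r (v - ratM n)| <= e / 2.
  rewrite frobC; apply: le_trans (le_abs_frob r (c := e / 2 / (1 + S)) _) _.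
    by move=> i j; rewrite !mxE (le_trans (hn i j))// ge_min lexx orbT.
  by rewrite -/S mulrAC ler_pdivrMr// ler_wpM2l ?(ltW e2)// lerDr.
apply: (@le_trans _ _ ((frob r (ratM n) - W (ratM n))%:E + e%:E)%E).
  rewrite -EFinD lee_fin; move: h1 h2; rewrite frobBr !ler_norml.
  by move=> /andP[? ?] /andP[? ?]; lra.
by rewrite leeD2r//; apply: ereal_sup_ubound; exists n.
Qed.

Lemma measurable_Wstar W r : convexM W ->
  (forall i j, measurable_fun setT (fun x => r x i j)) ->
  measurable_fun setT (fun x => Wstar W (r x)).
Proof.
move=> cW mr; under eq_fun do rewrite Wstar_ratE//.
apply: measurable_ereal_sup => n; apply/measurable_EFinP.
by apply: measurable_funB => //; apply: measurable_frob.
Qed.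

Lemma measurable_Wrec W r : convexM W -> (forall u : M, 0 <= W u) ->
  (forall i j, measurable_fun setT (fun x => r x i j)) ->
  measurable_fun setT (fun x => Wrec W (r x)).
Proof.
move=> cW W0 mr; have [s [c [sc Wsup]]] := convex_countable_sup cW W0.
under eq_fun do rewrite (Wrec_supE sc Wsup).
apply: measurable_ereal_sup => n; apply/measurable_EFinP.
by apply: measurable_frob.
Qed.

Lemma Wrec_ge0 W (v : M) : (forall u : M, 0 <= W u) -> convexM W -> (0 <= Wrec W v)%E.
Proof.
move=> W0 cW; have [s [c [sc Wsup]]] := convex_countable_sup cW W0.
have := frob_le_Wrec sc Wsup v (s := 0); rewrite frob0l; apply.
by apply: le_lt_trans (Wstar0_le0 W0) _; rewrite ltry.
Qed.

(** The larger function may have an infinite integral, so positive and negative parts are compared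
    separately. *)
Lemma le_integral_below (mu : {measure set T -> \bar R}) (G f : T -> \bar R) :
  mu.-integrable setT G -> measurable_fun setT f -> (forall x, G x <= f x)%E ->
  (\int[mu]_x G x <= \int[mu]_x f x)%E.
Proof.
move=> IG mf Gf; have mG := measurable_int _ IG.
rewrite integralE [leRHS]integralE; apply: leeB; apply: ge0_le_integral => //.
- exact: measurable_funepos.
- exact: measurable_funepos.
- by move=> x _; apply: funepos_le; rewrite ?inE.
- exact: measurable_funeneg.
- exact: measurable_funeneg.
- by move=> x _; apply: funeneg_le; rewrite ?inE.
Qed.

End Measurability.

Section Supports.
Context {R : realType} {V : normedModType R}.

Lemma compact_support_inP (W : normedModType R) (O : set V) (f : V -> W) :
  compact_support_in O f <->
  exists K, [/\ compact K, K `<=` O & forall x, ~ K x -> f x = 0].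
Proof.
split=> [[cS SO]|[K [cK KO fK]]].
  exists (fsupport f); split => // x nS; apply: contrapT => /eqP fx.
  by apply: nS; apply: subset_closure.
have SK : fsupport f `<=` K.
  have clK : closed K by apply: compact_closed => //; exact: norm_hausdorff.
  apply: (subset_trans _ clK); apply: closure_subset => x /= /eqP fx.
  by apply: contrapT => /fK.
split; last exact: subset_trans KO.
by apply: subclosed_compact cK SK; exact: closed_closure.
Qed.

End Supports.

Section Components.
Context {R : realType} {d q : nat}.
Local Notation X := (@Xsp R d q).
Implicit Types (phi : X -> 'rV[R]_d).

Lemma derive_component phi p w j : differentiable phi p ->
  ('D_w phi p) 0 j = 'D_w (fun p => phi p 0 j) p.
Proof.
by move=> dphi; rewrite derive_mx ?mxE//; exact: diff_derivable.
Qed.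

Lemma C1_component phi j : Ck 1 phi -> Ck 1 (fun p => phi p 0 j).
Proof.
move=> [df Df]; have dc p : differentiable (fun p => phi p 0 j) p.
  apply: (@differentiable_comp _ _ _ _ phi (fun v : 'rV[R]_d => v 0 j)) => //.
  exact: differentiable_coord.
split => // w; have -> : (fun p => 'D_w (fun p => phi p 0 j) p) =
    (fun p => ('D_w phi p) 0 j) by apply/funext => p; rewrite derive_component.
move=> p; apply: (@continuous_comp _ _ _ ('D_w phi) (fun v : 'rV[R]_d => v 0 j)).
  exact: Df.
exact: coord_continuous.
Qed.

Lemma divxE phi p : Ck 1 phi ->
  divx phi p = \sum_j 'D_(ev (inl j)) (fun p => phi p 0 j) p.
Proof.
by move=> [df _]; apply: eq_bigr => j _; rewrite -derive_component.
Qed.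

Lemma gradyE phi p i j : Ck 1 phi ->
  grady phi p i j = 'D_(ev (inr i)) (fun p => phi p 0 j) p.
Proof. by move=> [df _]; rewrite mxE -derive_component. Qed.

End Components.

(** * The continuity equation for C^1 test functions *)

Section WeakCont.
Context {R : realType} {d q : nat}.
Local Notation X := (@Xsp R d q).
Local Notation BX := (@BorelX R d q).
Local Open Scope ereal_scope.

Lemma cc_bmeas (O : set X) (g : X -> R) : cc O g -> bmeas (g : BX -> R).
Proof.
move=> cg; split; first by apply: continuous_borel; exact: cg.1.
by have [B _ HB] := cc_bounded cg; exists B.
Qed.

Definition rint (m : {finite_measure set BX -> \bar R}) (f : BX -> R) : R :=
  fine (\int[m]_p (f p)%:E).

Lemma rintE m f : bmeas f -> (rint m f)%:E = \int[m]_p (f p)%:E.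
Proof.
move=> bf; rewrite /rint fineK//; apply: integrable_fin_num => //; exact: bmeas_integrable.
Qed.

Lemma bmeas_sum (I : Type) (s : seq I) (F : I -> BX -> R) : (forall i, bmeas (F i)) ->
  bmeas (fun x => \sum_(i <- s) F i x)%R.
Proof.
move=> HF; split; first by apply: measurable_sum => i; exact: (HF i).1.
have [B HB] := choice (fun i => (HF i).2).
exists (\sum_(i <- s) B i)%R => x; apply: le_trans (ler_norm_sum _ _ _) _.
by apply: ler_sum => i _; exact: HB.
Qed.

Section TestFunctions.
Variable Om : set 'rV[R]_d.
Local Notation O := (@cyl R d q Om).

Lemma compact_support_component (g : X -> 'rV[R]_d) j : compact_support_in O g ->
  exists K, [/\ compact K, K `<=` O & forall x, ~ K x -> g x 0%R j = 0%R].
Proof.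
by move=> /compact_support_inP[K [cK KO gK]]; exists K; split => // x /gK ->; rewrite mxE.
Qed.

Lemma cc_derive_component (g : X -> 'rV[R]_d) j w : Ck 1 g -> compact_support_in O g ->
  cc O (fun x => 'D_w (fun p => g p 0%R j) x).
Proof.
move=> /(C1_component j)[_ Dg] /(compact_support_component j)[K [cK KO gK]].
by split; [exact: Dg|exists K; split => // x nK; exact: derive_out nK].
Qed.

Lemma cc_grady (g : X -> 'rV[R]_d) i j : Ck 1 g -> compact_support_in O g ->
  cc O (fun p => grady g p i j).
Proof.
move=> Cg Sg; under eq_fun do rewrite gradyE//; exact: cc_derive_component.
Qed.

Lemma bmeas_grady (g : X -> 'rV[R]_d) i j : Ck 1 g -> compact_support_in O g ->
  bmeas (fun p : BX => grady g p i j).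
Proof. by move=> Cg Sg; apply: (@cc_bmeas O); exact: cc_grady. Qed.

Lemma bmeas_divx (g : X -> 'rV[R]_d) : Ck 1 g -> compact_support_in O g ->
  bmeas (divx g : BX -> R).
Proof.
move=> Cg Sg; rewrite (_ : divx g = fun p => \sum_j 'D_(ev (inl j)) (fun p => g p 0%R j) p)%R.
  by apply: bmeas_sum => j; apply: (@cc_bmeas O); exact: cc_derive_component.
by apply/funext => p; rewrite divxE.
Qed.

End TestFunctions.

Lemma open_cyl (Om : set 'rV[R]_d) : open Om -> open (@cyl R d q Om).
Proof.
move=> oOm; rewrite (_ : cyl Om = (@fst 'rV[R]_d 'rV[R]_q) @^-1` Om).
  by apply: open_comp => // x _; exact: cvg_fst.
by apply/seteqP; split => [x []|x].
Qed.

Lemma integral_close (m : {finite_measure set BX -> \bar R}) (f g : BX -> R) (e : R) :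
  bmeas f -> bmeas g -> (forall x, `|f x - g x| <= e)%R ->
  (`|fine (\int[m]_x (f x)%:E) - fine (\int[m]_x (g x)%:E)| <= e * fine (m setT))%R.
Proof.
move=> bf bg fg.
have If := bmeas_integrable m bf; have Ig := bmeas_integrable m bg.
have e0 : (0 <= e)%R by apply: le_trans (fg point); exact: normr_ge0.
rewrite -fineB ?integrable_fin_num// -integralB//.
under eq_integral do rewrite -EFinB.
have Ifg : m.-integrable setT (fun x => (f x - g x)%:E).
  by under eq_fun do rewrite EFinB; exact: integrableB.
have finfg : \int[m]_x (f x - g x)%:E \is a fin_num by exact: integrable_fin_num.
rewrite -lee_fin -abse_EFin fineK//.
apply: le_trans (le_abse_integral _ measurableT (measurable_int _ Ifg)) _.
rewrite EFinM fineK ?fin_num_measure//.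
rewrite -integral_cst//; apply: ge0_le_integral => //.
  by apply: measurableT_comp => //; exact: measurable_int Ifg.
by move=> x _; rewrite abse_EFin lee_fin.
Qed.

Lemma charge_int_jordan (J : {charge set BX -> \bar R}) :
  exists P N : {finite_measure set BX -> \bar R}, forall f,
    charge_int J f = \int[P]_x (f x)%:E - \int[N]_x (f x)%:E.
Proof. by eexists; eexists => f; rewrite /charge_int. Qed.

(** The left-hand side is a functional of the first derivatives of the test function, bounded in sup
    norm by the constant [C] built from total masses. Each component is approximated with accuracy
    [e / (1 + C)]. *)
Lemma cont_eq_C1 (Om : set 'rV[R]_d) (mu : {measure set BX -> \bar R})
  (J : 'I_q -> 'I_d -> {charge set BX -> \bar R}) :
  open Om -> mu setT < +oo -> cont_eq Om mu J ->
  forall phi : X -> 'rV[R]_d, Ck 1 phi -> compact_support_in (cyl Om) phi ->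
  \int[mu]_p (divx phi p)%:E
    + \sum_i \sum_j charge_int (J i j) (fun p => grady phi p i j) = 0.
Proof.
move=> oOm muoo HJ phi Cphi Sphi.
have oO := open_cyl oOm.
have bdiv := @bmeas_divx Om; have bgrad := @bmeas_grady Om.
have [P HP] := choice (fun p : 'I_q * 'I_d => charge_int_jordan (J p.1 p.2)).
have [N HN] := choice HP.
pose muf : {finite_measure set BX -> \bar R} := finitized muoo.
pose T g := (rint muf (divx g) + \sum_i \sum_j
   (rint (P (i, j)) (fun p => grady g p i j) - rint (N (i, j)) (fun p => grady g p i j)))%R.
have TE (g : X -> 'rV[R]_d) : Ck 1 g -> compact_support_in (cyl Om) g ->
  \int[mu]_p (divx g p)%:E + \sum_i \sum_j charge_int (J i j) (fun p => grady g p i j)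
    = (T g)%:E.
  move=> Cg Sg; rewrite /T EFinD rintE; last exact: bdiv.
  congr (_ + _); rewrite -sumEFin; apply: eq_bigr => i _; rewrite -sumEFin.
  apply: eq_bigr => j _; rewrite (HN (i, j)) EFinB !rintE//; exact: bgrad.
rewrite TE//; congr EFin; apply/eqP; rewrite -normr_eq0 eq_le normr_ge0 andbT.
pose C : R := (d%:R * fine (muf setT) +
  \sum_i \sum_j (fine (P (i, j) setT) + fine (N (i, j) setT)))%R.
have fm0 (m : {finite_measure set BX -> \bar R}) : (0 <= fine (m setT))%R.
  by apply: fine_ge0; exact: measure_ge0.
have C0 : (0 <= C)%R.
  apply: addr_ge0; first exact: mulr_ge0 (ler0n _ _) (fm0 _).
  by apply: sumr_ge0 => i _; apply: sumr_ge0 => j _; exact: addr_ge0 (fm0 _) (fm0 _).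
apply/ler_addgt0Pr => e e0; rewrite add0r.
pose e' : R := (e / (1 + C))%R.
have C1 : (0 < 1 + C)%R by rewrite ltr_wpDr.
have e'0 : (0 < e')%R by rewrite divr_gt0.
have /choice[psi Hpsi] : forall j, exists psi : X -> R, [/\ smooth psi,
    exists K, [/\ compact K, K `<=` cyl Om & forall x, ~ K x -> psi x = 0%R] &
    forall p i, (`|'D_(ev i) psi p - 'D_(ev i) (fun p => phi p 0%R j) p| <= e')%R].
  by move=> j; apply: smooth_approx => //; [exact: C1_component|exact: compact_support_component].
pose Psi (p : X) : 'rV[R]_d := (\sum_j psi j p *: delta_mx 0 j)%R.
have PsiE p j : Psi p 0%R j = psi j p.
  rewrite /Psi summxE (bigD1 j)//= !mxE !eqxx mulr1 big1 ?addr0// => k kj.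
  by rewrite !mxE eqxx /= eq_sym (negbTE kj) mulr0.
have sPsi : smooth Psi.
  by move=> n; apply: Ck_sum => j; apply: Ck_scalel; have [h _ _] := Hpsi j; exact: h.
have SPsi : compact_support_in (cyl Om) Psi.
  apply/compact_support_inP.
  have /choice[K HK] : forall j, exists K, [/\ compact K, K `<=` cyl Om &
     forall x, ~ K x -> psi j x = 0%R] by move=> j; have [] := Hpsi j.
  exists (\big[setU/set0]_j K j); split.
  - by apply: bigsetU_compact => j _; have [] := HK j.
  - apply: (big_ind (fun A : set X => A `<=` cyl Om)) => [x []|A A' hA hA' x [/hA|/hA']//|j _].
    by have [] := HK j.
  - move=> x nK; apply/rowP => j; rewrite PsiE mxE; have [_ _ h] := HK j; apply: h => Kj.
    by apply: nK; rewrite (bigD1 j)//=; left.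
have CPsi := sPsi 1%N.
have TPsi : T Psi = 0%R by have := HJ Psi sPsi SPsi; rewrite (TE _ CPsi SPsi) => -[].
have close j i p : (`|'D_(ev i) (fun p => phi p 0%R j) p - 'D_(ev i) (fun p => Psi p 0%R j) p| <= e')%R.
  have -> : (fun p => Psi p 0%R j) = psi j by apply/funext.
  by rewrite distrC; have [_ _] := Hpsi j.
rewrite -[T phi]subr0 -TPsi.
have -> : e = ((1 + C) * e')%R by rewrite /e' mulrC divfK// gt_eqF.
apply: (@le_trans _ _ (C * e')%R); last by rewrite ler_wpM2r ?(ltW e'0)// lerDr.
rewrite /T opprD addrACA -sumrB; apply: le_trans (ler_normD _ _) _.
rewrite /C mulrDl; apply: lerD.
  have -> : (d%:R * fine (muf setT) * e' = (d%:R * e') * fine (muf setT))%R by rewrite mulrAC.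
  apply: integral_close; [exact: bdiv|exact: bdiv|move=> x].
  rewrite !divxE// -sumrB; apply: le_trans (ler_norm_sum _ _ _) _.
  apply: (@le_trans _ _ (\sum_(j < d) e')%R); first by apply: ler_sum.
  by rewrite sumr_const card_ord mulr_natl.
rewrite mulr_suml; apply: le_trans (ler_norm_sum _ _ _) _; apply: ler_sum => i _.
rewrite -sumrB mulr_suml; apply: le_trans (ler_norm_sum _ _ _) _; apply: ler_sum => j _.
have cP (m : {finite_measure set BX -> \bar R}) :
    (`|rint m (fun p => grady phi p i j) - rint m (fun p => grady Psi p i j)| <= e' * fine (m setT))%R.
  by apply: integral_close; [exact: bgrad|exact: bgrad|move=> x; rewrite !gradyE].
move: (cP (P (i, j))) (cP (N (i, j))).
move: (rint (P (i, j)) _) (rint (P (i, j)) _) (rint (N (i, j)) _) (rint (N (i, j)) _) => b a g c h1 h2.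
have -> : (a - c - (b - g) = (a - b) - (c - g))%R by ring.
by apply: le_trans (ler_normB _ _) _; rewrite mulrDl !(mulrC _ e'); exact: lerD.
Qed.

End WeakCont.

Section WeakDuality.
Context {R : realType} {d q : nat}.
Local Notation X := (@Xsp R d q).
Local Notation BX := (@BorelX R d q).
Local Open Scope ereal_scope.

(** Off a null set of the finite measure the entries are bounded by the Frobenius norm 1. *)
Lemma theta_integrable (sg : {measure set BX -> \bar R}) (th : BX -> 'M[R]_(q, d)) i j :
  sg setT < +oo -> (forall i j, measurable_fun setT (fun p => th p i j)) ->
  (exists N0 : set BX, [/\ measurable N0, sg N0 = 0 &
          forall p, ~ N0 p -> frobnorm (th p) = 1%R]) ->
  sg.-integrable setT (fun p => (th p i j)%:E).
Proof.
move=> sgoo mth [N0 [mN0 sN0 hN0]].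
have mt : measurable_fun setT (fun p => (th p i j)%:E) by exact/measurable_EFinP.
apply/(negligible_integrable mN0 measurableT mt sN0).
apply: measurable_bounded_integrable.
- exact: measurableD.
- apply: le_lt_trans sgoo; apply: le_measure; rewrite ?inE//; exact: measurableD.
- exact: measurable_funTS.
exists 1%R; split; first by rewrite num_real.
move=> M M1 p /= [_ nN]; apply: le_trans (ltW M1).
by rewrite -(hN0 _ nN); exact: abs_coord_frobnorm.
Qed.

Lemma integral_frob (m : {measure set BX -> \bar R}) (r v : BX -> 'M[R]_(q, d)) :
  m setT < +oo ->
  (forall i j, bmeas (fun p => r p i j)) ->
  (forall i j, m.-integrable setT (fun p => (v p i j)%:E)) ->
  [/\ forall i j, m.-integrable setT (fun p => (r p i j * v p i j)%:E),
    m.-integrable setT (fun p => (frob (r p) (v p))%:E) &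
    \int[m]_p (frob (r p) (v p))%:E = \sum_i \sum_j \int[m]_p (r p i j * v p i j)%:E].
Proof.
move=> moo br Iv.
have Irv i j : m.-integrable setT (fun p => (r p i j * v p i j)%:E).
  have [mr [B HB]] := br i j.
  have mv : measurable_fun setT (fun p => v p i j).
    by apply/measurable_EFinP; exact: measurable_int (Iv i j).
  apply: le_integrable (integrableZl measurableT `|B|%R (Iv i j)) => //.
    by apply/measurable_EFinP; exact: measurable_funM.
  move=> x _; rewrite -!EFinM !abse_EFin lee_fin !normrM ler_wpM2r// normr_id.
  exact: le_trans (HB x) (ler_norm _).
have Ir i : m.-integrable setT (fun p => \sum_j (r p i j * v p i j)%:E) by exact: integrable_sum.
have fE : (fun p => (frob (r p) (v p))%:E) = fun p => \sum_i \sum_j (r p i j * v p i j)%:E.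
  by apply/funext => p; rewrite -sumEFin; apply: eq_bigr => i _; rewrite sumEFin.
split => //; first by rewrite fE; exact: integrable_sum.
by rewrite fE integral_sum//; apply: eq_bigr => i _; rewrite integral_sum.
Qed.

(** Two pointwise inequalities are integrated: Fenchel-Young against [mu], and [frob_le_Wrec]
    against the singular part, where no conjugate term appears. The continuity equation replaces the
    divergence by the pairing with [J]. *)
Lemma weak_duality (Om : set 'rV[R]_d) (W : 'M[R]_(q, d) -> R)
  (mu : {measure set BX -> \bar R}) : open Om -> mu setT < +oo ->
  convexM W -> (forall v, (0 <= W v)%R) ->
  dual_value Om W mu <= TEul Om W mu.
Proof.
move=> oOm muoo cW W0; apply: ge_ereal_sup => _ [phi [Cphi Sphi fW] <-].
apply: le_ereal_inf_tmp => _ [J [_ HJ] <-].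
apply: le_ereal_inf_tmp => _ [v [sg [th [[Hv sgoo HN0 _ HA] ->]]]].
have Iv i j : mu.-integrable setT (fun p => (v p i j)%:E) by have [] := Hv i j.
have mth i j : measurable_fun setT (fun p => th p i j) by have [] := Hv i j.
have mv i j : measurable_fun setT (fun p => v p i j) by have [] := Hv i j.
have Ith i j := theta_integrable i j sgoo mth HN0.
have br i j := bmeas_grady i j Cphi Sphi.
have bd := bmeas_divx Cphi Sphi.
have mr i j : measurable_fun setT (fun p : BX => grady phi p i j) by exact: (br i j).1.
have [s [c [sc Wsup]]] := convex_countable_sup cW W0.
(* Admissibility speaks of the cylinder only; elsewhere the gradient is 0 and [Wstar W 0 <= 0]. *)
have WgradE p : Wstar W (grady phi p) < +oo.
  have [Op|nOp] := pselect (cyl Om p); first exact: fW.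
  suff -> : grady phi p = 0%R by rewrite (le_lt_trans (Wstar0_le0 W0))// ltry.
  apply/matrixP => i j; rewrite [RHS]mxE.
  exact: (cc_out (cc_grady i j Cphi Sphi) nOp).
have CE := cont_eq_C1 oOm muoo HJ Cphi Sphi.
have [I1 Ifr1 E1] := integral_frob muoo br Iv.
have [I2 Ifr2 E2] := integral_frob sgoo br Ith.
have fin1 i j := integrable_fin_num measurableT (I1 i j).
have fin2 i j := integrable_fin_num measurableT (I2 i j).
have Idiv : mu.-integrable setT (fun p => (divx phi p)%:E).
  exact: bmeas_integrable_lty muoo bd.
have CE' : \int[mu]_p (divx phi p)%:E + (\int[mu]_p (frob (grady phi p) (v p))%:E +
    \int[sg]_p (frob (grady phi p) (th p))%:E) = 0.
  rewrite -{}CE; congr (_ + _); rewrite E1 E2 -big_split; apply: eq_bigr => i _.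
  rewrite -big_split; apply: eq_bigr => j _ /=.
  by rewrite (@charge_int_RN _ _ _ (J i j) mu sg (fun p => v p i j) (fun p => th p i j) _
    muoo sgoo (br i j) (Iv i j) (Ith i j) (fun S mS => HA S mS i j)).
have mWv : measurable_fun setT (fun p => (W (v p))%:E).
  by apply/measurable_EFinP; exact: measurable_convex.
have Wv0 : 0 <= \int[mu]_p (W (v p))%:E by apply: integral_ge0 => p _; rewrite lee_fin.
have Wth0 : 0 <= \int[sg]_p Wrec W (th p) by apply: integral_ge0 => p _; exact: Wrec_ge0.
have Bth : \int[sg]_p (frob (grady phi p) (th p))%:E <= \int[sg]_p Wrec W (th p).
  apply: le_integral_below => //; first exact: measurable_Wrec.
  by move=> p; exact: (frob_le_Wrec sc Wsup).
(* The term [W (v p)] is subtracted below, so it must be integrable. If its integral is infinite, so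
   is the cost, as the singular term is nonnegative. *)
have [Woo|] := ltP (\int[mu]_p (W (v p))%:E) +oo; last first.
  rewrite leye_eq => /eqP ->; rewrite addye ?leey//.
  by rewrite gt_eqF// (lt_le_trans _ Wth0)// ltNyr.
have IWv : mu.-integrable setT (fun p => (W (v p))%:E).
  apply/integrableP; split => //; under eq_integral do rewrite abse_EFin ger0_norm//.
  exact: Woo.
have IG : mu.-integrable setT (fun p => (divx phi p)%:E +
     ((frob (grady phi p) (v p))%:E - (W (v p))%:E)).
  by apply: integrableD => //; exact: integrableB.
have le1 : \int[mu]_p ((divx phi p)%:E + ((frob (grady phi p) (v p))%:E - (W (v p))%:E)) <=
   \int[mu]_p ((divx phi p)%:E + Wstar W (grady phi p)).
  apply: le_integral_below => //.
    apply: emeasurable_funD; last exact: measurable_Wstar.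
    by apply/measurable_EFinP; exact: bd.1.
  by move=> p; rewrite leeD2l// -EFinB; exact: Fenchel_Young.
rewrite leeNl; apply: le_trans le1.
rewrite integralD//; last exact: integrableB.
rewrite integralB//.
have f1 := integrable_fin_num measurableT Idiv.
have f2 := integrable_fin_num measurableT Ifr1.
have f3 := integrable_fin_num measurableT Ifr2.
have f4 := integrable_fin_num measurableT IWv.
move: CE' Bth Wth0; rewrite -(fineK f1) -(fineK f2) -(fineK f3) -(fineK f4).
move: (\int[sg]_p Wrec W (th p)) => B.
case: B => [b| |]//; last by rewrite addey// leNye.
rewrite -!EFinD => -[h]; rewrite !lee_fin => h1 _.
lra.
Qed.

End WeakDuality.

(** * Strong duality *)

Section SignedRiesz.
Context {R : realType} {T : ptopologicalType}.
Variables (O : set T) (l : (T -> R) -> R) (C : R).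
Hypotheses (C0 : 0 <= C) (HO : open O).
Hypothesis Hex : forall U : set T, open U -> exists h : nat -> T -> R, exhaustion U h.
Hypothesis l_lin : forall a f g, cc O f -> cc O g -> l (fun x => a * f x + g x) = a * l f + l g.
Hypothesis l_bnd : forall f B, cc O f -> (forall x, `|f x| <= B) -> l f <= C * B.

Let lD f g : cc O f -> cc O g -> l (fun x => f x + g x) = l f + l g.
Proof.
move=> cf cg; rewrite -[l f]mul1r -l_lin//; congr l; apply/funext => x; by rewrite mul1r.
Qed.

Let l0 : l (fun=> 0) = 0.
Proof.
have := lD (cc0 O) (cc0 O); under eq_fun do rewrite addr0.
by move=> h; lra.
Qed.

Let lZ a f : cc O f -> l (fun x => a * f x) = a * l f.
Proof.
move=> cf; rewrite -[RHS]addr0 -l0 -l_lin//; last exact: cc0.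
by congr l; apply/funext => x; rewrite addr0.
Qed.

Let lB f g : cc O f -> cc O g -> l (fun x => f x - g x) = l f - l g.
Proof.
move=> cf cg; rewrite -mulN1r -lZ// -lD//; last exact: ccZ.
by congr l; apply/funext => x; rewrite mulN1r.
Qed.

(* [pos] is the positive part of [l]; both [pos] and [pos - l] are positive functionals. *)
Let pset f := [set l g | g in [set g | pcc O g /\ forall x, g x <= f x]].
Let pos f := sup (pset f).

Let pset_ub f B : (forall x, f x <= B) -> ubound (pset f) (C * B).
Proof.
move=> fB _ [g [pg gf] <-]; apply: l_bnd pg.1 _ => x.
by rewrite ger0_norm ?pg.2// (le_trans (gf x)).
Qed.

Let has_sup_pset f : pcc O f -> has_sup (pset f).
Proof.
move=> pf; split.
  by exists (l (fun=> 0)), (fun=> 0) => //; split; [exact: pcc0|exact: pf.2].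
have [B B0 fB] := cc_bounded pf.1.
by exists (C * B); apply: pset_ub => x; rewrite (le_trans (ler_norm _)).
Qed.

Let le_pos f g : pcc O f -> pcc O g -> (forall x, g x <= f x) -> l g <= pos f.
Proof. by move=> pf pg gf; apply: ub_le_sup; [exact: (has_sup_pset pf).2|exists g]. Qed.

Let pos_le f c : pcc O f -> (forall g, pcc O g -> (forall x, g x <= f x) -> l g <= c) ->
  pos f <= c.
Proof.
move=> pf h; apply: ge_sup; first exact: (has_sup_pset pf).1.
by move=> _ [g [pg gf] <-]; exact: h.
Qed.

(** The Riesz decomposition property: a function [g] below [f1 + f2] is the sum of the minimum of
    [g] and [f1] and of a remainder below [f2]. *)
Let posD f1 f2 : pcc O f1 -> pcc O f2 -> pos (fun x => f1 x + f2 x) = pos f1 + pos f2.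
Proof.
move=> p1 p2; apply/eqP; rewrite eq_le; apply/andP; split.
  apply: pos_le; first exact: pccD.
  move=> g pg gf; pose g1 x := Num.min (g x) (f1 x).
  have cg1 : cc O g1 by apply: cc_minr pg.1; [exact: p1.1.1|exact: p1.2].
  have pg1 : pcc O g1 by split => // x; rewrite le_min pg.2 p1.2.
  have pg2 : pcc O (fun x => g x - g1 x).
    by split; [apply: ccB => //; exact: pg.1|move=> x; rewrite subr_ge0 ge_min lexx].
  have -> : l g = l g1 + l (fun x => g x - g1 x).
    by rewrite -lD//; [congr l; apply/funext => x; rewrite addrC subrK|exact: pg2.1].
  apply: lerD; first by apply: le_pos => // x; rewrite ge_min lexx orbT.
  apply: le_pos => // x; move: (gf x) (p1.2 x) (p2.2 x).
  by rewrite /g1 minElt; case: ltP; lra.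
rewrite -lerBrDr; apply: pos_le => // g1 pg1 g1f.
rewrite lerBrDr -lerBrDl; apply: pos_le => // g2 pg2 g2f.
rewrite lerBrDl -lD; [|exact: pg1.1|exact: pg2.1].
by apply: le_pos; [exact: pccD|exact: pccD|move=> x; exact: lerD].
Qed.

Let posZ a f : 0 <= a -> pcc O f -> pos (fun x => a * f x) = a * pos f.
Proof.
have scale b g : 0 < b -> pcc O g -> b * pos g <= pos (fun x => b * g x).
  move=> b0 pg; rewrite mulrC -ler_pdivlMr//; apply: pos_le => // h ph hg.
  rewrite ler_pdivlMr// mulrC -lZ; last exact: ph.1.
  apply: le_pos; [exact/pccZ/pg/ltW|exact/pccZ/ph/ltW|].
  by move=> x; rewrite ler_pM2l.
rewrite le_eqVlt => /orP[/eqP <- pf|a0 pf].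
  rewrite mul0r; under eq_fun do rewrite mul0r.
  apply/eqP; rewrite eq_le; apply/andP; split.
    apply: pos_le; first exact: pcc0.
    move=> g pg g0; rewrite (_ : g = fun=> 0) ?l0//.
    by apply/funext => x; apply/eqP; rewrite eq_le g0 pg.2.
  by rewrite -[leLHS]l0; apply: le_pos; try exact: pcc0.
apply/eqP; rewrite eq_le scale// andbT.
have := scale a^-1 _ _ (pccZ (ltW a0) pf); rewrite invr_gt0 => /(_ a0).
under [fun x => a^-1 * _]eq_fun do rewrite mulKf ?gt_eqF//.
by rewrite mulrC ler_pdivrMr// mulrC.
Qed.

Lemma signed_riesz : exists A B : {measure set (g_sigma_algebraType (@open T)) -> \bar R},
  [/\ (A setT < +oo /\ B setT < +oo)%E,
      (forall S : set T, S `<=` ~` O -> A S = 0 /\ B S = 0)%E &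
      forall f, cc O f -> (l f)%:E = (\int[A]_x (f x)%:E - \int[B]_x (f x)%:E)%E].
Proof.
have le_self f : pcc O f -> l f <= pos f by move=> pf; exact: le_pos.
have absB f B : pcc O f -> (forall x, f x <= B) -> forall x, `|f x| <= B.
  by move=> pf fB x; rewrite ger0_norm ?pf.2.
have posP : pos_functional O pos.
  split => //.
    by move=> f pf; rewrite -l0; apply: le_pos => //; [exact: pcc0|exact: pf.2].
  exists C => // f B pf fB; apply: pos_le => // g pg gf; apply: l_bnd pg.1 _.
  by apply: absB => // x; exact: le_trans (fB x).
have negP : pos_functional O (fun f => pos f - l f).
  split.
  - by move=> f pf; rewrite subr_ge0 le_self.
  - by move=> f g pf pg; rewrite posD// lD; [lra|exact: pf.1|exact: pg.1].
  - by move=> a f a0 pf; rewrite posZ// lZ; [lra|exact: pf.1].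
  exists (C + C); first exact: addr_ge0.
  move=> f B pf fB; rewrite mulrDl; apply: lerD.
    apply: pos_le => // g pg gf; apply: l_bnd pg.1 _.
    by apply: absB => // x; exact: le_trans (fB x).
  rewrite -mulN1r -lZ; last exact: pf.1.
  apply: l_bnd; first exact/ccZ/pf.1.
  by move=> x; rewrite mulN1r normrN; exact: absB.
have [A [Aoo AO AE]] := riesz_representation posP Hex HO.
have [B [Boo BO BE]] := riesz_representation negP Hex HO.
exists A, B; split => // [S SO|f cf]; first by rewrite AO// BO.
pose fp x := Num.max (f x) 0; pose fn x := Num.max (- f x) 0.
have pfp : pcc O fp.
  by split; [exact: cc_max cf (cc0 O)|move=> x; rewrite le_max lexx orbT].
have pfn : pcc O fn.
  split; last by move=> x; rewrite le_max lexx orbT.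
  by apply: cc_max (cc0 O); under eq_fun do rewrite -mulN1r; exact: ccZ.
have fE : f = fun x => fp x - fn x.
  by apply/funext => x; rewrite /fp /fn !maxElt; do 2 case: ltP => ? //; lra.
have int (m : {measure set (g_sigma_algebraType (@open T)) -> \bar R}) g : (m setT < +oo)%E ->
    cc O g -> m.-integrable setT (fun x => (g x)%:E).
  move=> moo cg; apply: bmeas_integrable_lty moo _; split; first exact: continuous_borel cg.1.
  by have [K _ gK] := cc_bounded cg; exists K.
have intE (m : {measure set (g_sigma_algebraType (@open T)) -> \bar R}) : (m setT < +oo)%E ->
    (\int[m]_x (f x)%:E = \int[m]_x (fp x)%:E - \int[m]_x (fn x)%:E)%E.
  move=> moo; rewrite {1}fE; under eq_integral do rewrite EFinB.
  by rewrite integralB//; apply: int => //; [exact: pfp.1|exact: pfn.1].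
rewrite !intE// !AE// !BE// {1}fE lB; [|exact: pfp.1|exact: pfn.1].
by rewrite -!EFinB; congr EFin; lra.
Qed.

End SignedRiesz.

Section SingularNull.
Context {R : realType} {d q : nat}.
Local Notation BX := (@BorelX R d q).
Local Open Scope ereal_scope.

(** On [E] the charges with densities [th] vanish, so [th] is 0 almost everywhere there, while its
    norm is 1. This confines the singular part to the cylinder. *)
Lemma RN_decomp_singular_null (mu : {measure set BX -> \bar R})
  (J : 'I_q -> 'I_d -> {charge set BX -> \bar R}) v sg th (E : set BX) :
  RN_decomp mu J v sg th -> measurable E -> mu E = 0 ->
  (forall i j S, measurable S -> S `<=` E -> J i j S = 0) -> sg E = 0.
Proof.
move=> [Hv sgoo HN0 _ HA] mE muE HE.
have mth i j : measurable_fun setT (fun p => th p i j) by have [] := Hv i j.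
have mv i j : measurable_fun setT (fun p => v p i j) by have [] := Hv i j.
have Ith i j := theta_integrable i j sgoo mth HN0.
have h i j : ae_eq sg E (fun p => (th p i j)%:E) (cst 0).
  apply: integral_ae_eq => //; first exact: integrableS (Ith i j).
  move=> S SE mS; rewrite integral0; have := HA S mS i j; rewrite HE//.
  rewrite (@null_set_integral _ _ _ mu) ?add0e//.
    by apply/measurable_EFinP; exact: measurable_funTS.
  apply/eqP; rewrite eq_le measure_ge0 andbT -muE.
  by apply: le_measure; rewrite ?inE.
have [N0 [mN0 sN0 hN0]] := HN0.
have hE : \forall p \ae sg, ~ E p.
  have : \forall p \ae sg, ~ N0 p /\ forall i j, E p -> (th p i j)%:E = 0.
    apply: filterI; first by exists N0; split => // p /= /contrapT.
    apply: (@filter_forall _ _ (fun i (p : BX) => forall j, E p -> (th p i j)%:E = 0) (almost_everywhere sg)) => i.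
    by apply: (@filter_forall _ _ (fun j (p : BX) => E p -> (th p i j)%:E = 0) (almost_everywhere sg)) => j; exact: h.
  apply: filterS => p [np hp] Ep; have := hN0 p np.
  have -> : th p = 0%R by apply/matrixP => i j; rewrite mxE; apply/EFin_inj/hp.
  rewrite /frobnorm /frob big1 ?sqrtr0 => [/esym/eqP|i _]; first by rewrite oner_eq0.
  by rewrite big1// => j _; rewrite mxE mul0r.
case: hE => A [mA sA EA]; apply/eqP; rewrite eq_le measure_ge0 andbT -sA.
apply: le_measure; rewrite ?inE//; move=> p Ep; apply: EA => /=; exact.
Qed.
End SingularNull.

(** * Cutoffs approximating Borel sets in mean *)

Section Cutoffs.
Context {R : realType} {d q : nat}.
Local Notation X := (@Xsp R d q).
Local Notation BX := (@BorelX R d q).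
Local Notation M := 'M[R]_(q, d).
Local Notation bmeas := (@bmeas _ BX R).

Definition sum_norm (a : M) : R := \sum_i \sum_j `|a i j|.

Lemma sum_norm_ge0 a : 0 <= sum_norm a.
Proof. by apply: sumr_ge0 => i _; exact: sumr_ge0. Qed.

Lemma sum_normD a b : sum_norm (a + b) <= sum_norm a + sum_norm b.
Proof.
rewrite -big_split; apply: ler_sum => i _; rewrite -big_split; apply: ler_sum => j _ /=.
by rewrite mxE ler_normD.
Qed.

Lemma sum_normZ t a : sum_norm (t *: a) = `|t| * sum_norm a.
Proof.
rewrite mulr_sumr; apply: eq_bigr => i _; rewrite mulr_sumr; apply: eq_bigr => j _.
by rewrite mxE normrM.
Qed.

Lemma coord_le_sum_norm (a : M) i j : `|a i j| <= sum_norm a.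
Proof.
rewrite /sum_norm (bigD1 i)//= (bigD1 j)//= -addrA lerDl addr_ge0//.
  by apply: sumr_ge0.
by apply: sumr_ge0 => k _; exact: sumr_ge0.
Qed.

Lemma frob_le_sum_norm a b : `|frob a b| <= sum_norm a * sum_norm b.
Proof.
rewrite mulr_suml; apply: le_trans (ler_norm_sum _ _ _) _; apply: ler_sum => i _.
rewrite mulr_suml; apply: le_trans (ler_norm_sum _ _ _) _; apply: ler_sum => j _.
by rewrite normrM ler_wpM2l// coord_le_sum_norm.
Qed.

Lemma Wstar_leP (W : M -> R) r c :
  (Wstar W r <= c%:E)%E <-> forall v, frob r v - W v <= c.
Proof.
split => [h v|h]; last by apply: ge_ereal_sup => _ [v _ <-]; rewrite lee_fin.
by rewrite -lee_fin; apply: le_trans h; apply: ereal_sup_ubound; exists v.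
Qed.

Lemma Wstar_le_convex (W : M -> R) x y a b t : 0 <= t <= 1 ->
  (Wstar W x <= a%:E)%E -> (Wstar W y <= b%:E)%E ->
  (Wstar W ((1 - t) *: x + t *: y) <= ((1 - t) * a + t * b)%:E)%E.
Proof.
move=> /andP[t0 t1] /Wstar_leP ha /Wstar_leP hb; apply/Wstar_leP => v.
rewrite frobDl !frobZl.
have -> : (1 - t) * frob x v + t * frob y v - W v =
  (1 - t) * (frob x v - W v) + t * (frob y v - W v) by ring.
by apply: lerD; rewrite ler_wpM2l// subr_ge0.
Qed.

Lemma bmeasD (f g : BX -> R) : bmeas f -> bmeas g -> bmeas (fun p => f p + g p).
Proof.
move=> [mf [A fA]] [mg [B gB]]; split; first exact: measurable_funD.
by exists (A + B) => x; rewrite (le_trans (ler_normD _ _))// lerD.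
Qed.

Lemma bmeasM (f g : BX -> R) : bmeas f -> bmeas g -> bmeas (fun p => f p * g p).
Proof.
move=> [mf [A fA]] [mg [B gB]]; split; first exact: measurable_funM.
by exists (A * B) => x; rewrite normrM ler_pM.
Qed.

Lemma bmeas_cst c : bmeas (fun=> c).
Proof. by split; [exact: measurable_cst|exists `|c|]. Qed.

Lemma bmeasB (f g : BX -> R) : bmeas f -> bmeas g -> bmeas (fun p => f p - g p).
Proof.
move=> bf bg; under eq_fun do rewrite -mulN1r.
by apply: bmeasD => //; apply: bmeasM => //; exact: bmeas_cst.
Qed.

Lemma bmeas_norm (f : BX -> R) : bmeas f -> bmeas (fun p => `|f p|).
Proof.
move=> [mf [A fA]]; split; first exact: measurableT_comp.
by exists A => x; rewrite normr_id.
Qed.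

Lemma bmeas_indic (A : set BX) : measurable A -> bmeas (\1_A : BX -> R).
Proof.
move=> mA; split; first exact: measurable_indic.
by exists 1 => x; rewrite indicE ger0_norm// lern1 leq_b1.
Qed.

Lemma bmeas_sum_norm (f : BX -> M) : (forall i j, bmeas (fun p => f p i j)) ->
  bmeas (fun p => sum_norm (f p)).
Proof.
by move=> bf; apply: bmeas_sum => i; apply: bmeas_sum => j; exact: bmeas_norm.
Qed.

Lemma rintD m f g : bmeas f -> bmeas g -> rint m (fun p => f p + g p) = rint m f + rint m g.
Proof.
move=> bf bg; apply: EFin_inj; rewrite EFinD !rintE//; last exact: bmeasD.
under eq_integral do rewrite EFinD.
by rewrite integralD//; exact: bmeas_integrable.
Qed.

Lemma rintZ m a f : bmeas f -> rint m (fun p => a * f p) = a * rint m f.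
Proof.
move=> bf; have ba := bmeasM (bmeas_cst a) bf; apply: EFin_inj; rewrite EFinM !rintE//.
under eq_integral do rewrite EFinM.
by rewrite integralZl//; exact: bmeas_integrable.
Qed.

Lemma rint_le m f g : bmeas f -> bmeas g -> (forall p, f p <= g p) -> rint m f <= rint m g.
Proof.
move=> bf bg fg; rewrite -lee_fin !rintE//.
apply: le_integral => //; try exact: bmeas_integrable.
by move=> p _; rewrite lee_fin.
Qed.

Section Cutoff.
Variables (O : set X) (ka : {finite_measure set BX -> \bar R}).
Hypotheses (HO : open O) (kaO : ka (~` (O : set BX)) = 0%E).

Let mO : measurable (O : set BX). Proof. exact: open_borel. Qed.

Let cut (A : set BX) := measurable A /\ forall e : R, 0 < e -> exists al : X -> R,
  [/\ cc O al, forall p, 0 <= al p <= 1 & rint ka (fun p => `|al p - \1_A p|) <= e].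

Let bmeas_diff al (A : set BX) : cc O al -> measurable A ->
  bmeas (fun p : BX => `|al p - \1_A p|).
Proof.
move=> ca mA; apply: bmeas_norm; apply: bmeasB; first exact: cc_bmeas ca.
exact: bmeas_indic.
Qed.

Let rint_cvg (g : nat -> X -> R) (A : set BX) e : 0 < e -> measurable A ->
  (forall n, bmeas (g n : BX -> R)) -> (forall n p, 0 <= g n p <= 1) ->
  (forall p, O p -> g ^~ p @ \oo --> (\1_A p : R)) ->
  exists n, rint ka (fun p => `|g n p - \1_A p|) <= e.
Proof.
move=> e0 mA bg g01 gA.
have [|||||_ + _] := @dominated_convergence _ BX R ka setT measurableT
  (fun n p => (g n p)%:E) (fun p => (\1_A p : R)%:E) (cst 1%E).
- by move=> n; apply/measurable_EFinP; exact: (bg n).1.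
- by apply/measurable_EFinP; exact: measurable_indic.
- exists (~` O : set BX); split => //; first exact: measurableC.
  move=> p /= + /gA h; apply => _; apply: cvg_EFin h; exact: nearW.
- exact: finite_measure_integrable_cst.
- apply: aeW => p n _; rewrite lee_fin ger0_norm; by case/andP: (g01 n p).
move=> /fine_cvg /cvgr_lt /(_ e e0)[n _ /(_ n (leqnn n))] Hn; exists n; exact: ltW.
Qed.

(** The exhaustion is that of [U] intersected with [O], which keeps supports in [O]; nothing is lost
    since [ka] does not charge the complement. *)
Let cut_open (U : set X) : open U -> cut (U : set BX).
Proof.
move=> oU; have mU : measurable (U : set BX) by exact: open_borel.
split => // e e0.
have [h [hc h01 hS h0 h1]] := open_exhaustion (openI oU HO).
have cch n : cc O (h n).
  by have [hn [K [cK KU hK]]] := hc n; split => //; exists K; split => // x /KU[].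
have [||| |n Hn] := @rint_cvg h (U : set BX) e e0 => //.
- by move=> n; exact: cc_bmeas (cch n).
- move=> p Op; rewrite indicE; case: (boolP (p \in (U : set BX))) => [/set_mem Up|].
    by apply: h1; split.
  move=> /negP; rewrite inE => nU.
  have -> : h ^~ p = fun=> 0; last exact: cvg_cst.
  apply/funext => n; have [_ [K [_ KU hK]]] := hc n.
  by apply: hK => /KU[].
by exists (h n).
Qed.

Let indic01 (A : set BX) p : (0 <= (\1_A p : R) <= 1).
Proof. by rewrite indicE ler0n lern1 leq_b1. Qed.

(** As [1 - al] need not have compact support in [O], it is multiplied by a cutoff [be] of the whole
    space. *)
Let cutC (A : set BX) : cut A -> cut (~` A).
Proof.
move=> [mA cA]; split => [|e e0]; first exact: measurableC.
have e20 : 0 < e / 2 by rewrite divr_gt0.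
have [al [ca al01 ale]] := cA _ e20.
have [_ /(_ _ e20)[be [cb be01 bee]]] := cut_open openT.
have cba : cc O (fun x => be x * (1 - al x)).
  apply: cc_mulr cb => x; apply: cvgB; [exact: cvg_cst|exact: ca.1].
exists (fun x => be x * (1 - al x)); split => //.
  move=> p; have /andP[a0 a1] := al01 p; have /andP[b0 b1] := be01 p.
  rewrite mulr_ge0 ?subr_ge0//= mulr_ile1// ?subr_ge0//; lra.
apply: (@le_trans _ _ (rint ka (fun p => `|be p - \1_setT p| + `|al p - \1_A p|))).
  apply: rint_le; first by apply: bmeas_diff => //; exact: measurableC.
    by apply: bmeasD; exact: bmeas_diff.
  move=> p; have /andP[a0 a1] := al01 p; have /andP[b0 b1] := be01 p.
  have -> : \1_(~` A) p = 1 - \1_A p :> R.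
    by rewrite !indicE in_setC; case: (p \in A); rewrite /= ?subrr ?subr0.
  rewrite indicT.
  have -> : be p * (1 - al p) - (1 - \1_A p) = (be p - 1) * (1 - al p) - (al p - \1_A p) by ring.
  apply: le_trans (ler_normB _ _) _; rewrite lerD2r normrM ler_piMr//.
  by rewrite ger0_norm; lra.
rewrite rintD; [|exact: bmeas_diff|exact: bmeas_diff].
by rewrite [leRHS]splitr lerD.
Qed.

Let cutU (A B : set BX) : cut A -> cut B -> cut (A `|` B).
Proof.
move=> [mA cA] [mB cB]; split => [|e e0]; first exact: measurableU.
have e20 : 0 < e / 2 by rewrite divr_gt0.
have [al [ca al01 ale]] := cA _ e20.
have [be [cb be01 bee]] := cB _ e20.
exists (fun x => Num.max (al x) (be x)); split; first exact: cc_max.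
  move=> p; have /andP[a0 a1] := al01 p; have /andP[b0 b1] := be01 p.
  by rewrite le_max a0 ge_max a1 b1.
apply: (@le_trans _ _ (rint ka (fun p => `|al p - \1_A p| + `|be p - \1_B p|))).
  apply: rint_le.
  - by apply: bmeas_diff; [exact: cc_max|exact: measurableU].
  - by apply: bmeasD; exact: bmeas_diff.
  move=> p; have /andP[a0 a1] := al01 p; have /andP[b0 b1] := be01 p.
  have := ler_norm (al p - \1_A p); have := ler_norm (- (al p - \1_A p)); rewrite normrN.
  have := ler_norm (be p - \1_B p); have := ler_norm (- (be p - \1_B p)); rewrite normrN.
  rewrite ler_norml maxEle !indicE in_setU.
  by case: (leP (al p) (be p)) => ?; case: (p \in A); case: (p \in B) => /= *; apply/andP; split; lra.
rewrite rintD; [|exact: bmeas_diff|exact: bmeas_diff].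
by rewrite [leRHS]splitr lerD.
Qed.

(** Dominated convergence replaces the countable union by a finite one. *)
Let cut_bigcup (A : nat -> set BX) : (forall n, cut (A n)) -> cut (\bigcup_n A n).
Proof.
move=> cA; have mU : measurable (\bigcup_n A n) by apply: bigcupT_measurable => n; have [] := cA n.
split => // e e0; have e20 : 0 < e / 2 by rewrite divr_gt0.
pose B n := \big[setU/set0]_(k < n) A k.
have cB n : cut (B n).
  elim: n => [|n IH]; first by rewrite /B big_ord0; exact: (cut_open open0).
  by rewrite /B big_ord_recr; exact: cutU.
have mB n : measurable (B n) by have [] := cB n.
have [|||n Hn] := @rint_cvg (fun n => \1_(B n)) (\bigcup_n A n) (e / 2) e20 mU.
- by move=> n; exact: bmeas_indic.
- by move=> n p; exact: indic01.
- move=> p _; have [[k _ Ak]|nA] := pselect ((\bigcup_n A n) p).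
    apply: cvg_near_cst; exists k.+1 => // n /= kn.
    rewrite !indicE !mem_set//; first by exists k.
    by rewrite /B -bigcup_mkord; exists k.
  apply: cvg_near_cst; apply: nearW => n.
  rewrite !indicE !memNset// /B -bigcup_mkord => -[k _ Ak]; apply: nA; by exists k.
have [_ /(_ _ e20)[al [ca al01 ale]]] := cB n.
exists al; split => //.
apply: (@le_trans _ _ (rint ka (fun p => `|al p - \1_(B n) p| + `|\1_(B n) p - \1_(\bigcup_n A n) p|))).
  apply: rint_le; [exact: bmeas_diff| |by move=> p; exact: ler_distD].
  apply: bmeasD; first exact: bmeas_diff.
  by apply/bmeas_norm/bmeasB; exact: bmeas_indic.
rewrite rintD; [by rewrite [leRHS]splitr lerD|exact: bmeas_diff|].
by apply/bmeas_norm/bmeasB; exact: bmeas_indic.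
Qed.

(* The sets with this property form a sigma-algebra containing the open sets;
   no regularity of [ka] is invoked. *)
Lemma cutoff (A : set BX) e : measurable A -> 0 < e -> exists al : X -> R,
  [/\ cc O al, forall p, 0 <= al p <= 1 & rint ka (fun p => `|al p - \1_A p|) <= e].
Proof.
move=> mA; have [_] : cut A; last by apply.
have : (@measurable _ BX `<=` cut)%classic.
  apply: smallest_sub => [|U oU]; last exact: cut_open.
  split => [|S cS|F cF]; [exact: (cut_open open0)|by rewrite setTD; exact: cutC|].
  exact: cut_bigcup.
exact.
Qed.

End Cutoff.
End Cutoffs.

(** * Fields switching between finitely many slopes *)

Section Greedy.
Context {R : realType} {d q : nat}.
Local Notation X := (@Xsp R d q).
Local Notation BX := (@BorelX R d q).
Local Notation M := 'M[R]_(q, d).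
Local Notation bmeas := (@bmeas _ BX R).
Variables (O : set X) (la : {finite_measure set BX -> \bar R}).
Hypotheses (HO : open O) (laO : la (~` (O : set BX)) = 0%E).
Variables (x : BX -> M) (e : BX -> R) (W : M -> R) (S : R).
Hypothesis Ix : forall i j, la.-integrable setT (fun p => (x p i j)%:E).
Hypotheses (me : measurable_fun setT e) (e01 : forall p, 0 <= e p <= 1).

(** In the application [x] is the density of the flux and [e] is 1 on the regular part and 0 on the
    singular one, where the majorant [w] is not charged. *)
Definition pairing (r : BX -> M) (w : BX -> R) p := frob (r p) (x p) - e p * w p.

Hypothesis HS : forall (rho : BX -> M) w, (forall i j, cc O (fun p => rho p i j)) ->
  bmeas w -> (forall p, (Wstar W (rho p) <= (w p)%:E)%E) ->
  (\int[la]_p (pairing rho w p)%:E <= S%:E)%E.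

Let mO : measurable (O : set BX). Proof. exact: open_borel. Qed.

Let be : bmeas e.
Proof. by split => //; exists 1 => p; have /andP[? ?] := e01 p; rewrite ger0_norm. Qed.

Let laoo : (la setT < +oo)%E.
Proof. by rewrite -ge0_fin_numE// fin_num_measure. Qed.

Let u p := 1 + sum_norm (x p).

Let u0 p : 0 <= u p. Proof. by rewrite addr_ge0// sum_norm_ge0. Qed.

Let Iu : la.-integrable setT (fun p => (u p)%:E).
Proof.
rewrite /u; under eq_fun do rewrite EFinD.
apply: integrableD => //; first exact: finite_measure_integrable_cst.
rewrite /sum_norm; under eq_fun do rewrite -sumEFin.
apply: integrable_sum => // i _; under eq_fun do rewrite -sumEFin.
apply: integrable_sum => // j _; exact: (integrable_abse (Ix i j)).
Qed.

Let mu : measurable_fun setT u.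
Proof. by apply/measurable_EFinP; exact: measurable_int Iu. Qed.

Let Ipairing (r : BX -> M) w : (forall i j, bmeas (fun p => r p i j)) -> bmeas w ->
  la.-integrable setT (fun p => (pairing r w p)%:E).
Proof.
move=> br bw; rewrite /pairing; under eq_fun do rewrite EFinB.
apply: integrableB => //; last by apply: bmeas_integrable; exact: bmeasM.
by have [] := integral_frob laoo br Ix.
Qed.

Section Weight.
Variable ka : {finite_measure set BX -> \bar R}.
Hypothesis kaE : forall A, measurable A -> ka A = (\int[la]_(p in A) (u p)%:E)%E.

Let kaO : ka (~` (O : set BX)) = 0%E.
Proof.
rewrite kaE; last exact: measurableC.
by apply: null_set_integral => //; [exact: measurableC|apply/measurable_EFinP; exact: measurable_funTS].
Qed.

Let dist (r rho : BX -> M) (w om : BX -> R) p : R := sum_norm (r p - rho p) + `|w p - om p|.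

Let bmeas_dist (r rho : BX -> M) w om : (forall i j, bmeas (fun p => r p i j)) ->
  (forall i j, bmeas (fun p => rho p i j)) -> bmeas w -> bmeas om -> bmeas (dist r rho w om).
Proof.
move=> br brho bw bom; apply: bmeasD; last by apply/bmeas_norm/bmeasB.
by apply: bmeas_sum_norm => i j; under eq_fun do rewrite mxE [X in _ + X]mxE; exact: bmeasB.
Qed.

(* The L1 distance is taken for the weighted measure [ka] because [x] is only
   integrable, not bounded. *)
Definition approximable (r : BX -> M) (w : BX -> R) :=
  [/\ forall i j, bmeas (fun p => r p i j), bmeas w &
    forall eps : R, 0 < eps -> exists (rho : BX -> M) om, [/\ forall i j, cc O (fun p => rho p i j), bmeas om,
      forall p, (Wstar W (rho p) <= (om p)%:E)%E & rint ka (dist r rho w om) <= eps]].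

(** The two integrands differ by at most [dist * u], and [u] is the density of [ka], so closeness in
    mean for [ka] carries the bound [S] over. *)
Lemma approximable_pairing r w : approximable r w ->
  (\int[la]_p (pairing r w p)%:E <= S%:E)%E.
Proof.
move=> [br bw H]; apply/lee_addgt0Pr => eps e0.
have [rho [om [crho bom Wrho Hd]]] := H _ e0.
have brho i j : bmeas (fun p => rho p i j) by exact: cc_bmeas (crho i j).
have bd := bmeas_dist br brho bw bom.
have d0 p : 0 <= dist r rho w om p by rewrite addr_ge0// sum_norm_ge0.
have Id : la.-integrable setT (fun p => (dist r rho w om p * u p)%:E).
  have [B HB] := bd.2.
  apply: le_integrable (integrableZl measurableT B Iu) => //.
    by apply/measurable_EFinP/measurable_funM => //; exact: bd.1.
  move=> p _; rewrite -EFinM !abse_EFin lee_fin !normrM ler_wpM2r//.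
  by apply: le_trans (HB p) (ler_norm _).
apply: (@le_trans _ _ (\int[la]_p ((pairing rho om p)%:E + (dist r rho w om p * u p)%:E))%E).
  apply: le_integral => //; [exact: Ipairing|by apply: integrableD => //; exact: Ipairing|].
  move=> p _; rewrite -EFinD lee_fin /pairing /dist /u.
  have /andP[ep0 ep1] := e01 p.
  have h1 : frob (r p) (x p) - frob (rho p) (x p) <= sum_norm (r p - rho p) * sum_norm (x p).
    by rewrite ![frob _ (x p)]frobC -frobBr frobC; apply: le_trans (frob_le_sum_norm _ _); exact: ler_norm.
  have h2 : e p * (om p - w p) <= `|w p - om p|.
    apply: le_trans (ler_norm _) _; rewrite normrM distrC ler_piMl// ger0_norm//.
  have := mulr_ge0 (normr_ge0 (w p - om p)) (sum_norm_ge0 (x p)).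
  have := sum_norm_ge0 (r p - rho p); lra.
rewrite integralD//; last exact: Ipairing.
apply: leeD; first exact: HS.
move: Hd; rewrite -lee_fin rintE//.
by rewrite (ge0_integral_density mu kaE)//; apply/measurable_EFinP; exact: bd.1.
Qed.

(** Replacing the indicator of [A] by a cutoff turns the switch into a pointwise convex combination,
    which [Wstar_le_convex] keeps admissible. *)
Lemma approximable_switch r w s c (A : set BX) : measurable A ->
  (Wstar W s <= c%:E)%E -> approximable r w ->
  approximable (fun p => (1 - \1_A p) *: r p + \1_A p *: s)
               (fun p => (1 - \1_A p) * w p + \1_A p * c).
Proof.
move=> mA Ws [br bw H].
have b1A := bmeas_indic mA.
have bcA (f : BX -> R) k : bmeas f -> bmeas (fun p => (1 - \1_A p) * f p + \1_A p * k).
  move=> bf; apply: bmeasD; first by apply: bmeasM => //; apply: bmeasB => //; exact: bmeas_cst.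
  by apply: bmeasM => //; exact: bmeas_cst.
have br' i j : bmeas (fun p => ((1 - \1_A p) *: r p + \1_A p *: s) i j).
  by under eq_fun do rewrite !mxE; exact: bcA.
split => //; first exact: bcA.
move=> eps e0; have e20 : 0 < eps / 2 by rewrite divr_gt0.
have [rho [om [crho bom Wrho Hd]]] := H _ e20.
have brho i j : bmeas (fun p => rho p i j) by exact: cc_bmeas (crho i j).
have bdist := bmeas_dist brho (fun i j => bmeas_cst (s i j)) bom (bmeas_cst c).
(* The cutoff error gets multiplied by the distance from [(rho, om)] to [(s, c)], which [B] bounds;
   hence the accuracy [eps / 2 / (|B| + 1)]. *)
have [B HB] := bdist.2.
have B0 : 0 < `|B| + 1 by rewrite ltr_wpDl.
have [al [ca al01 Ha]] := cutoff HO kaO mA (divr_gt0 e20 B0).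
have ba : bmeas al by exact: cc_bmeas ca.
exists (fun p => (1 - al p) *: rho p + al p *: s), (fun p => (1 - al p) * om p + al p * c).
have cr i j : cc O (fun p => ((1 - al p) *: rho p + al p *: s) i j).
  under eq_fun do rewrite !mxE mulrC [X in _ + X]mulrC.
  apply: ccD; last exact: ccZ.
  apply: cc_mulr (crho i j) => p; apply: cvgB; [exact: cvg_cst|exact: ca.1].
have bo : bmeas (fun p => (1 - al p) * om p + al p * c).
  apply: bmeasD; first by apply: bmeasM => //; apply: bmeasB => //; exact: bmeas_cst.
  by apply: bmeasM => //; exact: bmeas_cst.
split => //.
  by move=> p; exact: Wstar_le_convex.
have bD := bmeas_dist br brho bw bom.
have bal : bmeas (fun p => `|al p - \1_A p|) by apply/bmeas_norm/bmeasB.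
have bBal := bmeasM (bmeas_cst (`|B| + 1)) bal.
apply: (@le_trans _ _ (rint ka (fun p => dist r rho w om p + (`|B| + 1) * `|al p - \1_A p|))).
  apply: rint_le; [|exact: bmeasD|].
    exact: bmeas_dist br' (fun i j => cc_bmeas (cr i j)) (bcA _ _ bw) bo.
  move=> p; rewrite /dist.
  have a01 : 0 <= 1 - (\1_A p : R) <= 1 by rewrite indicE; case: (p \in A) => /=; rewrite ?subrr ?subr0 lexx ler01.
  have /andP[A0 A1] := a01.
  have -> : (1 - \1_A p) *: r p + \1_A p *: s - ((1 - al p) *: rho p + al p *: s) =
     (1 - \1_A p) *: (r p - rho p) + (al p - \1_A p) *: (rho p - s).
    by apply/matrixP => i j; rewrite !mxE; ring.
  have -> : (1 - \1_A p) * w p + \1_A p * c - ((1 - al p) * om p + al p * c) =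
     (1 - \1_A p) * (w p - om p) + (al p - \1_A p) * (om p - c) by ring.
  apply: le_trans (lerD (sum_normD _ _) (ler_normD _ _)) _.
  rewrite !sum_normZ !normrM (ger0_norm A0) addrACA -!mulrDr.
  apply: lerD.
    by rewrite ler_piMl// addr_ge0// sum_norm_ge0.
  rewrite mulrC ler_wpM2r//.
  apply: le_trans (ler_norm _) _; apply: le_trans (HB p) _.
  by apply: le_trans (ler_norm _) _; rewrite lerDl.
rewrite rintD// rintZ// [leRHS]splitr lerD// mulrC -ler_pdivlMr//.
Qed.

End Weight.

(* [greedy n] is the integrand obtained by choosing, at each point, the best of
   the first [n] affine minorants. *)
Fixpoint greedy (s : nat -> M) (c : nat -> R) (c0 : R) n p : R :=
  if n is n'.+1 then Num.max (greedy s c c0 n' p) (frob (s n') (x p) - e p * c n')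
  else - (e p * c0).

(** Each greedy integrand is the [pairing] of an approximable field: one more slope is a switch on
    the measurable set where it strictly improves the value. *)
Lemma greedy_le s c c0 : (Wstar W 0 <= c0%:E)%E -> (forall n, (Wstar W (s n) <= (c n)%:E)%E) ->
  forall n, (\int[la]_p (greedy s c c0 n p)%:E <= S%:E)%E.
Proof.
move=> W0 Ws n.
have [ka kaE] := density_measure u0 Iu.
suff [r [w [/approximable_pairing Hle E]]] : exists r w,
    approximable ka r w /\ forall p, pairing r w p = greedy s c c0 n p.
  by under eq_integral do rewrite -E; exact: Hle.
elim: n => [|n [r [w [Arw E]]]].
  exists (fun=> 0), (fun=> c0); split; last by move=> p; rewrite /pairing frob0l sub0r.
  split; [by move=> i j; exact: bmeas_cst|exact: bmeas_cst|].
  move=> eps e0; exists (fun=> 0), (fun=> c0); split => //.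
  - by move=> i j; under eq_fun do rewrite mxE; exact: cc0.
  - exact: bmeas_cst.
  rewrite (_ : (fun p => _) = cst 0) ?/rint ?integral0 ?ltW//.
  by apply/funext => p; rewrite !subrr normr0 addr0 -(scale0r (0 : M)) sum_normZ normr0 mul0r.
have mG : measurable_fun setT (greedy s c c0 n).
  have [br bw _] := Arw; apply/measurable_EFinP; apply: eq_measurable_fun (measurable_int _ (Ipairing br bw)).
  by move=> p _; rewrite E.
have ms : measurable_fun setT (fun p => frob (s n) (x p) - e p * c n).
  apply/measurable_EFinP.
  exact: measurable_int (Ipairing (fun i j => bmeas_cst (s n i j)) (bmeas_cst (c n))).
pose A : set BX := [set p | greedy s c c0 n p < frob (s n) (x p) - e p * c n].
have mA : measurable A.
  by have := measurable_fun_ltr mG ms measurableT (Y := [set true]) I; rewrite setTI.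
exists (fun p => (1 - \1_A p) *: r p + \1_A p *: s n), (fun p => (1 - \1_A p) * w p + \1_A p * c n).
split; first exact: approximable_switch.
move=> p; rewrite /= maxElt -(E p) /pairing frobDl !frobZl indicE /A.
case: ifPn => h.
  by rewrite mem_set//=; [ring|rewrite /= -E].
rewrite memNset//=; first by ring.
by rewrite -E; exact/negP.
Qed.
End Greedy.

(** * Exchanging supremum and integral for both parts of the flux *)

Section Rockafellar.
Context {R : realType} {d q : nat}.
Local Notation X := (@Xsp R d q).
Local Notation BX := (@BorelX R d q).
Local Notation M := 'M[R]_(q, d).
Local Notation bmeas := (@bmeas _ BX R).
Local Open Scope ereal_scope.

(* Restricted to two singular measures, an integrand on X acts like a pair of
   independent integrands, which is why one measure [mu + sg] suffices. *)
Lemma singular_glue (mu sg : {measure set BX -> \bar R}) (N : set BX) :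
  measurable N -> mu N = 0 -> sg (~` N) = 0 ->
  forall f g : BX -> \bar R, measurable_fun setT f -> measurable_fun setT g ->
  let h p := if p \in N then g p else f p in
  [/\ measurable_fun setT h, \int[mu]_p h p = \int[mu]_p f p, \int[sg]_p h p = \int[sg]_p g p,
      mu.-integrable setT f -> mu.-integrable setT h & sg.-integrable setT g -> sg.-integrable setT h].
Proof.
move=> mN muN sgN f g mf mg h.
have mh : measurable_fun setT h.
  have mb : measurable_fun setT (fun p => p \in N).
    by apply: (measurable_fun_bool true); rewrite setTI (_ : _ @^-1` _ = N)//; apply/seteqP; split => p /= Hp; [exact: set_mem|exact: mem_set].
  exact: measurable_fun_ifT.
have hf : ae_eq mu setT h f.
  exists N; split => // p /= /not_implyP[_].
  by rewrite /h; case: (boolP (p \in N)) => // /set_mem.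
have hg : ae_eq sg setT h g.
  exists (~` N); split => //; first exact: measurableC.
  by move=> p /= /not_implyP[_]; rewrite /h; case: (boolP (p \in N)) => // /negP; rewrite inE.
have aei (m : {measure set BX -> \bar R}) k : measurable_fun setT k -> ae_eq m setT h k ->
    m.-integrable setT k -> m.-integrable setT h.
  move=> mk hk /integrableP[_ Ik]; apply/integrableP; split => //.
  rewrite (@ae_eq_integral _ _ _ m _ (abse \o k))//; try exact: measurableT_comp.
  by apply: filterS hk => p hp _ /=; rewrite hp.
by split => //; [exact: ae_eq_integral|exact: ae_eq_integral|exact: aei|exact: aei].
Qed.

(** With [x] equal to [th] on [N] and to [v] elsewhere, the hypothesis becomes a bound on [pairing]
    for the single measure [la]. The greedy integrands then increase to a function above both
    integrands. *)
Lemma rockafellar (O : set X) (W : M -> R) (S : R) (mu sg : {measure set BX -> \bar R})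
  (v th : BX -> M) (N : set BX) : open O -> convexM W -> (forall u, (0 <= W u)%R) ->
  mu setT < +oo -> sg setT < +oo -> mu (~` (O : set BX)) = 0 -> sg (~` (O : set BX)) = 0 ->
  (forall i j, mu.-integrable setT (fun p => (v p i j)%:E)) ->
  (forall i j, sg.-integrable setT (fun p => (th p i j)%:E)) ->
  measurable N -> mu N = 0 -> sg (~` N) = 0 ->
  (forall (rho : BX -> M) w, (forall i j, cc O (fun p => rho p i j)) -> bmeas w ->
     (forall p, Wstar W (rho p) <= (w p)%:E) ->
     \int[mu]_p (frob (rho p) (v p) - w p)%:E + \int[sg]_p (frob (rho p) (th p))%:E <= S%:E) ->
  \int[mu]_p (W (v p))%:E + \int[sg]_p Wrec W (th p) <= S%:E.
Proof.
move=> HO cW W0 muoo sgoo muO sgO Iv Ith mN muN sgN HS.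
have mv i j : measurable_fun setT (fun p => v p i j).
  by apply/measurable_EFinP; exact: measurable_int (Iv i j).
have mth i j : measurable_fun setT (fun p => th p i j).
  by apply/measurable_EFinP; exact: measurable_int (Ith i j).
have [|la Hla] := @finite_measure_of _ BX R (measure_add mu sg).
  by apply: (@le_lt_trans _ _ (mu setT + sg setT)); rewrite ?lte_add_pinfty// -measure_addE.
have laE f : measurable_fun setT f -> (forall p, 0 <= f p) ->
    \int[la]_p f p = \int[mu]_p f p + \int[sg]_p f p.
  move=> mf f0; rewrite -ge0_integral_measure_add//.
  by apply: eq_measure_integral => A mA _; exact: Hla.
have laI f : mu.-integrable setT f -> sg.-integrable setT f ->
    \int[la]_p f p = \int[mu]_p f p + \int[sg]_p f p.
  move=> If If'; have mf := measurable_int mu If; rewrite -integral_measure_add//.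
  by apply: eq_measure_integral => A mA _; exact: Hla.
have laint f : mu.-integrable setT f -> sg.-integrable setT f -> la.-integrable setT f.
  move=> /integrableP[mf If] /integrableP[_ If']; apply/integrableP; split => //.
  by rewrite laE//; [exact: lte_add_pinfty|exact: measurableT_comp].
have glue := singular_glue mN muN sgN.
pose x p : M := if p \in N then th p else v p.
pose e : BX -> R := \1_(~` N).
have xE i j : (fun p => (x p i j)%:E) = fun p => if p \in N then (th p i j)%:E else (v p i j)%:E.
  by apply/funext => p; rewrite /x; case: ifP.
have Ix i j : la.-integrable setT (fun p => (x p i j)%:E).
  have mEv : measurable_fun setT (fun p => (v p i j)%:E) by exact/measurable_EFinP.
  have mEth : measurable_fun setT (fun p => (th p i j)%:E) by exact/measurable_EFinP.
  have [mx _ _ I1 I2] := glue _ _ mEv mEth.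
  by rewrite xE; apply: laint; [exact: I1|exact: I2].
have e01 p : (0 <= e p <= 1)%R by rewrite /e indicE ler0n lern1 leq_b1.
have me : measurable_fun setT e by apply: measurable_indic; exact: measurableC.
have laO : la (~` (O : set BX)) = 0.
  have h0 : mu (~` O) + sg (~` O) = 0 by rewrite muO sgO adde0.
  by apply: (etrans (Hla _)); rewrite -[RHS]h0 -measure_addE.
have [s [c [sc Wsup]]] := convex_countable_sup cW W0.
(* Starting from the slope 0, whose intercept [c0] is nonpositive, makes all greedy integrands
   nonnegative, as monotone convergence requires. *)
pose c0 := fine (Wstar W 0).
have Wc0 : Wstar W 0 = c0%:E.
  rewrite fineK// fin_numElt; apply/andP; split.
    by apply: lt_le_trans (Fenchel_Young _ 0 W0); rewrite ltNyr.
  by apply: le_lt_trans (Wstar0_le0 W0) _; rewrite ltry.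
have c00 : (c0 <= 0)%R by rewrite -lee_fin -Wc0; exact: Wstar0_le0.
have HS' (rho : BX -> M) w : (forall i j, cc O (fun p => rho p i j)) -> bmeas w ->
    (forall p, Wstar W (rho p) <= (w p)%:E) -> \int[la]_p (pairing x e rho w p)%:E <= S%:E.
  move=> crho bw hw; apply: le_trans (HS _ _ crho bw hw).
  have Iw := bmeas_integrable_lty muoo bw.
  have [_ Ifv _] := integral_frob muoo (fun i j => cc_bmeas (crho i j)) Iv.
  have [_ Ig _] := integral_frob sgoo (fun i j => cc_bmeas (crho i j)) Ith.
  have If : mu.-integrable setT (fun p => (frob (rho p) (v p) - w p)%:E).
    under eq_fun do rewrite EFinB.
    exact: integrableB.
  have [mh e1 e2 I1 I2] := glue _ _ (measurable_int _ If) (measurable_int _ Ig).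
  have -> : (fun p => (pairing x e rho w p)%:E) = fun p =>
      if p \in N then (frob (rho p) (th p))%:E else (frob (rho p) (v p) - w p)%:E.
    apply/funext => p; rewrite /pairing /x /e indicE in_setC; case: ifP => /= _.
      by rewrite mul0r subr0.
    by rewrite mul1r.
  by rewrite laI ?e1 ?e2//; [exact: I1|exact: I2].
have gS := greedy_le HO laO Ix me e01 HS'.
have {}gS n : \int[la]_p (greedy x e s c c0 n p)%:E <= S%:E.
  by apply: gS => [|k]; rewrite ?Wc0// sc.
pose g n p := (greedy x e s c c0 n p)%:E.
have g0 n p : 0 <= g n p.
  rewrite lee_fin; elim: n => [|n IH] /=; last by rewrite le_max IH.
  by rewrite -mulrN mulr_ge0// ?oppr_ge0//; case/andP: (e01 p).
have gnd p : nondecreasing_seq (g ^~ p).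
  by apply/nondecreasing_seqP => n; rewrite lee_fin /= le_max lexx.
have mxf (y : M) : measurable_fun setT (fun p => frob y (x p)).
  apply: measurable_sum => i; apply: measurable_sum => j; apply: measurable_funM => //.
  by apply/measurable_EFinP; exact: measurable_int (Ix i j).
have mg n : measurable_fun setT (g n).
  apply/measurable_EFinP; elim: n => [|n IH] /=.
    by apply: measurableT_comp => //; apply: measurable_funM.
  by apply: measurable_maxr => //; apply: measurable_funB => //; exact: measurable_funM.
(* On [N] the factor [e p = 0] removes the intercepts, so the limit dominates the supremum of the
   linear parts, which is the recession function by [Wrec_supE]. *)
have gle p : (if p \in N then Wrec W (th p) else (W (v p))%:E) <= limn (g ^~ p).
  have cg : cvgn (g ^~ p) by exact: ereal_nondecreasing_is_cvgn.
  have gk k : (frob (s k) (x p) - e p * c k)%:E <= limn (g ^~ p).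
    apply: lime_ge => //; exists k.+1 => // n /= kn; apply: le_trans (gnd p _ _ kn).
    by rewrite lee_fin /= le_max lexx orbT.
  case: ifPn => pN.
    rewrite (Wrec_supE sc Wsup); apply: ge_ereal_sup => _ [k _ <-].
    apply: le_trans (gk k); rewrite lee_fin /x /e indicE in_setC pN /= mul0r subr0//.
  apply/lee_addgt0Pr => eps e0; have [k Hk] := Wsup (v p) eps e0.
  have := gk k; rewrite /x /e indicE in_setC (negbTE pN) /= mul1r.
  move=> /(leeD2r eps%:E); apply: le_trans; rewrite -EFinD lee_fin; lra.
have mW : measurable_fun setT (fun p => (W (v p))%:E).
  by apply/measurable_EFinP; exact: measurable_convex.
have mWr : measurable_fun setT (fun p => Wrec W (th p)) by exact: measurable_Wrec.
have [mh e1 e2 _ _] := glue _ _ mW mWr.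
rewrite -e1 -e2 -laE//; last first.
  by move=> p; case: ifP => _; [exact: Wrec_ge0|rewrite lee_fin].
apply: (@le_trans _ _ (\int[la]_p limn (g ^~ p))).
  apply: ge0_le_integral => //.
  - by move=> p _; case: ifP => _; [exact: Wrec_ge0|rewrite lee_fin].
  - by apply: (emeasurable_fun_cvg g) => // p _; exact: ereal_nondecreasing_is_cvgn.
rewrite monotone_convergence//; apply: lime_le; last exact: nearW.
apply: ereal_nondecreasing_is_cvgn => n m nm; apply: ge0_le_integral => // p _; exact: gnd.
Qed.
End Rockafellar.

(** * The Hahn-Banach functional and its properties *)

Section DualFunctional.
Context {R : realType} {d q : nat}.
Local Notation X := (@Xsp R d q).
Local Notation BX := (@BorelX R d q).
Local Notation M := 'M[R]_(q, d).
Local Notation bmeas := (@bmeas _ BX R).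

Lemma Ck_scaler (V W : normedModType R) k a (f : V -> W) : Ck k f -> Ck k (fun p => a *: f p).
Proof.
elim: k f => [|k IH] f; first by move=> cf x; apply: cvgZl_tmp; exact: cf.
move=> Cf; have [df Df] := Cf; split; first by move=> p; exact: differentiableZ.
move=> w; have -> : (fun p => derive (fun p => a *: f p) p w) = (fun p => a *: 'D_w f p).
  by apply/funext => p; exact: (deriveZ a (Ck_derivable Cf)).
exact/IH/Df.
Qed.

Lemma derive_lin (V W : normedModType R) a (f g : V -> W) p w : Ck 1 f -> Ck 1 g ->
  'D_w (fun p => a *: f p + g p) p = a *: 'D_w f p + 'D_w g p.
Proof.
move=> Cf Cg; apply: etrans (deriveD (Ck_derivable (Ck_scaler a Cf)) (Ck_derivable Cg)) _.
by congr (_ + _); exact: (deriveZ a (Ck_derivable Cf)).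
Qed.

Lemma grady_lin a (f g : X -> 'rV[R]_d) p : Ck 1 f -> Ck 1 g ->
  grady (fun p => a *: f p + g p) p = a *: grady f p + grady g p.
Proof. by move=> Cf Cg; apply/matrixP => i j; rewrite !mxE derive_lin// !mxE. Qed.

Lemma divx_lin a (f g : X -> 'rV[R]_d) p : Ck 1 f -> Ck 1 g ->
  divx (fun p => a *: f p + g p) p = a * divx f p + divx g p.
Proof.
move=> Cf Cg; rewrite mulr_sumr -big_split; apply: eq_bigr => j _ /=.
by rewrite derive_lin// !mxE.
Qed.

Definition test (O : set X) (f : X -> 'rV[R]_d) := Ck 1 f /\ compact_support_in O f.

Lemma test_lin (O : set X) a f g : test O f -> test O g -> test O (fun p => a *: f p + g p).
Proof.
move=> [Cf /compact_support_inP[K [cK KO fK]]] [Cg /compact_support_inP[L [cL LO gL]]].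
split; first exact: CkD (Ck_scaler a Cf) Cg.
apply/compact_support_inP; exists (K `|` L); split; [exact: compactU|by move=> p [/KO|/LO]|].
by move=> p /not_orP[nK nL]; rewrite fK// gL// scaler0 addr0.
Qed.

Lemma test_scale (O : set X) a f : test O f -> test O (fun p => a *: f p).
Proof.
move=> [Cf /compact_support_inP[K [cK KO fK]]]; split; first exact: Ck_scaler.
by apply/compact_support_inP; exists K; split => // p nK; rewrite fK// scaler0.
Qed.

Lemma grady_scale a (f : X -> 'rV[R]_d) p : Ck 1 f ->
  grady (fun p => a *: f p) p = a *: grady f p.
Proof.
move=> Cf; apply/matrixP => i j; rewrite !mxE.
by have -> := deriveZ a (Ck_derivable (p := p) (v := (0, delta_mx 0 i)) Cf); rewrite mxE.
Qed.

Lemma divx_scale a (f : X -> 'rV[R]_d) p : Ck 1 f ->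
  divx (fun p => a *: f p) p = a * divx f p.
Proof.
move=> Cf; rewrite mulr_sumr; apply: eq_bigr => j _ /=.
by have -> := deriveZ a (Ck_derivable (p := p) (v := (delta_mx 0 j, 0)) Cf); rewrite mxE.
Qed.

Lemma test0 (O : set X) : test O (fun=> 0).
Proof.
split; first exact: Ck_cst.
by apply/compact_support_inP; exists set0; split => //; exact: compact0.
Qed.

Lemma grady0 p : grady (fun=> 0 : 'rV[R]_d) p = 0 :> M.
Proof. by apply/matrixP => i j; rewrite !mxE derive_cst mxE. Qed.

Lemma divx0 (p : X) : divx (fun=> 0 : 'rV[R]_d) p = 0.
Proof. by rewrite /divx big1// => j _; rewrite derive_cst mxE. Qed.

Lemma linear_on_sum (V : lmodType R) (D : set V) (l : V -> R) (I : Type) (s : seq I) (F : I -> V) :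
  subspace_set D -> linear_on D l -> (forall i, D (F i)) ->
  D (\sum_(i <- s) F i) /\ l (\sum_(i <- s) F i) = \sum_(i <- s) l (F i).
Proof.
move=> [D0 DD] ll DF; have l0 : l 0 = 0.
  by have := ll 1 0 0 D0 D0; rewrite scale1r mul1r addr0 => h; lra.
elim: s => [|i s [IH1 IH2]]; first by rewrite !big_nil.
rewrite !big_cons; split; first by rewrite -[F i]scale1r; exact: DD.
by rewrite -[in LHS](scale1r (F i)) ll// mul1r IH2.
Qed.

Definition cc_field (O : set X) : set (X -> M) :=
  [set r | forall i j, cc O (fun p => r p i j)].

Lemma subspace_cc_field (O : set X) : subspace_set (cc_field O).
Proof.
split; first by move=> i j; under eq_fun do rewrite mxE; exact: cc0.
move=> a x y Dx Dy i j; under eq_fun do rewrite !mxE.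
by apply: ccD => //; exact: ccZ.
Qed.

Variables (Om : set 'rV[R]_d) (W : M -> R) (m : {finite_measure set BX -> \bar R}) (S : R).
Local Notation O := (@cyl R d q Om).
Hypothesis aB : AssumptionB W.
Hypothesis HK : forall phi w, test O phi -> bmeas w ->
  (forall p, (Wstar W (grady phi p) <= (w p)%:E)%E) ->
  0 <= S + rint m (fun p => divx phi p + w p).

Local Notation D := (cc_field O).

(* The epigraph of the inf-convolution whose linear minorants are the admissible
   fluxes: minorizing at [r = - t *: grady phi] forces the continuity equation. *)
Let C (r : X -> M) (c : R) := exists phi w, [/\ test O phi, bmeas w,
  forall p, (Wstar W (r p + grady phi p) <= (w p)%:E)%E &
  S + rint m (fun p => divx phi p + w p) <= c].

Let subD := subspace_cc_field O.

Let bdivx phi : test O phi -> bmeas (divx phi).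
Proof. by move=> [C1 C2]; exact: bmeas_divx C1 C2. Qed.

Let convC t x y c c' : 0 <= t <= 1 -> C x c -> C y c' ->
  C (t *: x + (1 - t) *: y) (t * c + (1 - t) * c').
Proof.
move=> t01 [phi [w [Tphi bw Hw Hc]]] [psi [z [Tpsi bz Hz Hc']]].
have /andP[t0 t1] := t01.
exists (fun p => t *: phi p + (1 - t) *: psi p), (fun p => t * w p + (1 - t) * z p).
have Tpsi' := test_scale (1 - t) Tpsi.
have bm a (f : BX -> R) : bmeas f -> bmeas (fun p => a * f p).
  by move=> bf; apply: bmeasM => //; exact: bmeas_cst.
have Tp : test O (fun p => t *: phi p + (1 - t) *: psi p).
  exact: test_lin.
have divE p : divx (fun p => t *: phi p + (1 - t) *: psi p) p = t * divx phi p + (1 - t) * divx psi p.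
  rewrite divx_lin; [|exact: Tphi.1|exact: Tpsi'.1].
  by rewrite divx_scale//; exact: Tpsi.1.
have gradE p : grady (fun p => t *: phi p + (1 - t) *: psi p) p = t *: grady phi p + (1 - t) *: grady psi p.
  rewrite grady_lin; [|exact: Tphi.1|exact: Tpsi'.1].
  by rewrite grady_scale//; exact: Tpsi.1.
split => //.
- by apply: bmeasD; exact: bm.
- move=> p; rewrite gradE.
  have -> : (t *: x + (1 - t) *: y) p + (t *: grady phi p + (1 - t) *: grady psi p) =
    (1 - (1 - t)) *: (x p + grady phi p) + (1 - t) *: (y p + grady psi p).
    by rewrite !scalerDr subKr addrACA.
  have -> : t * w p = (1 - (1 - t)) * w p by rewrite subKr.
  by apply: Wstar_le_convex; [lra|exact: Hw|exact: Hz].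
under [X in rint m X]eq_fun do rewrite divE addrACA -!mulrDr.
have [b1 b2] : bmeas (fun p => divx phi p + w p) /\ bmeas (fun p => divx psi p + z p).
  by split; apply: bmeasD => //; exact: bdivx.
rewrite rintD ?rintZ//; [|exact: bm|exact: bm].
have := ler_wpM2l t0 Hc; have := ler_wpM2l (_ : 0 <= 1 - t) Hc'; rewrite subr_ge0 => /(_ t1).
lra.
Qed.

Let C0 c : C 0 c -> 0 <= c.
Proof.
move=> [phi [w [Tphi bw Hw Hc]]]; apply: le_trans Hc; apply: HK => // p.
by rewrite -[grady phi p]add0r; exact: Hw.
Qed.

Let absC c0 K : (forall r : M, (forall i j, `|r i j| <= c0) -> (Wstar W r <= K%:E)%E) ->
  forall r : X -> M, (forall p i j, `|r p i j| <= c0) -> C r (S + rint m (fun=> K)).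
Proof.
move=> HW r rb; exists (fun=> 0), (fun=> K); split.
- exact: test0.
- exact: bmeas_cst.
- by move=> p; rewrite grady0 addr0; exact: HW.
- by under eq_fun do rewrite divx0 add0r.
Qed.

(** A field in [D] is bounded, so a small multiple has all entries in the range where [Wstar] is
    bounded. *)
Let finC x : D x -> exists t c, 0 < t /\ C (t *: x) c.
Proof.
move=> Dx; have [c0 [K [c00 HW]]] := Wstar_near0 aB.
have [B HB] : exists B : R, forall p i j, `|x p i j| <= B.
  have [B [B0 HB]] : exists B : 'I_q -> 'I_d -> R, (forall i j, 0 <= B i j) /\
      forall p i j, `|x p i j| <= B i j.
    have hb (ij : 'I_q * 'I_d) : exists B : R, 0 <= B /\ forall p, `|x p ij.1 ij.2| <= B.
      by have [B B0 HB] := cc_bounded (Dx ij.1 ij.2); exists B.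
    have [B HB] := choice hb; exists (fun i j => B (i, j)); split=> [i j|p i j].
      exact: (HB (i, j)).1.
    exact: (HB (i, j)).2.
  exists (\sum_i \sum_j B i j) => p i j; apply: le_trans (HB p i j) _.
  rewrite (bigD1 i)//= (bigD1 j)//= -addrA lerDl addr_ge0// sumr_ge0// => k _.
  by rewrite sumr_ge0.
have B1 : 0 < `|B| + 1 by rewrite ltr_wpDl.
exists (c0 / (`|B| + 1)), (S + rint m (fun=> K)); split; first exact: divr_gt0.
apply: absC HW _ _ => p i j; rewrite mxE normrM gtr0_norm ?divr_gt0//.
rewrite mulrAC ler_pdivrMr// ler_wpM2l ?(ltW c00)//.
by apply: le_trans (HB p i j) _; rewrite (le_trans (ler_norm _))// lerDl.
Qed.

Lemma dual_functional : exists l : (X -> M) -> R,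
  [/\ linear_on D l,
      forall r w, D r -> bmeas w -> (forall p, (Wstar W (r p) <= (w p)%:E)%E) -> l r <= S + rint m w,
      forall phi, test O phi -> l (grady phi) = - rint m (divx phi) &
      exists2 K : R, 0 <= K & forall i j f B, cc O f -> (forall p, `|f p| <= B) ->
        l (fun p => f p *: delta_mx i j) <= K * B].
Proof.
have [l [ll lC]] := convex_linear_minorant subD convC C0 finC.
have [D0 DD] := subD.
have l0 : l 0 = 0 by have := ll 1 0 0 D0 D0; rewrite scale1r mul1r addr0 => h; lra.
have lZ a r : D r -> D (a *: r) /\ l (a *: r) = a * l r.
  move=> Dr; split; first by rewrite -[a *: r]addr0; exact: DD.
  by rewrite -[in LHS](addr0 (a *: r)) ll// l0 addr0.
have [c0 [K [c00 HW]]] := Wstar_near0 aB.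
exists l; split => //.
- move=> r w Dr bw Hw; apply: lC => //; exists (fun=> 0), w; split => //; first exact: test0.
    by move=> p; rewrite grady0 addr0.
  by under [X in rint m X]eq_fun do rewrite divx0 add0r.
- move=> phi Tphi.
  have Dg : D (grady phi) by move=> i j; exact: cc_grady Tphi.1 Tphi.2.
  (* The test function [t *: phi] cancels the gradient, so [w = 0] is admissible. As [t] takes both
     signs, an affine function of [t] is bounded below and its slope
     [l (grady phi) + rint m (divx phi)] must vanish. *)
  have key t : - t * l (grady phi) <= S + t * rint m (divx phi).
    have [DN <-] := lZ (- t) _ Dg; apply: lC => //.
    exists (fun p => t *: phi p), (fun=> 0); split.
    + exact: test_scale.
    + exact: bmeas_cst.
    + move=> p; rewrite grady_scale; last exact: Tphi.1.
      by rewrite scaleNr addNr; apply: Wstar0_le0; case: aB.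
    + rewrite -rintZ; last exact: bdivx.
      rewrite lerD2l; apply: rint_le => [||p].
      * apply: bmeasD; last exact: bmeas_cst.
        by apply: bdivx; exact: test_scale.
      * by apply: bmeasM; [exact: bmeas_cst|exact: bdivx].
      * by rewrite divx_scale ?addr0//; exact: Tphi.1.
  apply/eqP; rewrite -addr_eq0; apply/negPn/negP => z0.
  set z := l _ + _ in z0.
  have := divfK z0 (`|S| + 1); have := key (- ((`|S| + 1) / z)); have := ler_norm S.
  by rewrite opprK mulNr /z; move: (_ / _) => t; rewrite mulrDr; lra.
(* A field with entries at most [B], scaled by [c0 / B], enters the range where [Wstar] is at most
   the constant [K]; undoing the scaling gives this norm. *)
exists (`|S + rint m (fun=> K)| / c0); first by rewrite divr_ge0// ltW.
move=> i j f B cf fB; pose r p : M := f p *: delta_mx i j.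
have rE p i' j' : r p i' j' = f p * ((i' == i) && (j' == j))%:R by rewrite !mxE.
have Dr : D r by move=> i' j'; under eq_fun do rewrite rE mulrC; exact: ccZ.
have B0 : 0 <= B by apply: le_trans (fB point).
have le_rB p i' j' : `|r p i' j'| <= B.
  by rewrite rE normrM normr_nat; apply: le_trans (fB p); rewrite ler_piMr// lern1 leq_b1.
change (l r <= `|S + rint m (fun=> K)| / c0 * B).
have [B00|B0'] := eqVneq B 0.
  rewrite B00 mulr0 (_ : r = 0) ?l0//; apply/funext => p; apply/matrixP => i' j'.
  by have := le_rB p i' j'; rewrite B00 normr_le0 => /eqP ->; rewrite mxE.
have Bp : 0 < B by rewrite lt_def B0' B0.
have t0 : 0 < c0 / B by exact: divr_gt0.
have [DN HN] := lZ (c0 / B) _ Dr.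
have : l ((c0 / B) *: r) <= S + rint m (fun=> K).
  apply: lC => //; apply: absC HW _ _ => p i' j'; rewrite mxE normrM gtr0_norm//.
  by rewrite mulrAC ler_pdivrMr// ler_wpM2l// ltW.
rewrite HN => h; rewrite mulrAC ler_pdivlMr// -(ler_pM2r (_ : 0 < B^-1)) ?invr_gt0//.
rewrite mulfK//; apply: le_trans (ler_norm _); apply: le_trans h.
by rewrite le_eqVlt; apply/orP; left; apply/eqP; field.
Qed.
End DualFunctional.

(** * Charges from the functional, and conclusion of strong duality *)

Section StrongDuality.
Context {R : realType} {d q : nat}.
Local Notation X := (@Xsp R d q).
Local Notation BX := (@BorelX R d q).
Local Notation M := 'M[R]_(q, d).
Local Notation bmeas := (@bmeas _ BX R).
Variables (Om : set 'rV[R]_d) (W : M -> R).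
Local Notation O := (@cyl R d q Om).
Local Open Scope ereal_scope.

Lemma sum_frob_delta (r : X -> M) : r = (\sum_i \sum_j (fun p => r p i j *: delta_mx i j))%R.
Proof.
apply/funext => p; rewrite {1}[r p](matrix_sum_delta (r p)) fct_sumE; apply: eq_bigr => i _.
by rewrite fct_sumE.
Qed.

(** The representation theorem is applied to each matrix entry separately, to [l] on multiples of
    [delta_mx i j]; linearity of [l] on [cc_field O] reassembles the entries. *)
Lemma dual_charge (m : {finite_measure set BX -> \bar R}) (S : R) : open Om -> AssumptionB W ->
  (forall phi w, test O phi -> bmeas w ->
     (forall p, Wstar W (grady phi p) <= (w p)%:E) ->
     (0 <= S + rint m (fun p => divx phi p + w p))%R) ->
  exists J : 'I_q -> 'I_d -> {charge set BX -> \bar R},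
  [/\ forall i j, charge_on (J i j) O,
      forall phi, test O phi ->
        \sum_i \sum_j charge_int (J i j) (fun p => grady phi p i j) = (- rint m (divx phi))%:E &
      forall (rho : BX -> M) w, (forall i j, cc O (fun p => rho p i j)) -> bmeas w ->
        (forall p, Wstar W (rho p) <= (w p)%:E) ->
        \sum_i \sum_j charge_int (J i j) (fun p => rho p i j) <= (S + rint m w)%:E].
Proof.
move=> oOm aB HK; have [l [ll lW lphi [K K0 lK]]] := dual_functional aB HK.
have HO := open_cyl (q := q) oOm.
pose lij i j (f : X -> R) := l (fun p => f p *: delta_mx i j : M)%R.
have Dij i j f : cc O f -> forall i' j', cc O (fun p => (f p *: delta_mx i j : M) i' j').
  by move=> cf i' j'; under eq_fun do rewrite !mxE mulrC; exact: ccZ.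
have repr i j : exists A B : {finite_measure set BX -> \bar R},
    (forall S' : set X, S' `<=` ~` O -> A S' = 0 /\ B S' = 0) /\
    forall f, cc O f -> (lij i j f)%:E = \int[A]_x (f x)%:E - \int[B]_x (f x)%:E.
  have [|f B cf fB|A [B [[Aoo Boo] ABO ABE]]] := @signed_riesz R X O (lij i j) K K0 HO (@open_exhaustion R d q).
  - move=> a f g cf cg; rewrite /lij -ll; [|exact: Dij|exact: Dij].
    by congr l; apply/funext => p; rewrite scalerDl -scalerA.
  - exact: lK.
  have [A' HA'] := finite_measure_of Aoo; have [B' HB'] := finite_measure_of Boo.
  exists A', B'; split => [S' HS'|f cf].
    by have [h1 h2] := ABO _ HS'; split; [apply: etrans (HA' _) h1|apply: etrans (HB' _) h2].
  rewrite ABE//; congr (_ - _).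
    by apply: eq_measure_integral => S' _ _; exact/esym/HA'.
  by apply: eq_measure_integral => S' _ _; exact/esym/HB'.
have [AB HAB] := choice (fun ij : 'I_q * 'I_d => repr ij.1 ij.2).
have {}[B HB] := choice HAB.
pose J i j : {charge set BX -> \bar R} :=
  cadd (charge_of_finite_measure (AB (i, j))) (cscale (-1) (charge_of_finite_measure (B (i, j)))).
have JE i j S' : J i j S' = AB (i, j) S' - B (i, j) S'.
  rewrite /J /= /cadd /cscale. by congr (_ + _); exact: mulN1e.
have JI i j f : cc O f -> charge_int (J i j) f = (lij i j f)%:E.
  move=> cf; rewrite (charge_int_sub (cc_bmeas cf) (fun S' _ => JE i j S')).
  by rewrite (HB (i, j)).2.
have lsum (r : X -> M) : (forall i j, cc O (fun p => r p i j)) ->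
    \sum_i \sum_j charge_int (J i j) (fun p => r p i j) = (l r)%:E.
  move=> cr; under eq_bigr => i _ do under eq_bigr => j _ do rewrite JI//.
  under eq_bigr do rewrite sumEFin.
  rewrite sumEFin; congr EFin; rewrite [r in RHS]sum_frob_delta.
  have sD := @subspace_cc_field R d q O.
  have Drij i j : cc_field O (fun p => r p i j *: delta_mx i j : M)%R by exact: Dij.
  have Dri i := linear_on_sum (index_enum 'I_d) sD ll (Drij i).
  have [_ ->] := linear_on_sum (index_enum 'I_q) sD ll (fun i => (Dri i).1).
  by apply: eq_bigr => i _; rewrite (Dri i).2.
exists J; split.
- move=> i j S' mS SO; rewrite JE; have [-> ->] := (HB (i, j)).1 _ SO.
  by rewrite sube0.
- by move=> phi Tphi; rewrite lsum ?lphi// => i j; exact: cc_grady Tphi.1 Tphi.2.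
- by move=> rho w crho bw Hw; rewrite lsum// lee_fin; exact: lW.
Qed.

Lemma strong_duality (mu : {measure set BX -> \bar R}) : open Om -> AssumptionB W ->
  mu setT < +oo -> mu (~` (O : set BX)) = 0 -> TEul Om W mu <= dual_value Om W mu.
Proof.
move=> oOm aB muoo muO; have [W0 cW _] := aB; have HO := open_cyl (q := q) oOm.
have [m Hm] := finite_measure_of muoo.
have mint f : \int[m]_p f p = \int[mu]_p f p.
  by apply: eq_measure_integral => A _ _; exact: Hm.
(* The zero test function excludes the value [-oo]; for [+oo] there is nothing to prove. *)
have dual0 : 0 <= dual_value Om W mu.
  pose z : X -> 'rV[R]_d := fun=> 0%R.
  have [Tz1 Tz2] := test0 O.
  apply: (@le_trans _ _ (- \int[mu]_p ((divx z p)%:E + Wstar W (grady z p)))).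
    under eq_integral do rewrite divx0 grady0 add0e.
    by rewrite integral_cst// oppe_ge0 mule_le0_ge0// Wstar0_le0.
  apply: ereal_sup_ubound; exists z => //; split => // p _.
  by rewrite grady0; apply: le_lt_trans (Wstar0_le0 W0) _; rewrite ltry.
case E : (dual_value Om W mu) dual0 => [S| |] // _; last by rewrite leey.
(* The dual value bounds the integral of [Wstar] itself, so the majorant [w] is lowered to the least
   one, [w0], which is bounded because it lies between [- W 0] and [w]. *)
have HK phi w : test O phi -> bmeas w ->
    (forall p, Wstar W (grady phi p) <= (w p)%:E) ->
    (0 <= S + rint m (fun p => divx phi p + w p)%R)%R.
  move=> [C1 C2] bw Hw.
  have Wfin p : Wstar W (grady phi p) \is a fin_num.
    rewrite fin_numElt; apply/andP; split.
      by apply: lt_le_trans (Fenchel_Young _ 0%R W0); rewrite ltNyr.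
    by apply: le_lt_trans (Hw p) _; rewrite ltry.
  pose w0 (p : BX) := fine (Wstar W (grady phi p)).
  have w0E p : (w0 p)%:E = Wstar W (grady phi p) by rewrite fineK.
  have w0w p : (w0 p <= w p)%R by rewrite -lee_fin w0E.
  have w0W p : (- W 0 <= w0 p)%R.
    rewrite -lee_fin w0E; apply: le_trans (Fenchel_Young _ 0%R W0).
    by rewrite lee_fin frob0r sub0r.
  have bd := bmeas_divx C1 C2.
  have bw0 : bmeas w0.
    split.
      apply/measurable_EFinP; apply: (eq_measurable_fun (fun p : BX => Wstar W (grady phi p))) => [p _|].
        by rewrite /= w0E.
      by apply: measurable_Wstar => // i j; have [] := bmeas_grady i j C1 C2.
    have [B HB] := bw.2; exists (`|W 0| + B)%R => p.
    move: (HB p) (w0w p) (w0W p) (ler_norm (W 0)) (normr_ge0 (W 0)) (ler_norm (w p)) (normr_ge0 (w p)).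
    by move=> ? ? ? ? ? ? ?; rewrite ler_norml; apply/andP; split; lra.
  have : - (\int[mu]_p ((divx phi p)%:E + Wstar W (grady phi p))) <= S%:E.
    by rewrite -E; apply: ereal_sup_ubound; exists phi => //; split => // p _; rewrite -w0E ltry.
  rewrite -mint; under eq_integral do rewrite -w0E -EFinD.
  rewrite -rintE; last exact: bmeasD.
  rewrite -EFinN lee_fin => h.
  have := rint_le m (bmeasD bd bw0) (bmeasD bd bw) (fun p => lerD (lexx _) (w0w p)).
  lra.
have [J [JO Jphi Jrho]] := dual_charge oOm aB HK.
have [v [sg [th RN]]] := RN_decomp_exists J muoo.
have [Hv sgoo HN0 [N [mN muN sgN]] HA] := RN.
have Iv i j : mu.-integrable setT (fun p => (v p i j)%:E) by have [] := Hv i j.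
have mth i j : measurable_fun setT (fun p => th p i j) by have [] := Hv i j.
have Ith i j := theta_integrable i j sgoo mth HN0.
(* Admissible fields vanish off the cylinder and could not detect singular mass there, so its
   absence has to be proved from the charges. *)
have sgO : sg (~` (O : set BX)) = 0.
  apply: (RN_decomp_singular_null RN) => //.
  by apply: measurableC; exact: open_borel.
apply: (@le_trans _ _ (BW W mu J)).
  apply: ereal_inf_lbound; exists J => //; split => // phi sphi Sphi.
  have Tphi : test O phi by split => //; exact: sphi.
  rewrite Jphi// -mint -rintE; first by rewrite -EFinD subrr.
  exact: bmeas_divx Tphi.1 Tphi.2.
apply: (@le_trans _ _ (\int[mu]_p (W (v p))%:E + \int[sg]_p Wrec W (th p))).
  by apply: ereal_inf_lbound; exists v, sg, th.
apply: (rockafellar HO cW W0 muoo sgoo muO sgO Iv Ith mN muN sgN) => rho w crho bw Hw.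
have := Jrho rho w crho bw Hw.
have brho i j := cc_bmeas (crho i j).
under eq_bigr => i _ do (under eq_bigr => j _ do
  rewrite (charge_int_RN muoo sgoo (brho i j) (Iv i j) (Ith i j) (fun S' mS => HA S' mS i j));
  rewrite big_split /=).
have [_ Iv' Ev] := integral_frob muoo brho Iv; have [_ Ith' Eth] := integral_frob sgoo brho Ith.
rewrite big_split /= -Ev -Eth.
have Iw := bmeas_integrable_lty muoo bw.
under [in X in _ -> X]eq_integral do rewrite EFinB.
rewrite integralB//.
rewrite EFinD rintE// mint.
have /fineK <- := integrable_fin_num measurableT Iv'.
have /fineK <- := integrable_fin_num measurableT Ith'.
have /fineK <- := integrable_fin_num measurableT Iw.
by rewrite -!EFinD !lee_fin; lra.
Qed.
End StrongDuality.

Theorem mainTheorem3 (R : realType) (d q : nat) (Om : set 'rV[R]_d)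
  (lam : {measure set @BorelRV R d -> \bar R})
  (W : 'M[R]_(q, d) -> R)
  (mu : {measure set @BorelX R d q -> \bar R}) :
  open Om -> bounded_set Om ->
  is_lebesgue lam ->
  AssumptionB W ->
  marginal_leb Om lam mu ->
  TEul Om W mu = dual_value Om W mu.
Proof.
move=> oOm _ _ aB [muoo muO _]; have [W0 cW _] := aB.
by apply/eqP; rewrite eq_le strong_duality// weak_duality.
Qed.
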